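(* There exists a nonempty bounded pseudoconvex domain $\Omega$ in $\mathbb{C}^2$ with boundary of class $\mathcal{C}^{1,1}$ such that: (i) $\overline{\Omega}$ has a Stein neighborhood basis; (ii) $\overline{\Omega}$ is not $s$-H-convex for any real number $s\geq 1$.
   Context: Given a real number $s\geq 1$, a nonempty compact set $K\subseteq\mathbb{C}^n$ is called $s$-H-convex if there exists $C$ with $0<C\leq 1$ such that for all $\epsilon$ with $0<\epsilon\leq 1$ there exists an open pseudoconvex subset $\Omega_\epsilon$ of $\mathbb{C}^n$ satisfying $$\{z\in\mathbb{C}^n : d(z,K)<C\epsilon^s\}\subseteq\Omega_\epsilon\subseteq\{z\in\mathbb{C}^n : d(z,K)<\epsilon\},$$ where $d(\cdot,K)$ is the Euclidean distance to $K$. A compact set $K\subseteq\mathbb{C}^n$ has a Stein neighborhood basis if every open neighborhood of $K$ contains an open pseudoconvex set containing $K$; equivalently, for every $\epsilon>0$ there is an open pseudoconvex set $D$ with $K\subseteq D\subseteq\{z : d(z,K)<\epsilon\}$. An open set $\emptyset\subsetneq U\subsetneq\mathbb{R}^k$ has boundary of class $\mathcal{C}^{1,1}$ if for every boundary point $p$ of $U$ there exist an open neighborhood $V$ of $p$ in $\mathbb{R}^k$ and a function $r\colon V\to\mathbb{R}$ of class $\mathcal{C}^{1,1}$ such that $\nabla r$ vanishes nowhere on $V$ and $U\cap V=\{x\in V : r(x)<0\}$. Here $\mathbb{C}^2$ is identified with $\mathbb{R}^4$. A domain is a connected open set. *)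

(* Defs.v *)
From HB Require Import structures.
From mathcomp Require Import all_boot all_order all_algebra.
From mathcomp Require Import all_classical all_reals all_analysis.
From mathcomp Require Import complex.

Set Implicit Arguments.
Unset Strict Implicit.
Unset Printing Implicit Defensive.

Import Order.TTheory GRing.Theory Num.Theory.
Import numFieldNormedType.Exports.

Local Open Scope classical_set_scope.
Local Open Scope complex_scope.
Local Open Scope ring_scope.

(* C^n as row vectors over R[i].  The cast to numFieldType is what lets
   type inference find the canonical (product) topology. *)
Notation Cspace R n := 'rV[(complex R : numFieldType)]_n.

Section ComplexSpace.
Context {R : realType} {n : nat}.
Implicit Types (z w : Cspace R n) (K D : set (Cspace R n)).

(* The library norm on row vectors is the sup norm; distances below are
   measured with the Euclidean norm. *)
Definition euclidean_norm z : R :=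
  Num.sqrt (\sum_(i < n) (complex.Re (z 0 i) ^+ 2 + complex.Im (z 0 i) ^+ 2)).

(* Meaningful for nonempty K only: the infimum of the empty set is 0. *)
Definition euclidean_dist z K : R := inf [set euclidean_norm (z - w) | w in K].

Definition expi (t : R) : R[i] := cos t +i* sin t.

(* The usual notion on an open set D: [-oo, +oo[-valued, upper semicontinuous,
   and satisfying the sub-mean value inequality on every closed disc of a
   complex line that is contained in D.  The values of u off D are
   irrelevant. *)
Definition plurisubharmonic D (u : Cspace R n -> \bar R) : Prop :=
  [/\ forall z, D z -> (u z < +oo)%E,
      forall z (a : R), D z -> (u z < a%:E)%E ->
        \forall w \near z, D w -> (u w < a%:E)%E
    & forall z w,
        (forall t : R[i], `|t| <= 1 -> D (z + t *: w)) ->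
        (u z <= ((2 * pi)^-1)%:E *
          \int[lebesgue_measure]_(t in `[0%R, (2 * pi)%R])
             u (z + expi t *: w)%R)%E].

(* Existence of a continuous plurisubharmonic exhaustion function. *)
Definition pseudoconvex D : Prop :=
  exists u : Cspace R n -> R,
    [/\ {within D, continuous u},
        plurisubharmonic D (fun z => (u z)%:E)
      & forall c : R,
          let S := [set z | D z /\ u z < c] in
          compact (closure S) /\ closure S `<=` D].

(* Intended for nonempty compact K and s >= 1.  These conditions are not part
   of the predicate, so its negation cannot hold merely because they fail. *)
Definition s_H_convex (s : R) K : Prop :=
  exists2 C : R, 0 < C <= 1 &
    forall e : R, 0 < e <= 1 ->
      exists W : set (Cspace R n),
        [/\ open W, pseudoconvex W,
            [set z | euclidean_dist z K < C * e `^ s] `<=` W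
          & W `<=` [set z | euclidean_dist z K < e]].

Definition Stein_neighborhood_basis K : Prop :=
  forall U : set (Cspace R n), open U -> K `<=` U ->
    exists D : set (Cspace R n),
      [/\ open D, pseudoconvex D, K `<=` D & D `<=` U].

(* The identification of C^n with R^(2n), with coordinates ordered as
   (Re z_1, ..., Re z_n, Im z_1, ..., Im z_n). *)
Definition realify z : 'rV[R]_(n + n) :=
  row_mx (map_mx (@complex.Re R) z) (map_mx (@complex.Im R) z).

End ComplexSpace.

Section C11Boundary.
Context {R : realType} {k : nat}.
Implicit Types (U V : set 'rV[R]_k) (r : 'rV[R]_k -> R).

Definition boundary U : set 'rV[R]_k := closure U `\` interior U.

Definition gradient r (x : 'rV[R]_k) : 'rV[R]_k :=
  \row_(i < k) 'D_(delta_mx 0 i) r x.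

(* For V open: differentiable on V with locally Lipschitz gradient.  The
   values of r off V are irrelevant. *)
Definition C11_on V r : Prop :=
  (forall x, V x -> differentiable r x) /\
  (forall x, V x -> exists2 N : set 'rV[R]_k,
     nbhs x N & [lipschitz gradient r y | y in N `&` V]).

Definition C11_boundary U : Prop :=
  [/\ open U, U !=set0, U != setT
    & forall p, boundary U p ->
        exists (V : set 'rV[R]_k) (r : 'rV[R]_k -> R),
          [/\ open V, V p, C11_on V r,
              forall x, V x -> gradient r x != 0
            & U `&` V = [set x | V x /\ r x < 0]]].

End C11Boundary.

(* Main.v *)
Require Import Defs.
From HB Require Import structures.
From mathcomp Require Import all_boot all_order all_algebra.
From mathcomp Require Import all_classical all_reals all_analysis.
From mathcomp Require Import complex.
From mathcomp Require Import ring lra.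

Set Implicit Arguments.
Unset Strict Implicit.
Unset Printing Implicit Defensive.

Import Order.TTheory GRing.Theory Num.Theory.
Import numFieldNormedType.Exports.

Local Open Scope classical_set_scope.
Local Open Scope ring_scope.

(** The domain is a worm with the critical amount of winding.  Write [(z, w)] for
    the coordinates, [t = ln |z|] and [w = a + i b].  Over the circles
    [|z| = e^t] the worm is the disc

      [|w|^2 - Im (w e^(- i t)) + damping t < 0],

    whose boundary passes through [0] for [t] in the core [[0, pi]], while its
    centre [(i / 2) e^(i t)] makes a half-turn around [0].  At a distance [tau]
    outside the core, [damping] equals [sin tau ^ 2 / 4 + flat tau], where
    [flat tau = exp (2 - 1 / tau)].  It exceeds [1] for [tau >= 1 / 2], so the worm
    is bounded; it is of class C^{1,1} and has no critical point where it equals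
    [1 / 4], so the boundary is of class C^{1,1} ([worm_C11]).

    Pseudoconvexity and the Stein neighborhoods come from one family of domains,
    the tubes: for [0 < p <= 1] and [C >= 1],

      [C |zeta|^p cos (p (arg zeta - t - pi / 2)) - |zeta|^2
         - max (damping t - nu) 0 > 0],   with [zeta = w - d].

    The logarithm of the left-hand side is plurisuperharmonic, because after
    multiplication by [exp (p arg z)] the first term is the real part of a
    holomorphic function, the second one is the modulus of one and the third
    is a convex function of [t] times the modulus of one
    ([tube_level_subharmonic]); so the tubes are pseudoconvex
    ([tube_pseudoconvex]).  To avoid derivatives of the maximum and of the
    damping, plurisubharmonicity is deduced from a pointwise second-order
    inequality ([discrete_psh]).  The worm is the tube with [p = C = 1] and
    [nu = d = 0] ([worm_tube]).  Since the winding is only a half-turn, the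
    worm and its closure avoid the half-line [w >= 0], apart from [w = 0];
    moving the slit to [w >= d], opening the angle by taking [p < 1] and
    inflating by [C > 1] produces tubes that contain the closed worm and shrink
    to it ([shrinking_tubes]), whence the Stein neighborhood basis
    ([closed_worm_Stein]).

    For the negative part, consider the annuli [w = c], [- tau <= t <= pi + tau]
    with [c = sin tau / 2].  For [c = 0] the annulus is contained in the closed
    worm.  The two end circles of the others are within [4 flat tau] of the closed
    worm, a quantity that vanishes to infinite order in [c], while the middle
    circle is at a distance comparable to [c].  A pseudoconvex open set that
    contains the closed worm and the end circles for all [tau <= T] contains the
    annuli ([annuli_principle]).  So such a set within the distance [e = c / 3]
    of the closed worm cannot contain its neighborhood of radius [C e^s],
    whatever [s] and [C], once [T] is small ([worm_not_s_H_convex]). *)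

(** * The topology of C^n in real coordinates *)

Section ComplexTopology.
Context {R : realType}.
Local Notation C := (complex R : numFieldType).

Lemma Re_norm_le (z : C) (e : R) : `|z| < (e%:C)%C -> `|complex.Re z| < e.
Proof.
rewrite normc_def ltcR; apply: le_lt_trans.
by rewrite -sqrtr_sqr ler_sqrt ?lerDl ?sqr_ge0// addr_ge0 ?sqr_ge0.
Qed.

Lemma Im_norm_le (z : C) (e : R) : `|z| < (e%:C)%C -> `|complex.Im z| < e.
Proof.
rewrite normc_def ltcR; apply: le_lt_trans.
by rewrite -sqrtr_sqr ler_sqrt ?lerDr ?sqr_ge0// addr_ge0 ?sqr_ge0.
Qed.

Lemma norm_lt_ReIm (z : C) (e : R) :
  `|complex.Re z| < e -> `|complex.Im z| < e -> `|z| < ((2 * e)%:C)%C.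
Proof.
move=> re im; rewrite normc_def ltcR.
have e0 : 0 < e by apply: le_lt_trans re.
rewrite -[ltRHS]ger0_norm; last by rewrite mulr_ge0// ltW.
rewrite -sqrtr_sqr ltr_sqrt; last by rewrite exprn_gt0// mulr_gt0.
have h (x : R) : `|x| < e -> x ^+ 2 < e ^+ 2.
  by move=> xe; rewrite -real_normK ?num_real// ltr_pXn2r// nnegrE ltW.
have := h _ re; have := h _ im; have : 0 < e ^+ 2 by rewrite exprn_gt0.
nra.
Qed.

Lemma Re_sub (z w : C) : complex.Re (z - w) = complex.Re z - complex.Re w.
Proof. by case: z w => a b [c d]. Qed.
Lemma Im_sub (z w : C) : complex.Im (z - w) = complex.Im z - complex.Im w.
Proof. by case: z w => a b [c d]. Qed.

Lemma nbhs_CspaceP n (X : Cspace R n) (A : set (Cspace R n)) :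
  nbhs X A <-> exists2 e : R, 0 < e & forall Y : Cspace R n,
   (forall i, `|complex.Re (Y 0 i) - complex.Re (X 0 i)| < e /\
              `|complex.Im (Y 0 i) - complex.Im (X 0 i)| < e) -> A Y.
Proof.
split.
  move=> /nbhs_ballP[/= e e0 eA].
  move: e0; rewrite ltcE /= => /andP[/eqP e1 e0].
  exists (complex.Re e / 2); first by rewrite divr_gt0.
  move=> Y XY; apply: eA; split=> [|i j]; first by rewrite ltcE/= e1 eqxx.
  rewrite /ball /= ord1 distrC.
  have [h1 h2] := XY j.
  have := @norm_lt_ReIm (Y 0 j - X 0 j) (complex.Re e / 2).
  rewrite Re_sub Im_sub => /(_ h1 h2); congr (_ < _).
  by rewrite mulrC divfK// [in RHS](complexE e) e1; simpc.
move=> [e e0 eA]; apply/nbhs_ballP; exists (e%:C)%C.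
  by rewrite /= ltcE /= eqxx.
move=> Y [_ XY]; apply: eA => i; have := XY 0 i; rewrite /ball /= distrC => h.
by rewrite -Re_sub -Im_sub; split; [exact: Re_norm_le|exact: Im_norm_le].
Qed.

Lemma nbhs_CP (z : C) (A : set C) :
  nbhs z A <-> exists2 e : R, 0 < e & forall w : C,
   `|complex.Re w - complex.Re z| < e -> `|complex.Im w - complex.Im z| < e -> A w.
Proof.
split.
  move=> /nbhs_ballP[/= e e0 eA].
  move: e0; rewrite ltcE /= => /andP[/eqP e1 e0].
  exists (complex.Re e / 2); first by rewrite divr_gt0.
  move=> w h1 h2; apply: eA; rewrite /ball /= distrC.
  have := @norm_lt_ReIm (w - z) (complex.Re e / 2).
  rewrite Re_sub Im_sub => /(_ h1 h2); congr (_ < _).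
  by rewrite mulrC divfK// [in RHS](complexE e) e1; simpc.
move=> [e e0 eA]; apply/nbhs_ballP; exists (e%:C)%C.
  by rewrite /= ltcE /= eqxx.
move=> w; rewrite /ball /= distrC => h; apply: eA.
  by rewrite -Re_sub; exact: Re_norm_le.
by rewrite -Im_sub; exact: Im_norm_le.
Qed.

Lemma Re_continuous : continuous (@complex.Re R : C -> R).
Proof.
move=> z /= A /nbhs_ballP[e /= e0 eA]; apply/nbhs_CP; exists e => // w h _.
by apply: eA; rewrite /ball/= distrC.
Qed.

Lemma Im_continuous : continuous (@complex.Im R : C -> R).
Proof.
move=> z /= A /nbhs_ballP[e /= e0 eA]; apply/nbhs_CP; exists e => // w _ h.
by apply: eA; rewrite /ball/= distrC.
Qed.

Lemma Re_coord_continuous n (i : 'I_n) :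
  continuous (fun X : Cspace R n => complex.Re (X 0 i)).
Proof.
move=> X; apply: (@continuous_comp _ _ _ (fun X : Cspace R n => X 0 i)).
  exact: coord_continuous.
exact: Re_continuous.
Qed.

Lemma Im_coord_continuous n (i : 'I_n) :
  continuous (fun X : Cspace R n => complex.Im (X 0 i)).
Proof.
move=> X; apply: (@continuous_comp _ _ _ (fun X : Cspace R n => X 0 i)).
  exact: coord_continuous.
exact: Im_continuous.
Qed.

Lemma Cspace_continuous (T : topologicalType) n (f : T -> Cspace R n) (t : T) :
  (forall i, {for t, continuous (fun s => complex.Re (f s 0 i))}) ->
  (forall i, {for t, continuous (fun s => complex.Im (f s 0 i))}) ->
  {for t, continuous f}.
Proof.
move=> cRe cIm A /nbhs_CspaceP[e e0 eA].
have nRe i : \forall s \near t, `|complex.Re (f s 0 i) - complex.Re (f t 0 i)| < e.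
  by have /cvgr_distC_lt := cRe i; exact.
have nIm i : \forall s \near t, `|complex.Im (f s 0 i) - complex.Im (f t 0 i)| < e.
  by have /cvgr_distC_lt := cIm i; exact.
have FF := @nbhs_filter _ t.
have nRe' := @filter_forall _ _ _ _ FF nRe.
have nIm' := @filter_forall _ _ _ _ FF nIm.
change (\forall s \near t, A (f s)).
by apply: filterS2 nRe' nIm' => s hRe hIm; apply: eA => i; split; [exact: hRe|exact: hIm].
Qed.

Lemma C_continuous (T : topologicalType) (f : T -> C) (t : T) :
  {for t, continuous (fun s => complex.Re (f s))} ->
  {for t, continuous (fun s => complex.Im (f s))} ->
  {for t, continuous f}.
Proof.
move=> cRe cIm A /nbhs_CP[e e0 eA]; near=> s; apply: eA.
  by near: s; move/cvgr_distC_lt: cRe; exact.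
by near: s; move/cvgr_distC_lt: cIm; exact.
Unshelve. all: by end_near. Qed.

Lemma box_compact n (M : R) : compact [set X : Cspace R n | forall i,
  `|complex.Re (X 0 i)| <= M /\ `|complex.Im (X 0 i)| <= M].
Proof.
have cB : compact [set z : C | `|complex.Re z| <= M /\ `|complex.Im z| <= M].
  have -> : [set z : C | `|complex.Re z| <= M /\ `|complex.Im z| <= M] =
      (fun p : R * R => (p.1 +i* p.2)%C : C) @` (`[-M, M] `*` `[-M, M]).
    apply/seteqP; split.
      move=> [a b] /= [ha hb]; exists (a, b) => //=.
      by rewrite !in_itv /= -!ler_norml.
    by move=> _ [[a b] /= [ha hb] <-] /=; move: ha hb; rewrite !in_itv /= -!ler_norml.
  apply: continuous_compact; last by apply: compact_setX; exact: segment_compact.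
  apply/continuous_subspaceT => p; apply: C_continuous => /=.
    exact: cvg_fst.
  exact: cvg_snd.
by have := @rV_compact C n (fun=> [set z : C | `|complex.Re z| <= M /\ `|complex.Im z| <= M])
  (fun _ => cB).
Qed.

Lemma closed_box_compact n (M : R) (A : set (Cspace R n)) : closed A ->
  (forall X, A X -> forall i, `|complex.Re (X 0 i)| <= M /\ `|complex.Im (X 0 i)| <= M) ->
  compact A.
Proof. by move=> cA bA; apply: (subclosed_compact cA (@box_compact n M)). Qed.

End ComplexTopology.

(** * From a pointwise condition to plurisubharmonicity *)

Section SubMean.
Context {R : realType}.
Local Notation C := (complex R : numFieldType).

(** The lower Laplacian of [u] at [X], computed from the four points of a small
    cross in the complex line directed by [W], is nonnegative.  For a continuous
    function this pointwise condition is enough for plurisubharmonicity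
    ([discrete_psh]), and it survives maxima and comparison from below with
    smooth functions, so no derivative of [u] itself is ever needed. *)
Definition discrete_subharmonic n (u : Cspace R n -> R) (X W : Cspace R n) :=
  forall eta : R, 0 < eta -> exists2 r0 : R, 0 < r0 & forall r, 0 < r < r0 ->
    4 * u X - eta * r ^+ 2 <=
    u (X + (r +i* 0)%C *: W) + u (X + (- r +i* 0)%C *: W) +
    u (X + (0 +i* r)%C *: W) + u (X + (0 +i* - r)%C *: W).

Lemma expiD (a b : R) : expi (a + b) = expi a * expi b.
Proof. by rewrite /expi sinD cosD; simpc; congr (_ +i* _)%C; ring. Qed.

Lemma norm_expi (a : R) : `|expi a| = 1.
Proof. by rewrite normc_def /= cos2Dsin2 sqrtr1. Qed.

Lemma unit_circle (x y : R) : x ^+ 2 + y ^+ 2 = 1 ->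
  exists2 s, - pi <= s <= pi & (cos s = x /\ sin s = y).
Proof.
move=> xy; have x1 : -1 <= x <= 1.
  by apply/andP; split; have : 0 <= y ^+ 2 by [exact: sqr_ge0|]; nra.
have cx : cos (acos x) = x by apply: acosK; rewrite in_itv.
have sx : sin (acos x) = `|y|.
  by rewrite sin_acos// -sqrtr_sqr; congr Num.sqrt; rewrite -xy; ring.
have a0 := acos_ge0 x1; have ap := acos_lepi x1.
have [y0|y0] := leP 0 y.
  exists (acos x); first by apply/andP; split => //; lra.
  by rewrite cx sx ger0_norm.
exists (- acos x); first by apply/andP; split; lra.
by rewrite cosN sinN cx sx ltr0_norm// opprK.
Qed.

Lemma uniform_continuity (g : R -> R) (a b e : R) : continuous g -> 0 < e ->
  exists2 d : R, 0 < d & forall x y : R, a <= x <= b -> `|y - x| < d -> `|g y - g x| < e.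
Proof.
move=> cg e0.
have /compact_near_coveringP cK := @segment_compact R a b.
have nP : \forall d \near (0 : R)^'+, forall x, `[a, b]%classic x ->
    forall y, `|y - x| < d -> `|g y - g x| < e.
  apply: (cK _ _ (fun d x => forall y, `|y - x| < d -> `|g y - g x| < e)) => x _.
  have /cvgr_distC_lt/(_ (e / 2)) := cg x.
  rewrite divr_gt0// => /(_ isT) /nbhs_ballP[r /= r0 rg].
  exists (ball x (r / 2), [set d | d < r / 2]) => /=.
    by split; [apply: nbhsx_ballx; rewrite divr_gt0|apply: nbhs_right_lt; rewrite divr_gt0].
  move=> [x' d] /= [xx' dr] y yx'.
  have h1 : `|g x' - g x| < e / 2.
    by apply: rg; apply: le_ball xx'; lra.
  have h2 : `|g y - g x| < e / 2.
    apply: rg; move: xx'; rewrite /ball/= => h.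
    have := ler_distD x' x y; rewrite (distrC x' y); lra.
  have := ler_distD (g x) (g y) (g x'); rewrite (distrC (g x) (g x')); lra.
have [d [d0 dP]] : exists d : R, 0 < d /\ forall x, `[a, b]%classic x ->
    forall y, `|y - x| < d -> `|g y - g x| < e.
  apply: (@filter_ex _ (0 : R)^'+); near=> d; split.
    by near: d; exact: nbhs_right_gt.
  by near: d.
by exists d => // x y xab; apply: dP; rewrite /= in_itv.
Unshelve. all: by end_near. Qed.

Lemma cancel_weights (e p n : R) : 0 < p -> 0 < n ->
  e = 2 * p / n * (e / (2 * p)) * n.
Proof. by move=> p0 n0; field; rewrite !lt0r_neq0. Qed.

(** Uniformity in the starting point [s] is the point: the rotation angle that
    comes out of the maximum principle below is not under control. *)
Lemma periodic_riemann (g : R -> R) (e : R) : continuous g ->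
    (forall x : R, g (x + 2 * pi) = g x) -> 0 < e ->
  exists2 N : nat, (0 < N)%N & forall s : R, - pi <= s <= pi ->
    (2 * pi / N%:R) * \sum_(k < N) g (s + 2 * pi * k%:R / N%:R) <=
    \int[lebesgue_measure]_(t in `[0, 2 * pi]) (g t) + e.
Proof.
move=> cg pg e0; have p0 := pi_gt0 R.
have e1 : 0 < e / (2 * pi) by rewrite divr_gt0// mulr_gt0.
have [d d0 dg] := uniform_continuity (- pi) (3 * pi) cg e1.
pose N := (Num.truncn (2 * pi / d)).+1.
have N0 : 0 < N%:R :> R by rewrite ltr0n.
have hd : 2 * pi / N%:R < d.
  have : 2 * pi / d < N%:R by exact: truncnS_gt.
  by rewrite !ltr_pdivrMr // [d * _]mulrC.
pose G x := \int[lebesgue_measure]_(t in `[(- pi - 1), x]) (g t).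
have ig u : lebesgue_measure.-integrable `[(- pi - 1), u] (EFin \o g).
  apply: continuous_compact_integrable; first exact: segment_compact.
  exact: continuous_subspaceT.
have dG (x : R) : - pi - 1 < x -> is_derive x 1 G (g x).
  move=> ax.
  have [|dG <-] := @continuous_FTC1_closed R g (- pi - 1) x (x + 1) _ (ig _) ax (cg x).
    by rewrite ltrDl.
  by rewrite derive1E; apply: derivableP.
have cG (x : R) : - pi - 1 < x -> {for x, continuous G}.
  move=> ax; apply: differentiable_continuous; apply/derivable1_diffP.
  by have := dG _ ax => -[].
have wG (a b : R) : - pi - 1 < a -> {within `[a, b], continuous G}.
  move=> ax; apply: continuous_in_subspaceT => x; rewrite inE /= in_itv /= => /andP[xa _].
  by apply: cG; apply: lt_le_trans xa.
have intG : \int[lebesgue_measure]_(t in `[0, 2 * pi]) (g t) = G (2 * pi) - G 0.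
  rewrite /Rintegral (@continuous_FTC2 _ g G) //; first by rewrite mulr_gt0.
  - exact: continuous_subspaceT.
  - split.
    + move=> x; rewrite in_itv /= => /andP[x0 _].
      have : - pi - 1 < x by lra.
      by move/dG => [].
    + by apply: cvg_at_right_filter; apply: cG; lra.
    + by apply: cvg_at_left_filter; apply: cG; lra.
  - move=> x; rewrite in_itv /= => /andP[x0 _].
    have /dG dx : - pi - 1 < x by lra.
    by rewrite derive1E; apply: derive_val.
exists N => // s /andP[s1 s2].
have Gs : G (s + 2 * pi) - G s = G (2 * pi) - G 0.
  pose P x := G (x + 2 * pi) - G x.
  have dP (x : R) : - pi - 1 < x -> is_derive x 1 P 0.
    move=> ax; rewrite /P.
    have d1 : is_derive x 1 (fun x => G (x + 2 * pi)) (g x).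
      have /dG d2 : - pi - 1 < x + 2 * pi by lra.
      have d3 : is_derive x (1:R) (fun x : R => x + 2 * pi) 1.
        by apply: is_derive_eq; rewrite addr0.
      have := @is_derive1_comp _ G (fun x => x + 2 * pi) x _ _ d2 d3.
      by rewrite pg mulr1.
    have := dG _ ax => d2.
    have -> : 0 = g x - g x by rewrite subrr.
    exact: is_deriveB.
  have cP (a b : R) : - pi - 1 < a -> {within `[a, b], continuous P}.
    move=> ax; apply: continuous_in_subspaceT => x; rewrite inE /= in_itv /= => /andP[xa _].
    apply: differentiable_continuous; apply/derivable1_diffP.
    have /dP : - pi - 1 < x by apply: lt_le_trans xa.
    by case.
  rewrite -/(P s) -[X in G X - G 0](add0r (2 * pi)) -/(P 0).
  have dP' (a b : R) : - pi - 1 < a -> forall x : R, x \in `]a, b[%R -> is_derive x 1 P 0.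
    by move=> a1 x; rewrite in_itv /= => /andP[ax _]; apply: dP; apply: lt_trans ax.
  have [s0|s0] := leP s 0.
    have as1 : - pi - 1 < s by lra.
    have [c _] := MVT_segment s0 (dP' _ _ as1) (cP _ _ as1).
    by rewrite mul0r => /eqP; rewrite subr_eq0 => /eqP ->.
  have as1 : - pi - 1 < 0 :> R by lra.
  have [c _] := MVT_segment (ltW s0) (dP' _ _ as1) (cP _ _ as1).
  by rewrite mul0r => /eqP; rewrite subr_eq0 => /eqP ->.
rewrite intG -Gs.
pose x k : R := s + 2 * pi * k%:R / N%:R.
have xS k : x k.+1 = x k + 2 * pi / N%:R.
  by rewrite /x -natr1; field; rewrite lt0r_neq0.
have -> : G (s + 2 * pi) - G s = \sum_(k < N) (G (x k.+1) - G (x k)).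
  rewrite -(big_mkord xpredT (fun k => G (x k.+1) - G (x k))) telescope_sumr //.
  rewrite /x mulr0 mul0r addr0; congr (G (s + _) - _).
  by field; rewrite lt0r_neq0.
have -> : e = \sum_(k < N) (2 * pi / N%:R * (e / (2 * pi))).
  by rewrite sumr_const card_ord -[RHS]mulr_natr; apply: cancel_weights.
rewrite mulr_sumr -big_split /=; apply: ler_sum => k _.
have h0 : 0 < 2 * pi / N%:R :> R by apply: divr_gt0 => //; apply: mulr_gt0.
have xk : x k < x k.+1 by rewrite xS ltrDl.
have ax : - pi <= x k.
  by rewrite /x; apply: le_trans s1 _; rewrite lerDl divr_ge0// mulr_ge0// mulr_ge0// ltW.
have xb : x k <= 3 * pi.
  have : 2 * pi * k%:R / N%:R <= 2 * pi :> R.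
    rewrite ler_pdivrMr// ler_pM2l ?mulr_gt0// ler_nat ltnW//.
  by rewrite /x; lra.
have ax1 : - pi - 1 < x k by lra.
have dk : forall y : R, y \in `]x k, x k.+1[%R -> is_derive y 1 G (g y).
  by move=> y; rewrite in_itv /= => /andP[y1 _]; apply: dG; apply: lt_trans y1.
have [c] := MVT xk dk (wG _ _ ax1).
rewrite in_itv /= => /andP[c1 c2] ->.
rewrite xS addrAC subrr add0r [g c * _]mulrC -mulrDr ler_pM2l//.
have : `|c - x k| < d.
  rewrite gtr0_norm ?subr_gt0//; apply: lt_trans hd.
  by rewrite ltrBlDl -xS.
move=> /(dg (x k) c); rewrite ax xb => /(_ isT).
rewrite distrC ltr_norml => /andP[_]; rewrite -/(x k); lra.
Qed.

End SubMean.

Section RotationAverages.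
Context {R : realType}.
Local Notation C := (complex R : numFieldType).

Lemma line_continuous n (z w : Cspace R n) (T : topologicalType) (f : T -> C) t :
  {for t, continuous f} -> {for t, continuous (fun s => z + f s *: w)}.
Proof.
move=> cf; apply: cvgD; first exact: cvg_cst.
by apply: cvgZr_tmp.
Qed.

Lemma sum_continuous (T : topologicalType) (f : nat -> T -> R) N (t : T) :
  (forall k, {for t, continuous (f k)}) ->
  {for t, continuous (fun s => \sum_(k < N) f k s)}.
Proof.
move=> cf; elim: N => [|N IH].
  rewrite (_ : (fun s => _) = cst 0); first exact: cst_continuous.
  by apply/funext => s; rewrite big_ord0.
rewrite (_ : (fun s => _) = (fun s => \sum_(k < N) f k s + f N s)).
  by apply: cvgD => //; exact: cf.
by apply/funext => s; rewrite big_ord_recr.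
Qed.

Lemma sqr_norm_continuous : continuous (fun p : R * R => p.1 ^+ 2 + p.2 ^+ 2).
Proof.
move=> p; apply: cvgD; rewrite /=.
  by apply: (@continuous_comp _ _ _ fst (fun x : R => x ^+ 2)); [exact: cvg_fst|exact: exprn_continuous].
by apply: (@continuous_comp _ _ _ snd (fun x : R => x ^+ 2)); [exact: cvg_snd|exact: exprn_continuous].
Qed.

Lemma expi_continuous : continuous (@expi R : R -> C).
Proof.
by move=> t; apply: C_continuous => /=; [exact: continuous_cos|exact: continuous_sin].
Qed.

Lemma cancel_weights2 (e p n : R) : 0 < p -> 0 < n ->
  2 * p / n * (e * n / (4 * p)) = e / 2.
Proof. by move=> p0 n0; field; rewrite !lt0r_neq0. Qed.

(** The function [v tau = \sum_k u (z + e^(i a k) tau w)] of the complex number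
    [tau] satisfies the same pointwise condition as [u], so the maximum of
    [v tau + e |tau|^2] over the closed unit disc is reached on the boundary
    circle, while the value at [0] is [N u z]. *)
Lemma rotation_average_max n (D : set (Cspace R n)) (u : Cspace R n -> R)
    (z w : Cspace R n) N (a : R -> R) (e : R) :
    open D -> (forall X, D X -> {for X, continuous u}) ->
    (forall X W, D X -> discrete_subharmonic u X W) ->
    (forall t : R[i], `|t| <= 1 -> D (z + t *: w)) -> (0 < N)%N -> 0 < e ->
  exists2 s : R, - pi <= s <= pi &
    N%:R * u z - e <= \sum_(k < N) u (z + expi (s + a k%:R) *: w).
Proof.
move=> oD cu du zwD N0 e0.
pose tau (p : R * R) : R[i] := (p.1 +i* p.2)%C.
pose pt k p := z + (expi (a k%:R) * tau p) *: w.
pose V p := \sum_(k < N) u (pt k p) + e * (p.1 ^+ 2 + p.2 ^+ 2).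
pose B : set (R * R) := [set p | p.1 ^+ 2 + p.2 ^+ 2 <= 1].
have tauB p : B p -> `|tau p| <= 1.
  move=> Bp; rewrite normc_def lecR /= -[leRHS]sqrtr1.
  by apply: ler_wsqrtr.
have Dpt k p : B p -> D (pt k p).
  move=> Bp; apply: zwD; rewrite normrM norm_expi mul1r; exact: tauB.
have ctau : continuous (tau : R * R -> C).
  by move=> p; apply: C_continuous; [exact: cvg_fst|exact: cvg_snd].
have cpt k : continuous (pt k).
  by move=> p; apply: line_continuous; apply: cvgM; [exact: cvg_cst|exact: ctau].
have cV p : B p -> {for p, continuous V}.
  move=> Bp; apply: cvgD.
    apply: (@sum_continuous _ (fun k p => u (pt k p))) => k.
    by apply: (@continuous_comp _ _ _ (pt k) u); [exact: cpt|apply: cu; exact: Dpt].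
  by apply: cvgM; [exact: cvg_cst|exact: sqr_norm_continuous].
have cB : compact B.
  apply: (@subclosed_compact _ B (`[-1, 1] `*` `[-1, 1])).
  - have cf := sqr_norm_continuous.
    by apply: (@closed_comp _ _ (fun p : R * R => p.1 ^+ 2 + p.2 ^+ 2) [set x | x <= 1]) => //; exact: closed_le.
  - by apply: compact_setX; exact: segment_compact.
  - move=> [x y] /=; rewrite /B /= => xy; rewrite !in_itv /= -!ler_norml.
    have h (r : R) : r ^+ 2 <= 1 -> `|r| <= 1.
      by rewrite -real_normK ?num_real// expr_le1.
    by split; apply: h; move: (sqr_ge0 x) (sqr_ge0 y); lra.
have B0 : B !=set0 by exists (0, 0); rewrite /B /= expr0n /= addr0.
have [p pB pmax] : exists2 c, c \in B & forall t, t \in B -> V t <= V c.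
  apply: compact_EVT_max => //; apply: continuous_in_subspaceT => p.
  by rewrite inE; exact: cV.
rewrite inE in pB.
have V0 : V (0, 0) = N%:R * u z.
  rewrite /V /= expr0n /= addr0 mulr0 addr0.
  rewrite (eq_bigr (fun=> u z)) ?sumr_const ?card_ord ?mulr_natl// => k _.
  by rewrite /pt /tau /= (_ : (0 +i* 0)%C = 0)// mulr0 scale0r addr0.
have Vp : N%:R * u z <= V p.
  by rewrite -V0; apply: pmax; rewrite inE /B /= expr0n /= addr0.
have [p1|p1] := eqVneq (p.1 ^+ 2 + p.2 ^+ 2) 1.
  have [s sp [cs ss]] := unit_circle p1.
  exists s => //; rewrite lerBlDr.
  move: Vp; rewrite /V p1 mulr1 => /le_trans; apply; rewrite lerD2r le_eqVlt; apply/orP; left.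
  apply/eqP; apply: eq_bigr => k _; rewrite /pt addrC expiD mulrC.
  by rewrite /tau -cs -ss addrC.
have {p1}p1 : p.1 ^+ 2 + p.2 ^+ 2 < 1 by rewrite lt_neqAle p1.
exfalso.
have dk (k : 'I_N) := du (pt k p) (expi (a k%:R) *: w) (Dpt k p pB).
have eN : 0 < e / N%:R by rewrite divr_gt0// ltr0n.
pose r_ k := let: exist2 r _ _ := cid2 (dk k _ eN) in r.
have r0 k : 0 < r_ k by rewrite /r_; case: cid2.
have rP k r : 0 < r < r_ k -> 4 * u (pt k p) - (e / N%:R) * r ^+ 2 <=
   u (pt k (p + (r, 0))) + u (pt k (p + (- r, 0))) +
   u (pt k (p + (0, r))) + u (pt k (p + (0, - r))).
  move=> rr; rewrite /r_ in rr; case: cid2 rr => /= r1 _ rP rr.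
  have ptD x y : pt k (p + (x, y)) = pt k p + (x +i* y)%C *: (expi (a k%:R) *: w).
    rewrite /pt -addrA; congr (_ + _); rewrite scalerA -scalerDl; congr (_ *: _).
    rewrite [(x +i* y)%C * _]mulrC -mulrDr; congr (_ * _).
  by rewrite !ptD; exact: rP.

(* a radius that fits all the sheets and keeps the four points in the disc *)
pose q := Num.sqrt (p.1 ^+ 2 + p.2 ^+ 2).
have q1 : q < 1 by rewrite -sqrtr1 ltr_sqrt.
have q0 : 0 <= q by exact: sqrtr_ge0.
have [r /andP[rgt0 rr1] rr] : exists2 r : R, 0 < r < 1 - q & forall k : 'I_N, r < r_ k.
  have hn : \forall r \near (0 : R)^'+, forall k : 'I_N, r < r_ k.
    by apply: filter_forall => k; apply: nbhs_right_lt; exact: r0.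
  have [r [h1 h2 h3]] : exists r : R, [/\ 0 < r, r < 1 - q & forall k : 'I_N, r < r_ k].
    apply: (@filter_ex _ (0 : R)^'+); near=> r; split.
    - by near: r; exact: nbhs_right_gt.
    - by near: r; apply: nbhs_right_lt; rewrite subr_gt0.
    - by near: r.
  by exists r; rewrite ?h1.
have bnd x y : x ^+ 2 + y ^+ 2 = r ^+ 2 -> B (p + (x, y)).
  move=> xy; rewrite /B /=.
  have : p.1 * x + p.2 * y <= q * r.
    apply: le_trans (ler_norm _) _.
    rewrite -(@ler_pXn2r _ 2)// ?nnegrE ?mulr_ge0// ?(ltW rgt0)//.
    rewrite real_normK ?num_real// exprMn sqr_sqrtr ?addr_ge0 ?sqr_ge0// -xy.
    have : 0 <= (p.1 * y - p.2 * x) ^+ 2 by exact: sqr_ge0.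
    nra.
  have : q ^+ 2 = p.1 ^+ 2 + p.2 ^+ 2 by rewrite sqr_sqrtr// addr_ge0// sqr_ge0.
  have : (q + r) ^+ 2 <= 1 by rewrite expr_le1// ?addr_ge0// ?(ltW rgt0)//; lra.
  nra.
have le4 x y : x ^+ 2 + y ^+ 2 = r ^+ 2 -> V (p + (x, y)) <= V p.
  by move=> /bnd h; apply: pmax; rewrite inE.
have := le4 r 0; have := le4 (- r) 0; have := le4 0 r; have := le4 0 (- r).
rewrite !expr0n /= !sqrrN !addr0 !add0r => /(_ erefl) v1 /(_ erefl) v2 /(_ erefl) v3 /(_ erefl) v4.
have {v1 v2 v3 v4}sum4 : V (p + (r, 0)) + V (p + (- r, 0)) + V (p + (0, r)) + V (p + (0, - r)) <= 4 * V p.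
  lra.
have {}rP : \sum_(k < N) (4 * u (pt k p) - (e / N%:R) * r ^+ 2) <=
   \sum_(k < N) (u (pt k (p + (r, 0))) + u (pt k (p + (- r, 0))) +
   u (pt k (p + (0, r))) + u (pt k (p + (0, - r)))).
  by apply: ler_sum => k _; apply: rP; rewrite rgt0/=.
move: rP; rewrite !big_split /= -mulr_sumr sumrN sumr_const card_ord -[X in - X]mulr_natr.
have -> : e / N%:R * r ^+ 2 * N%:R = e * r ^+ 2.
  by field; rewrite pnatr_eq0 -lt0n.
move: sum4; rewrite /V /= ![in X in X -> _]addr0.
have er : 0 < e * r ^+ 2 by rewrite mulr_gt0// exprn_gt0.
have absurd (x y s s1 s2 s3 s4 : R) :
    s1 + e * ((x + r) ^+ 2 + y ^+ 2) + (s2 + e * ((x - r) ^+ 2 + y ^+ 2)) +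
    (s3 + e * (x ^+ 2 + (y + r) ^+ 2)) + (s4 + e * (x ^+ 2 + (y - r) ^+ 2)) <=
    4 * (s + e * (x ^+ 2 + y ^+ 2)) ->
    4 * s - e * r ^+ 2 <= s1 + s2 + s3 + s4 -> False.
  by move=> ? ?; lra.
exact: absurd.
Unshelve. all: by end_near. Qed.

(** Subharmonicity is a local property: the local inequality on small crosses
    gives the mean value inequality on every disc.  The average of [u] over the
    rotations by N-th roots of unity obeys the maximum principle, which bounds
    the value at the centre by a Riemann sum over the circle. *)
Lemma discrete_psh n (D : set (Cspace R n)) (u : Cspace R n -> R) :
    open D -> (forall X, D X -> {for X, continuous u}) ->
    (forall X W, D X -> discrete_subharmonic u X W) ->
  plurisubharmonic D (fun z => (u z)%:E).
Proof.
move=> oD cu du; split.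
- by move=> z _; exact: ltry.
- move=> z a Dz; rewrite lte_fin => uza.
  have /cvgr_lt := cu z Dz => /(_ a uza); apply: filterS => w.
  by rewrite lte_fin.
move=> z w zwD.
pose g s := u (z + expi s *: w).
have cg : continuous g.
  move=> s; apply: (@continuous_comp _ _ _ (fun s => z + expi s *: w) u).
    by apply: line_continuous; exact: expi_continuous.
  by apply: cu; apply: zwD; rewrite norm_expi.
have pg (x : R) : g (x + 2 * pi) = g x.
  by rewrite /g /expi mulr_natl sinD2pi cosD2pi.
have p0 := pi_gt0 R.
have ig : lebesgue_measure.-integrable `[0, 2 * pi] (EFin \o g).
  apply: continuous_compact_integrable; first exact: segment_compact.
  exact: continuous_subspaceT.
rewrite -[X in (_ * X)%E](@fineK _ _); last exact: integrable_fin_num.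
rewrite -EFinM lee_fin ler_pdivlMl ?mulr_gt0//.
rewrite -/(Rintegral _ _ _).
apply/ler_addgt0Pr => e e0.
have e1 : 0 < e / 2 by rewrite divr_gt0.
have [N N0 NP] := periodic_riemann cg pg e1.
have N1 : 0 < N%:R :> R by rewrite ltr0n.
have e2 : 0 < e * N%:R / (4 * pi) by rewrite divr_gt0// mulr_gt0.
have [s sp] := @rotation_average_max n D u z w N (fun k => 2 * pi * k / N%:R) _ oD cu du zwD N0 e2.
move/NP : sp; set S1 := \sum_(k < N) _ => h1 h2.
have h0 : 0 < 2 * pi / N%:R :> R by apply: divr_gt0 => //; apply: mulr_gt0.
rewrite -(ler_pM2l h0) in h2.
have := le_trans h2 h1; rewrite mulrBr.
have -> : 2 * pi / N%:R * (N%:R * u z) = 2 * pi * u z.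
  by rewrite mulrA divfK// lt0r_neq0.
have -> : 2 * pi / N%:R * (e * N%:R / (4 * pi)) = e / 2.
  by apply: cancel_weights2.
rewrite -/g; lra.
Qed.

End RotationAverages.

(** * Second derivatives along real lines *)

Section SecondOrder.
Context {R : realType}.

Definition second_order (f : R -> R) (a b : R) := exists g : R -> R,
  [/\ \forall r \near (0 : R), is_derive r (1 : R) f (g r), g 0 = a & is_derive (0 : R) (1 : R) g b].

Lemma derive_remainder (g : R -> R) (x b e : R) : is_derive x (1 : R) g b -> 0 < e ->
  \forall h \near (0 : R), `|g (x + h) - g x - b * h| <= e * `|h|.
Proof.
move=> dg e0; have [dx db] := dg.
have /cvgr_distC_le : (h^-1 *: (g (h *: 1 + x) - g x)) @[h --> (0 : R)^'] --> b.
  by rewrite -db; exact: dx.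
move=> /(_ e e0); rewrite near_withinE => nh; near=> h.
have [->|h0] := eqVneq h 0; first by rewrite addr0 subrr mulr0 subrr normr0 mulr0.
have : `|h^-1 *: (g (h%:A + x) - g x) - b| <= e by move: h0; near: h.
rewrite (_ : h%:A = h); last by rewrite /GRing.scale /= mulr1.
have -> : g (x + h) - g x - b * h = h * (h^-1 *: (g (h + x) - g x) - b).
  by rewrite /GRing.scale /= mulrBr mulrA divff// mul1r mulrC [x + h]addrC; ring.
by move=> he; rewrite normrM mulrC ler_wpM2r.
Unshelve. all: by end_near. Qed.

Lemma second_order_remainder (f : R -> R) (a b e : R) : second_order f a b -> 0 < e ->
  exists2 r0 : R, 0 < r0 &
    forall r : R, 0 < r < r0 -> `|f r + f (- r) - 2 * f 0 - b * r ^+ 2| <= e * r ^+ 2.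
Proof.
move=> [g [df g0 dg]] e0.
have e1 : 0 < e / 2 by rewrite divr_gt0.
have := derive_remainder dg e1.
move=> /nbhs_ballP[d /= d0 gd]; move: df => /nbhs_ballP[d' /= d'0 df].
exists (Num.min d d'); first by rewrite lt_min d0.
move=> r /andP[r0]; rewrite lt_min => /andP[rd rd'].
pose P (s : R) := f s + f (- s) - b * s ^+ 2.
have dP (s : R) : `|s| < d' -> is_derive s (1 : R) P (g s - g (- s) - 2 * b * s).
  move=> sd.
  have h1 : is_derive s (1 : R) f (g s) by apply: df; rewrite /ball /= sub0r normrN.
  have h2 : is_derive (- s) (1 : R) f (g (- s)) by apply: df; rewrite /ball /= sub0r opprK.
  have h3 : is_derive s (1 : R) (fun s : R => - s) (-1) by exact: is_deriveNid.
  have h4 := is_derive1_comp h2 h3.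
  have h5 := is_deriveD h1 h4.
  have h6 := is_deriveZ b (is_deriveX 2 (is_derive_id s (1 : R))).
  apply: is_derive_eq (is_deriveB h5 h6) _.
  by rewrite /GRing.scale /=; ring.
have rr' : `|r| < d' by rewrite gtr0_norm.
have Hd : forall x : R, x \in `]0, r[%R -> is_derive x (1 : R) P (g x - g (- x) - 2 * b * x).
  move=> x; rewrite in_itv /= => /andP[x0 xr]; apply: dP.
  by rewrite gtr0_norm//; apply: lt_trans rd'.
have cP : {within `[0, r], continuous P}.
  apply: continuous_in_subspaceT => x; rewrite inE /= in_itv /= => /andP[x0 xr].
  apply: differentiable_continuous; apply/derivable1_diffP.
  have /dP : `|x| < d' by rewrite ger0_norm//; apply: le_lt_trans rd'.
  by case.
have [c] := MVT r0 Hd cP; rewrite in_itv /= => /andP[c0 cr].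
have -> : P r - P 0 = f r + f (- r) - 2 * f 0 - b * r ^+ 2.
  by rewrite /P oppr0; ring.
move=> ->; rewrite subr0 normrM [`|r|]gtr0_norm//.
rewrite expr2 mulrA; apply: ler_wpM2r; first exact: ltW.
have k1 : `|g (0 + c) - g 0 - b * c| <= e / 2 * `|c|.
  by apply: gd; rewrite /ball /= sub0r normrN gtr0_norm//; apply: lt_trans rd.
have k2 : `|g (0 - c) - g 0 - b * - c| <= e / 2 * `|- c|.
  by apply: gd; rewrite /ball /= sub0r opprK gtr0_norm//; apply: lt_trans rd.
rewrite add0r in k1; rewrite sub0r normrN in k2.
rewrite [`|c|]gtr0_norm// in k1; rewrite [`|c|]gtr0_norm// in k2.
have -> : g c - g (- c) - 2 * b * c =
  (g c - g 0 - b * c) - (g (- c) - g 0 - b * - c) by ring.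
apply: le_trans (ler_normB _ _) _.
have : e * c <= e * r by rewrite ler_pM2l// ltW.
lra.
Qed.

Lemma second_order_cst (c : R) : second_order (fun=> c) 0 0.
Proof.
exists (fun=> 0); split => //; last exact: is_derive_cst.
by near=> r; exact: is_derive_cst.
Unshelve. all: by end_near. Qed.

Lemma second_orderD (f1 f2 : R -> R) a1 b1 a2 b2 :
  second_order f1 a1 b1 -> second_order f2 a2 b2 ->
  second_order (fun r => f1 r + f2 r) (a1 + a2) (b1 + b2).
Proof.
move=> [g1 [d1 <- h1]] [g2 [d2 <- h2]]; exists (fun r => g1 r + g2 r); split => //.
- by apply: filterS2 d1 d2 => r e1 e2; exact: is_deriveD.
- exact: is_deriveD.
Qed.

Lemma second_orderM (f1 f2 : R -> R) a1 b1 a2 b2 :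
  second_order f1 a1 b1 -> second_order f2 a2 b2 ->
  second_order (fun r => f1 r * f2 r) (a1 * f2 0 + f1 0 * a2)
    (b1 * f2 0 + 2 * a1 * a2 + f1 0 * b2).
Proof.
move=> [g1 [d1 <- h1]] [g2 [d2 <- h2]].
exists (fun r => g1 r * f2 r + f1 r * g2 r); split => //.
- apply: filterS2 d1 d2 => r e1 e2.
  by apply: is_derive_eq (is_deriveM e1 e2) _; rewrite /GRing.scale /=; ring.
- have e1 := nbhs_singleton d1; have e2 := nbhs_singleton d2.
  apply: is_derive_eq (is_deriveD (is_deriveM h1 e2) (is_deriveM e1 h2)) _.
  by rewrite /GRing.scale /=; ring.
Qed.

Lemma second_order_comp (F G f : R -> R) a b c :
  (\forall y \near f 0, is_derive (y : R) (1 : R) F (G y)) ->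
  is_derive (f 0) (1 : R) G c -> second_order f a b ->
  second_order (fun r => F (f r)) (G (f 0) * a) (c * a ^+ 2 + G (f 0) * b).
Proof.
move=> dF dG [g [df <- dg]]; exists (fun r => G (f r) * g r); split => //.
- have cf : {for 0, continuous f}.
    apply: differentiable_continuous; apply/derivable1_diffP.
    by have [] := nbhs_singleton df.
  have dF' : \forall r \near (0 : R), is_derive (f r) (1 : R) F (G (f r)) by exact: (cf _ dF).
  by apply: filterS2 df dF' => r e1 e2; exact: (is_derive1_comp e2 e1).
- have e1 := nbhs_singleton df.
  have e2 := is_derive1_comp dG e1.
  apply: is_derive_eq (is_deriveM e2 dg) _.
  by rewrite /GRing.scale /=; ring.
Qed.

Lemma second_order_eq (f : R -> R) a b a' b' :
  second_order f a b -> a = a' -> b = b' -> second_order f a' b'.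
Proof. by move=> h <- <-. Qed.

Lemma second_orderZ (c : R) (f : R -> R) a b :
  second_order f a b -> second_order (fun r => c * f r) (c * a) (c * b).
Proof.
move=> h; apply: second_order_eq (second_orderM (second_order_cst c) h) _ _; ring.
Qed.

Lemma second_order_expR (f : R -> R) a b : second_order f a b ->
  second_order (fun r => expR (f r)) (expR (f 0) * a) (expR (f 0) * (a ^+ 2 + b)).
Proof.
move=> h.
have h1 : \forall y \near f 0, is_derive (y : R) (1 : R) expR ((expR) y).
  by near=> y; exact: is_derive_expR.
have h2 : is_derive (f 0) (1 : R) (expR) (expR (f 0)) by exact: is_derive_expR.
by apply: second_order_eq (second_order_comp h1 h2 h) _ _; rewrite /=; ring.
Unshelve. all: by end_near. Qed.

Lemma second_order_cos (f : R -> R) a b : second_order f a b ->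
  second_order (fun r => cos (f r)) (- sin (f 0) * a) (- cos (f 0) * a ^+ 2 - sin (f 0) * b).
Proof.
move=> h.
have h1 : \forall y \near f 0, is_derive (y : R) (1 : R) cos ((fun x => - sin x) y).
  by near=> y; exact: is_derive_cos.
have h2 : is_derive (f 0) (1 : R) (fun x => - sin x) (- cos (f 0)) by exact: is_deriveN.
by apply: second_order_eq (second_order_comp h1 h2 h) _ _; rewrite /=; ring.
Unshelve. all: by end_near. Qed.

Lemma second_order_sin (f : R -> R) a b : second_order f a b ->
  second_order (fun r => sin (f r)) (cos (f 0) * a) (- sin (f 0) * a ^+ 2 + cos (f 0) * b).
Proof.
move=> h.
have h1 : \forall y \near f 0, is_derive (y : R) (1 : R) sin ((cos) y).
  by near=> y; exact: is_derive_sin.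
have h2 : is_derive (f 0) (1 : R) (cos) (- sin (f 0)) by exact: is_derive_cos.
by apply: second_order_eq (second_order_comp h1 h2 h) _ _; rewrite /=; ring.
Unshelve. all: by end_near. Qed.

(** A smooth function touching [u] from below at the centre has smaller four-point
    sums. *)
Lemma discrete_subharmonic_support n (u : Cspace R n -> R) (X W : Cspace R n)
    (g1 g2 : R -> R) a1 b1 a2 b2 :
  second_order g1 a1 b1 -> second_order g2 a2 b2 -> g1 0 = u X -> g2 0 = u X ->
  0 <= b1 + b2 ->
  (\forall r \near (0 : R), g1 r <= u (X + (r +i* 0)%C *: W)) ->
  (\forall r \near (0 : R), g2 r <= u (X + (0 +i* r)%C *: W)) ->
  discrete_subharmonic u X W.
Proof.
move=> d1 d2 e1 e2 b0 /nbhs_ballP[r1 /= r10 n1] /nbhs_ballP[r2 /= r20 n2] eta eta0.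
have eta1 : 0 < eta / 2 by rewrite divr_gt0.
have [r3 r30 n3] := second_order_remainder d1 eta1.
have [r4 r40 n4] := second_order_remainder d2 eta1.
exists (Num.min (Num.min r1 r2) (Num.min r3 r4)).
  by rewrite !lt_min r10 r20 r30 r40.
move=> r /andP[r0]; rewrite !lt_min => /andP[/andP[k1 k2] /andP[k3 k4]].
have := n3 r; rewrite r0 k3 => /(_ isT).
have := n4 r; rewrite r0 k4 => /(_ isT).
rewrite !ler_norml e1 e2 => /andP[m4 _] /andP[m3 _].
have h1 : g1 r <= u (X + (r +i* 0)%C *: W).
  by apply: n1; rewrite /ball /= sub0r normrN gtr0_norm.
have h2 : g1 (- r) <= u (X + (- r +i* 0)%C *: W).
  by apply: n1; rewrite /ball /= sub0r opprK gtr0_norm.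
have h3 : g2 r <= u (X + (0 +i* r)%C *: W).
  by apply: n2; rewrite /ball /= sub0r normrN gtr0_norm.
have h4 : g2 (- r) <= u (X + (0 +i* - r)%C *: W).
  by apply: n2; rewrite /ball /= sub0r opprK gtr0_norm.
apply: le_trans (lerD (lerD (lerD h1 h2) h3) h4); clear h1 h2 h3 h4.
have : 0 <= (b1 + b2) * r ^+ 2 by rewrite mulr_ge0// sqr_ge0.
lra.
Qed.

Lemma discrete_subharmonic_max n (u v : Cspace R n -> R) (X W : Cspace R n) :
  discrete_subharmonic u X W -> discrete_subharmonic v X W ->
  discrete_subharmonic (fun X => Num.max (u X) (v X)) X W.
Proof.
move=> du dv eta eta0.
have [r1 r10 h1] := du _ eta0; have [r2 r20 h2] := dv _ eta0.
exists (Num.min r1 r2); first by rewrite lt_min r10.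
move=> r /andP[r0]; rewrite lt_min => /andP[k1 k2].
have := h1 r; have := h2 r; rewrite r0 k1 k2 => /(_ isT) m2 /(_ isT) m1.
have L (x y : R) : x <= Num.max x y by rewrite le_max lexx.
have L' (x y : R) : y <= Num.max x y by rewrite le_max lexx orbT.
have [uv|uv] := leP (u X) (v X).
  by apply: le_trans m2 _; rewrite !lerD.
by apply: le_trans m1 _; rewrite !lerD.
Qed.

End SecondOrder.

(** * Polar coordinates on the slit plane *)

Section Polar.
Context {R : realType}.
Implicit Types (a b x y : R).

Definition modulus a b : R := Num.sqrt (a ^+ 2 + b ^+ 2).
Definition log_modulus a b : R := ln (a ^+ 2 + b ^+ 2) / 2.
(** The branch with values in ]0, 2 pi[ of the argument, on the plane slit along
    the half-line [0, +oo[, which is where [a < modulus a b]. *)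
Definition argument a b : R := pi - 2 * atan (b / (modulus a b - a)).

Lemma modulus_ge0 a b : 0 <= modulus a b. Proof. exact: sqrtr_ge0. Qed.

Lemma sqr_modulus a b : modulus a b ^+ 2 = a ^+ 2 + b ^+ 2.
Proof. by rewrite sqr_sqrtr// addr_ge0// sqr_ge0. Qed.

Lemma slit_gt0 a b : a < modulus a b -> 0 < a ^+ 2 + b ^+ 2.
Proof.
move=> h; rewrite lt_neqAle addr_ge0 ?sqr_ge0// andbT eq_sym paddr_eq0 ?sqr_ge0//.
apply/negP => /andP[]; rewrite !sqrf_eq0 => /eqP a0 /eqP b0.
by move: h; rewrite /modulus a0 b0 expr0n /= addr0 sqrtr0 ltxx.
Qed.

Lemma modulus_gt0 a b : 0 < a ^+ 2 + b ^+ 2 -> 0 < modulus a b.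
Proof. by rewrite sqrtr_gt0. Qed.

Lemma slitP a b : (b != 0) || (a < 0) -> a < modulus a b.
Proof.
have m0 := modulus_ge0 a b; have m2 := sqr_modulus a b.
case/orP => [b0|]; last by move=> h; apply: lt_le_trans m0.
have [//|am] := ltP a (modulus a b).
have : 0 < b ^+ 2 by rewrite exprn_even_gt0.
nra.
Qed.

Lemma expR_log_modulus a b : 0 < a ^+ 2 + b ^+ 2 ->
  expR (log_modulus a b) = modulus a b.
Proof.
move=> h; apply/eqP; rewrite -(@eqrXn2 _ 2)// ?expR_ge0 ?modulus_ge0// sqr_modulus.
by rewrite -expRM_natl /log_modulus mulrC divfK// lnK// posrE.
Qed.

Lemma argument_bounds a b : 0 < argument a b < 2 * pi.
Proof.
have := atan_gtNpi2 (b / (modulus a b - a)); have := atan_ltpi2 (b / (modulus a b - a)).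
by rewrite /argument; lra.
Qed.

Let cos_sin_argument a b : a < modulus a b ->
  modulus a b * cos (argument a b) = a /\ modulus a b * sin (argument a b) = b.
Proof.
move=> h; have m2 := sqr_modulus a b; have m0 := modulus_gt0 (slit_gt0 h).
rewrite /argument; set u := b / _.
have d0 : modulus a b - a != 0 by rewrite lt0r_neq0// subr_gt0.
have bu : b = u * (modulus a b - a) by rewrite /u divfK.
have u1 : 0 < 1 + u ^+ 2 by rewrite ltr_wpDr// sqr_ge0.
have c2 : cos (atan u) ^+ 2 * (1 + u ^+ 2) = 1.
  by rewrite cos_atan exprVn sqr_sqrtr ?(ltW u1)// mulVf// lt0r_neq0.
have s2 : sin (atan u) = u * cos (atan u).
  rewrite -[X in _ = X * _](atanK u) /tan divfK//.
  by rewrite cos_atan invr_neq0// lt0r_neq0// sqrtr_gt0.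
have -> : pi - 2 * atan u = pi - (atan u + atan u) by congr (_ - _); ring.
rewrite cosB sinB cospi sinpi cosD sinD s2.
move: (cos (atan u)) c2 => c c2.
move: (modulus a b) m2 m0 d0 bu => m m2 m0 d0 bu.
have e1 : m + a = u ^+ 2 * (m - a).
  apply: (mulIf d0); have -> : (m + a) * (m - a) = m ^+ 2 - a ^+ 2 by ring.
  by rewrite m2 addrAC subrr add0r [in LHS]bu; ring.
have e2 : a * (1 + u ^+ 2) = m * (u ^+ 2 - 1) by lra.
have e3 : b * (1 + u ^+ 2) = 2 * u * m.
  have e4 : (m - a) * (1 + u ^+ 2) = 2 * m by lra.
  by rewrite [in LHS]bu -mulrA e4; ring.
split.
  have -> : m * (-1 * (c * c - u * c * (u * c)) + 0 * (u * c * c + c * (u * c))) =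
     m * (u ^+ 2 - 1) * c ^+ 2 by ring.
  by rewrite -e2 -mulrA [_ * c ^+ 2]mulrC c2 mulr1.
have -> : m * (0 * (c * c - u * c * (u * c)) - -1 * (u * c * c + c * (u * c))) =
   2 * u * m * c ^+ 2 by ring.
by rewrite -e3 -mulrA [_ * c ^+ 2]mulrC c2 mulr1.
Qed.

Lemma cos_argument a b : a < modulus a b -> modulus a b * cos (argument a b) = a.
Proof. by move=> /cos_sin_argument[]. Qed.

Lemma sin_argument a b : a < modulus a b -> modulus a b * sin (argument a b) = b.
Proof. by move=> /cos_sin_argument[]. Qed.

(** The left-hand side is what the chain rule gives for [argument], with [m] the
    modulus: the half-angle form collapses to the usual angular derivative. *)
Lemma argument_derivative_algebra (m X Y dX dY : R) :
  m ^+ 2 = X ^+ 2 + Y ^+ 2 -> m != 0 -> m - X != 0 ->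
  0 - 2 * ((1 + (Y / (m - X)) ^+ 2)^-1 *
    (Y * (- (m - X) ^- 2 * ((2 * m)^-1 * (2 * (X * dX + Y * dY)) - dX)) +
     (m - X)^-1 * dY)) = (X * dY - Y * dX) / (X ^+ 2 + Y ^+ 2).
Proof.
move=> m2 m0 d0.
have -> : 1 + (Y / (m - X)) ^+ 2 = 2 * m / (m - X).
  apply: (mulIf (expf_neq0 2 d0)); rewrite mulrDl exprMn exprVn divfK ?expf_neq0//.
  by rewrite expr2 [in RHS]mulrA divfK//; lra.
rewrite -m2; have e : - m * (dY * (m - X)) + Y * ((X * dX + Y * dY) - m * dX) =
    (X * dY - Y * dX) * (m - X).
  by have := congr1 ( *%R dY) m2; lra.
have -> : (X * dY - Y * dX) / m ^+ 2 =
    (- m * (dY * (m - X)) + Y * ((X * dX + Y * dY) - m * dX)) / (m ^+ 2 * (m - X)).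
  by rewrite e; field; rewrite m0 d0.
by field; rewrite m0 d0.
Qed.

Section Derivatives.
Variables (x y : R -> R) (dx dy r : R).
Hypotheses (hx : is_derive r (1 : R) x dx) (hy : is_derive r (1 : R) y dy).

Let dS : is_derive r (1 : R) (fun r => x r ^+ 2 + y r ^+ 2) (2 * (x r * dx + y r * dy)).
Proof.
apply: is_derive_eq (is_deriveD (is_deriveX 2 hx) (is_deriveX 2 hy)) _.
by rewrite /GRing.scale /=; ring.
Qed.

Lemma is_derive_log_modulus : 0 < x r ^+ 2 + y r ^+ 2 ->
  is_derive r (1 : R) (fun r => log_modulus (x r) (y r))
    ((x r * dx + y r * dy) / (x r ^+ 2 + y r ^+ 2)).
Proof.
move=> S0; have d1 := @is_derive1_comp _ (@ln R) (fun r => x r ^+ 2 + y r ^+ 2) r _ _ (is_derive1_ln S0) dS.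
have d2 := is_deriveM d1 (is_derive_cst (2^-1 : R) r (1 : R)).
apply: is_derive_eq d2 _.
by rewrite /GRing.scale /=; field; rewrite lt0r_neq0.
Qed.

Lemma is_derive_argument : x r < modulus (x r) (y r) ->
  is_derive r (1 : R) (fun r => argument (x r) (y r))
    ((x r * dy - y r * dx) / (x r ^+ 2 + y r ^+ 2)).
Proof.
move=> sl; have S0 := slit_gt0 sl.
have dm := @is_derive1_comp _ (@Num.sqrt R) (fun r => x r ^+ 2 + y r ^+ 2) r _ _ (is_derive1_sqrt S0) dS.
have d0 : modulus (x r) (y r) - x r != 0 by rewrite lt0r_neq0// subr_gt0.
pose D r := modulus (x r) (y r) - x r.
have dD := is_deriveB dm hx : is_derive r (1 : R) D _.
have dV := @is_deriveV _ D r _ _ d0 dD.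
pose Q r := y r * (D r)^-1.
have dq := is_deriveM hy dV : is_derive r (1 : R) Q _.
have da := @is_derive1_comp _ (@atan R) Q r _ _ (is_derive1_atan _) dq.
pose T r := atan (Q r).
have dT := is_deriveZ 2 (da : is_derive r (1 : R) T _).
have de := is_deriveB (is_derive_cst (pi : R) r (1 : R)) dT.
apply: is_derive_eq de _.
rewrite /GRing.scale /= /Q /D.
apply: argument_derivative_algebra => //; first exact: sqr_modulus.
by rewrite lt0r_neq0// modulus_gt0.
Qed.
End Derivatives.

Section AlongLines.
Variables x0 y0 xi eta : R.
Let N := x0 ^+ 2 + y0 ^+ 2.
Let X (r : R) := x0 + r * xi.
Let Y (r : R) := y0 + r * eta.
(* [al + i be] is the logarithmic derivative at [0] of the complex affine
   function [X + i Y]; minus its square is the second derivative of its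
   logarithm, whose real and imaginary parts are treated below *)
Let al := (x0 * xi + y0 * eta) / N.
Let be := (x0 * eta - y0 * xi) / N.

Let dX (r : R) : is_derive r (1 : R) X xi.
Proof.
apply: is_derive_eq (is_deriveD (is_derive_cst (x0 : R) r (1 : R))
  (is_deriveM (is_derive_id r (1 : R)) (is_derive_cst (xi : R) r (1 : R)))) _.
by rewrite /GRing.scale /=; ring.
Qed.

Let dY (r : R) : is_derive r (1 : R) Y eta.
Proof.
apply: is_derive_eq (is_deriveD (is_derive_cst (y0 : R) r (1 : R))
  (is_deriveM (is_derive_id r (1 : R)) (is_derive_cst (eta : R) r (1 : R)))) _.
by rewrite /GRing.scale /=; ring.
Qed.

Let cX : {for 0, continuous X}.
Proof. by apply: differentiable_continuous; apply/derivable1_diffP; case: (dX 0). Qed.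

Let S (r : R) := X r ^+ 2 + Y r ^+ 2.

Let dS (r : R) : is_derive r (1 : R) S (2 * (X r * xi + Y r * eta)).
Proof.
apply: is_derive_eq (is_deriveD (is_deriveX 2 (dX r)) (is_deriveX 2 (dY r))) _.
by rewrite /GRing.scale /=; ring.
Qed.

Let cS : {for 0, continuous S}.
Proof. by apply: differentiable_continuous; apply/derivable1_diffP; case: (dS 0). Qed.

Let X0 : X 0 = x0. Proof. by rewrite /X mul0r addr0. Qed.
Let Y0 : Y 0 = y0. Proof. by rewrite /Y mul0r addr0. Qed.
Let S0 : S 0 = N. Proof. by rewrite /S X0 Y0. Qed.

Let quotient_derive (P : R -> R) (p : R) : 0 < N -> is_derive (0 : R) (1 : R) P p ->
  is_derive (0 : R) (1 : R) (fun r => P r / S r) (p / N - P 0 * (2 * (x0 * xi + y0 * eta)) / N ^+ 2).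
Proof.
move=> N0 dP; have S00 : S 0 != 0 by rewrite S0 lt0r_neq0.
apply: is_derive_eq (is_deriveM dP (is_deriveV S00 (dS 0))) _.
rewrite /GRing.scale /= S0 X0 Y0; field.
by rewrite lt0r_neq0.
Qed.

Lemma second_order_log_modulus : 0 < N ->
  second_order (fun r => log_modulus (x0 + r * xi) (y0 + r * eta)) al (be ^+ 2 - al ^+ 2).
Proof.
move=> N0; exists (fun r => (X r * xi + Y r * eta) / S r); split.
- have : \forall r \near (0 : R), 0 < S r by apply: (cvgr_gt _ cS); rewrite S0.
  by apply: filterS => r Sr; exact: is_derive_log_modulus.
- by rewrite X0 Y0 S0.
- have dP : is_derive (0 : R) (1 : R) (fun r => X r * xi + Y r * eta) (xi ^+ 2 + eta ^+ 2).
    apply: is_derive_eq (is_deriveD (is_deriveM (dX 0) (is_derive_cst (xi : R) 0 (1 : R)))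
      (is_deriveM (dY 0) (is_derive_cst (eta : R) 0 (1 : R)))) _.
    by rewrite /GRing.scale /=; ring.
  apply: is_derive_eq (quotient_derive N0 dP) _.
  rewrite X0 Y0 /al /be; rewrite (_ : xi ^+ 2 + eta ^+ 2 =
    ((x0 * eta - y0 * xi) ^+ 2 + (x0 * xi + y0 * eta) ^+ 2) / N).
    by field; rewrite lt0r_neq0.
  apply: (mulIf (lt0r_neq0 N0)); rewrite divfK ?lt0r_neq0//; rewrite /N; ring.
Qed.

Lemma second_order_argument : x0 < modulus x0 y0 ->
  second_order (fun r => argument (x0 + r * xi) (y0 + r * eta)) be (- 2 * al * be).
Proof.
move=> sl; have N0 := slit_gt0 sl.
exists (fun r => (X r * eta - Y r * xi) / S r); split.
- have cm : {for 0, continuous (fun r => modulus (X r) (Y r) - X r)}.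
    apply: cvgB => //.
    by apply: (@continuous_comp _ _ _ S (@Num.sqrt R)) => //; exact: sqrt_continuous.
  have : \forall r \near (0 : R), 0 < modulus (X r) (Y r) - X r.
    by apply: (cvgr_gt _ cm); rewrite X0 Y0 subr_gt0.
  apply: filterS => r; rewrite subr_gt0 => Sr; exact: is_derive_argument.
- by rewrite X0 Y0 S0.
- have dP : is_derive (0 : R) (1 : R) (fun r => X r * eta - Y r * xi) 0.
    apply: is_derive_eq (is_deriveB (is_deriveM (dX 0) (is_derive_cst (eta : R) 0 (1 : R)))
      (is_deriveM (dY 0) (is_derive_cst (xi : R) 0 (1 : R)))) _.
    by rewrite /GRing.scale /=; ring.
  apply: is_derive_eq (quotient_derive N0 dP) _.
  rewrite X0 Y0 /al /be; field.
  by rewrite lt0r_neq0.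
Qed.

End AlongLines.

End Polar.

(** * The damping profile *)

Section Profile.
Context {R : realType}.
Implicit Types (x t tau : R).

(** Beyond the core, the worm is narrowed by [sin tau ^ 2 / 4], for which the
    discs would touch the real axis exactly at [w = sin tau / 2], plus a term that
    vanishes to infinite order at [0] and pulls them off the axis.  The constant
    [2] makes [flat] reach [1] at [1 / 2], which closes the worm. *)
Definition flat tau : R := expR (2 - tau^-1).

Definition ramp tau : R := if 0 < tau then sin tau ^+ 2 / 4 + flat tau else 0.

Definition ramp' tau : R :=
  if 0 < tau then sin tau * cos tau / 2 + flat tau / tau ^+ 2 else 0.

Lemma flat_gt0 tau : 0 < flat tau. Proof. exact: expR_gt0. Qed.

Lemma rampN tau : tau <= 0 -> ramp tau = 0.
Proof. by rewrite /ramp leNgt => /negbTE ->. Qed.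

Lemma rampP tau : 0 < tau -> ramp tau = sin tau ^+ 2 / 4 + flat tau.
Proof. by rewrite /ramp => ->. Qed.

Lemma ramp_ge0 tau : 0 <= ramp tau.
Proof.
rewrite /ramp; case: ifP => // _.
by rewrite addr_ge0 ?(ltW (flat_gt0 _))// divr_ge0// sqr_ge0.
Qed.

Lemma ramp_ge1 tau : 2^-1 <= tau -> 1 <= ramp tau.
Proof.
move=> t2; have t0 : 0 < tau by apply: lt_le_trans t2.
rewrite rampP//; have : 1 <= flat tau.
  by rewrite -expR0 ler_expR subr_ge0 -[2]invrK lef_pV2// posrE.
have : 0 <= sin tau ^+ 2 / 4 by rewrite divr_ge0// sqr_ge0.
lra.
Qed.

(** All the estimates on [flat] come from the growth of the exponential. *)
Lemma flat_le n tau : 0 < tau -> flat tau <= expR 2 * n.+1`!%:R * tau ^+ n.+1.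
Proof.
move=> t0; rewrite /flat expRB ler_pdivrMr ?expR_gt0// -!mulrA ler_peMr ?expR_ge0//.
have h : (tau^-1) ^+ n.+1 / n.+1`!%:R <= expR tau^-1.
  by apply: le_trans (expR_ge1Dxn n _); rewrite ?lerDr// invr_ge0 ltW.
have f0 : 0 < n.+1`!%:R :> R by rewrite ltr0n fact_gt0.
rewrite ler_pdivrMr// exprVn in h.
have p0 : 0 < tau ^+ n.+1 by rewrite exprn_gt0.
rewrite -(ler_pM2l p0) divff ?lt0r_neq0// in h.
by apply: le_trans h _; rewrite le_eqVlt; apply/orP; left; apply/eqP; ring.
Qed.

Lemma norm_sin_le x : 0 <= x -> `|sin x| <= x.
Proof.
move=> x0; have Hd : forall y : R, y \in `]0, x[%R -> is_derive y (1 : R) sin (cos y).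
  by move=> y _; exact: is_derive_sin.
have cs : {within `[0, x], continuous (@sin R)} by apply: continuous_subspaceT; exact: continuous_sin.
have [c _] := MVT_segment x0 Hd cs.
rewrite sin0 !subr0 => ->; rewrite normrM (ger0_norm x0).
by rewrite ler_piMl// cos_max.
Qed.

Lemma is_derive_flat tau : 0 < tau -> is_derive tau (1 : R) flat (flat tau / tau ^+ 2).
Proof.
move=> t0; have tn : tau != 0 by rewrite lt0r_neq0.
have d1 := is_deriveV (tn : id tau != 0) (is_derive_id tau (1 : R)).
have d2 := is_deriveB (is_derive_cst (2 : R) tau (1 : R)) d1.
have d3 := @is_derive1_comp _ (@expR R) (fun x => 2 - x^-1) tau _ _ (is_derive_expR _) d2.
apply: is_derive_eq d3 _; rewrite /GRing.scale /=; rewrite /flat; field.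
exact: tn.
Qed.

Lemma is_derive_ramp_gt0 tau : 0 < tau -> is_derive tau (1 : R) ramp (ramp' tau).
Proof.
move=> t0.
have d1 := is_deriveM (is_deriveX 2 (is_derive_sin tau)) (is_derive_cst (4^-1 : R) tau (1 : R)).
have d2 := is_deriveD d1 (is_derive_flat t0).
have d3 : is_derive tau (1 : R) (fun x => sin x ^+ 2 / 4 + flat x) (ramp' tau).
  apply: is_derive_eq d2 _; rewrite /ramp' t0 /GRing.scale /=; field.
  by rewrite lt0r_neq0.
apply: near_eq_is_derive d3.
have : \forall x \near tau, 0 < x by exact: lt_nbhsr.
by apply: filterS => x x0; rewrite rampP.
Qed.

(** This gives the derivative [0] at the junction [tau = 0]; the second derivative
    jumps there, which limits the regularity of the boundary to C^{1,1}. *)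
Lemma ramp_le tau : ramp tau <= (4^-1 + 2 * expR 2) * tau ^+ 2.
Proof.
have e0 := @expR_gt0 R 2; have t2 := sqr_ge0 tau.
have [t0|t0] := leP tau 0; first by rewrite rampN// mulr_ge0//; lra.
rewrite rampP//; have := flat_le 1 t0; rewrite (_ : 2`! = 2)// => h.
have s2 : sin tau ^+ 2 <= tau ^+ 2.
  by rewrite -real_normK ?num_real// ler_pXn2r ?nnegrE ?(ltW t0)//; exact: norm_sin_le (ltW t0).
lra.
Qed.

Lemma is_derive_ramp tau : is_derive tau (1 : R) ramp (ramp' tau).
Proof.
have [t0|t0|t0] := ltgtP tau 0.
- rewrite /ramp' ltNge (ltW t0) /=.
  apply: near_eq_is_derive (is_derive_cst (0 : R) tau (1 : R)).
  have : \forall x \near tau, x < 0 by exact: lt_nbhsl.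
  by apply: filterS => x x0; rewrite rampN// ltW.
- exact: is_derive_ramp_gt0.
have C0 : 0 < 4^-1 + 2 * expR 2 :> R by have := @expR_gt0 R 2; lra.
rewrite t0 /ramp' ltxx.
have cv : (h^-1 *: (ramp (h *: (1 : R) + 0) - ramp 0)) @[h --> (0 : R)^'] --> (0 : R).
  apply/cvgr0Pnorm_lt => e e0; rewrite near_withinE.
  have : \forall h \near (0 : R), `|h| < e / (4^-1 + 2 * expR 2).
    have := @nbhsx_ballx _ _ (0 : R) (e / (4^-1 + 2 * expR 2)).
    by rewrite divr_gt0// => /(_ isT); apply: filterS => h; rewrite /ball /= sub0r normrN.
  apply: filterS => h hlt h0.
  rewrite (rampN (lexx 0)) subr0 addr0 /GRing.scale /= mulr1 normrM normfV.
  rewrite (ger0_norm (ramp_ge0 _)) mulrC ltr_pdivrMr ?normr_gt0//.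
  apply: le_lt_trans (ramp_le _) _.
  rewrite -[h ^+ 2]real_normK ?num_real// expr2 mulrA ltr_pM2r ?normr_gt0//.
  by rewrite mulrC -ltr_pdivlMr.
apply: DeriveDef; last exact: (cvg_lim _ cv).
by apply/cvg_ex; exists 0.
Qed.

Lemma ramp_continuous : continuous ramp.
Proof.
move=> x; apply: differentiable_continuous; apply/derivable1_diffP.
by case: (is_derive_ramp x).
Qed.

(** The factor [1 - 2 tau] is why convexity is limited to [tau <= 1 / 2]. *)
Lemma is_derive_flat' tau : 0 < tau -> is_derive tau (1 : R) (fun x => flat x / x ^+ 2)
  (flat tau * (1 - 2 * tau) / tau ^+ 4).
Proof.
move=> t0; have tn : tau != 0 by rewrite lt0r_neq0.
have t2 : tau ^+ 2 != 0 by rewrite expf_neq0.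
have dV := @is_deriveV _ (fun x : R => x ^+ 2) tau _ _ t2 (is_deriveX 2 (is_derive_id tau (1 : R))).
apply: is_derive_eq (is_deriveM (is_derive_flat t0) dV) _.
by rewrite /GRing.scale /=; field.
Qed.

Lemma is_derive_ramp' tau : 0 < tau -> is_derive tau (1 : R) ramp'
  (cos (tau *+ 2) / 2 + flat tau * (1 - 2 * tau) / tau ^+ 4).
Proof.
move=> t0.
have d1 := is_deriveM (is_deriveM (is_derive_sin tau) (is_derive_cos tau)) (is_derive_cst (2^-1 : R) tau (1 : R)).
have d2 := is_deriveD d1 (is_derive_flat' t0).
have d3 : is_derive tau (1 : R) (fun x => sin x * cos x / 2 + flat x / x ^+ 2)
   (cos (tau *+ 2) / 2 + flat tau * (1 - 2 * tau) / tau ^+ 4).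
  apply: is_derive_eq d2 _; rewrite cos_mulr2n.
  have -> : cos tau ^+ 2 *+ 2 - 1 = cos tau ^+ 2 - sin tau ^+ 2.
    by rewrite sin2cos2; ring.
  rewrite /GRing.scale /=; field.
  by rewrite lt0r_neq0.
apply: near_eq_is_derive d3.
have : \forall x \near tau, 0 < x by exact: lt_nbhsr.
by apply: filterS => x x0; rewrite /ramp' x0.
Qed.

Lemma ramp'N tau : tau <= 0 -> ramp' tau = 0.
Proof. by rewrite /ramp' leNgt => /negbTE ->. Qed.

Lemma ramp'_gt0 tau : 0 < tau <= 2^-1 -> 0 < ramp' tau.
Proof.
move=> /andP[t0 t2]; rewrite /ramp' t0; have p1 := @pihalf_ge1 R.
have s0 : 0 < sin tau by apply: sin_gt0_pihalf; apply/andP; split => //; lra.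
have c0 : 0 < cos tau by apply: cos_gt0_pihalf; apply/andP; split; lra.
by rewrite addr_gt0// divr_gt0 ?mulr_gt0 ?flat_gt0// exprn_gt0.
Qed.

Lemma ramp'_mono s t : s <= t -> t <= 2^-1 -> ramp' s <= ramp' t.
Proof.
move=> st t2; have [s0|s0] := leP s 0.
  rewrite ramp'N//; have [t0|t0] := leP t 0; first by rewrite ramp'N.
  by apply/ltW/ramp'_gt0; rewrite t0.
have Hd : forall y : R, y \in `]s, t[%R -> is_derive y (1 : R) ramp'
    (cos (y *+ 2) / 2 + flat y * (1 - 2 * y) / y ^+ 4).
  move=> y; rewrite in_itv /= => /andP[sy _]; apply: is_derive_ramp'.
  exact: lt_trans sy.
have cs : {within `[s, t], continuous ramp'}.
  apply: continuous_in_subspaceT => y; rewrite inE /= in_itv /= => /andP[sy _].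
  apply: differentiable_continuous; apply/derivable1_diffP.
  have /is_derive_ramp' : 0 < y by apply: lt_le_trans sy.
  by case.
have [c] := MVT_segment st Hd cs; rewrite in_itv /= => /andP[sc ct] e.
rewrite -subr_ge0 e mulr_ge0 ?subr_ge0//.
have c0 : 0 < c by apply: lt_le_trans sc.
have p1 := @pihalf_ge1 R.
have : 0 <= cos (c *+ 2) by rewrite mulr2n; apply: cos_ge0_pihalf; apply/andP; split; lra.
have : 0 <= flat c * (1 - 2 * c) / c ^+ 4.
  by rewrite divr_ge0 ?mulr_ge0 ?exprn_ge0 ?(ltW c0) ?(ltW (flat_gt0 _))//; lra.
lra.
Qed.

(** Convexity on ]-oo, 1/2].  It is what makes the damping admissible in a
    plurisubharmonic function. *)
Lemma ramp_tangent s t : s <= 2^-1 -> t <= 2^-1 -> ramp s + ramp' s * (t - s) <= ramp t.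
Proof.
move=> s2 t2.
have Hd (a b : R) : forall y : R, y \in `]a, b[%R -> is_derive y (1 : R) ramp (ramp' y).
  by move=> y _; exact: is_derive_ramp.
have cs (a b : R) : {within `[a, b], continuous ramp}.
  by apply: continuous_subspaceT; exact: ramp_continuous.
have [st|/ltW st] := leP s t.
  have [c] := MVT_segment st (Hd _ _) (cs _ _).
  rewrite in_itv /= => /andP[sc ct] e.
  rewrite addrC -lerBrDr e ler_wpM2r ?subr_ge0//.
  by apply: ramp'_mono => //; apply: le_trans t2.
have [c] := MVT_segment st (Hd _ _) (cs _ _).
rewrite in_itv /= => /andP[tc cs'] e.
have : ramp' c * (s - t) <= ramp' s * (s - t).
  by rewrite ler_wpM2r ?subr_ge0//; apply: ramp'_mono.
lra.
Qed.

(** By convexity, since [ramp 0 = 0]. *)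
Lemma ramp_scale l tau : 0 <= l <= 1 -> tau <= 2^-1 -> ramp (l * tau) <= l * ramp tau.
Proof.
move=> /andP[l0 l1] t2.
have lt2 : l * tau <= 2^-1 by have [t0|t0] := leP tau 0; nra.
have h1 := ramp_tangent lt2 t2.
have h20 : 0 <= 2^-1 :> R by lra.
have := ramp_tangent lt2 h20; rewrite [ramp 0]rampN// => h2.
have := ler_wpM2l l0 h1; have l1' : 0 <= 1 - l by lra.
have := ler_wpM2l l1' h2; lra.
Qed.

Lemma ramp'_lipschitz_gt0 s t : 0 < s -> 0 < t -> s <= t ->
  `|ramp' t - ramp' s| <= (1 + 36 * expR 2) * (t - s).
Proof.
move=> s0 t0 st.
have Hd : forall y : R, y \in `]s, t[%R -> is_derive y (1 : R) ramp'
    (cos (y *+ 2) / 2 + flat y * (1 - 2 * y) / y ^+ 4).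
  move=> y; rewrite in_itv /= => /andP[sy _]; apply: is_derive_ramp'.
  exact: lt_trans sy.
have cs : {within `[s, t], continuous ramp'}.
  apply: continuous_in_subspaceT => y; rewrite inE /= in_itv /= => /andP[sy _].
  apply: differentiable_continuous; apply/derivable1_diffP.
  have /is_derive_ramp' : 0 < y by apply: lt_le_trans sy.
  by case.
have [c] := MVT_segment st Hd cs; rewrite in_itv /= => /andP[sc ct] ->.
have c0 : 0 < c by apply: lt_le_trans sc.
rewrite normrM (ger0_norm (_ : 0 <= t - s)) ?subr_ge0//.
apply: ler_wpM2r; first by rewrite subr_ge0.
have f4 := flat_le 3 c0; have f3 := flat_le 2 c0; have f0 := flat_gt0 c.
rewrite (_ : 4`! = 24)// in f4; rewrite (_ : 3`! = 6)// in f3.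
have c4 : 0 < c ^+ 4 by rewrite exprn_gt0.
have c3 : 0 < c ^+ 3 by rewrite exprn_gt0.
have -> : flat c * (1 - 2 * c) / c ^+ 4 = flat c / c ^+ 4 - 2 * (flat c / c ^+ 3).
  by field; rewrite lt0r_neq0.
have : flat c / c ^+ 4 <= expR 2 * 24 by rewrite ler_pdivrMr.
have : flat c / c ^+ 3 <= expR 2 * 6 by rewrite ler_pdivrMr.
have : 0 <= flat c / c ^+ 4 by rewrite divr_ge0// ltW.
have : 0 <= flat c / c ^+ 3 by rewrite divr_ge0// ltW.
have := cos_max (c *+ 2); rewrite !ler_norml => /andP[k1 k2] k3 k4 k5 k6.
apply/andP; split; lra.
Qed.

Lemma ramp'_le tau : 0 <= tau -> `|ramp' tau| <= (1 + 36 * expR 2) * tau.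
Proof.
rewrite le_eqVlt => /predU1P[<-|t0]; first by rewrite ramp'N// normr0 mulr0.
rewrite /ramp' t0.
have f3 := flat_le 2 t0; have f0 := flat_gt0 tau.
rewrite (_ : 3`! = 6)// in f3.
have c2 : 0 < tau ^+ 2 by rewrite exprn_gt0.
  have : flat tau / tau ^+ 2 <= expR 2 * 6 * tau by rewrite ler_pdivrMr//; apply: le_trans f3 _; rewrite exprS mulrA.
have : 0 <= flat tau / tau ^+ 2 by rewrite divr_ge0// ltW.
have : `|sin tau * cos tau| <= tau.
  by rewrite normrM -[leRHS]mulr1 ler_pM ?norm_sin_le ?cos_max// ltW.
have := @expR_gt0 R 2; rewrite !ler_norml => e0 /andP[k1 k2] k3 k4.
have : 0 < expR 2 * tau by rewrite mulr_gt0.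
by move=> k5; apply/andP; split; lra.
Qed.

Lemma ramp'_lipschitz s t : `|ramp' t - ramp' s| <= (1 + 36 * expR 2) * `|t - s|.
Proof.
wlog st : s t / s <= t => [wl|].
  by have [|/ltW] := leP s t; [exact: wl|move/wl; rewrite distrC (distrC s)].
rewrite [`|t - s|]ger0_norm ?subr_ge0//.
have L0 : 0 < 1 + 36 * expR 2 :> R by have := @expR_gt0 R 2; lra.
have [s0|s0] := leP s 0.
  rewrite (ramp'N s0) subr0; have [t0|t0] := leP t 0.
    by rewrite ramp'N// normr0 mulr_ge0 ?subr_ge0// ltW.
  apply: le_trans (ramp'_le (ltW t0)) _; rewrite ler_pM2l//; lra.
by apply: ramp'_lipschitz_gt0 => //; apply: lt_le_trans st.
Qed.

Definition damping t : R := ramp (- t) + ramp (t - pi).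
Definition damping' t : R := ramp' (t - pi) - ramp' (- t).

Lemma damping_ge0 t : 0 <= damping t. Proof. by rewrite addr_ge0 ?ramp_ge0. Qed.

Lemma damping_core t : 0 <= t <= pi -> damping t = 0.
Proof. by move=> /andP[t0 tp]; rewrite /damping !rampN ?addr0//; lra. Qed.

Lemma damping_neg t : t <= 0 -> damping t = ramp (- t).
Proof. by move=> t0; rewrite /damping [ramp (t - pi)]rampN ?addr0//; have := pi_gt0 R; lra. Qed.

Lemma damping_sym t : damping (pi - t) = damping t.
Proof. by rewrite /damping addrC; congr (ramp _ + ramp _); ring. Qed.

Lemma is_derive_damping t : is_derive t (1 : R) damping (damping' t).
Proof.
have d1 := @is_derive1_comp _ ramp (fun t => - t) t _ _ (is_derive_ramp _) (is_deriveNid t (1 : R)).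
have d2 := @is_derive1_comp _ ramp (fun t => t - pi) t _ _ (is_derive_ramp _)
  (is_deriveB (is_derive_id t (1 : R)) (is_derive_cst (pi : R) t (1 : R))).
apply: is_derive_eq (is_deriveD d1 d2) _.
by rewrite /damping' subr0 mulr1 mulrN1 addrC.
Qed.

Lemma damping_continuous : continuous damping.
Proof.
move=> x; apply: differentiable_continuous; apply/derivable1_diffP.
by case: (is_derive_damping x).
Qed.

Lemma damping'_lipschitz s t : `|damping' t - damping' s| <= 2 * (1 + 36 * expR 2) * `|t - s|.
Proof.
have := ramp'_lipschitz (s - pi) (t - pi); have := ramp'_lipschitz (- s) (- t).
have -> : - t - - s = s - t by ring.
have -> : t - pi - (s - pi) = t - s by ring.
rewrite (distrC s t) /damping' => h1 h2.
have -> : ramp' (t - pi) - ramp' (- t) - (ramp' (s - pi) - ramp' (- s)) =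
  (ramp' (t - pi) - ramp' (s - pi)) - (ramp' (- t) - ramp' (- s)) by ring.
by apply: le_trans (ler_normB _ _) _; lra.
Qed.

Lemma damping_tangent s t : - 2^-1 <= s <= pi + 2^-1 -> - 2^-1 <= t <= pi + 2^-1 ->
  damping s + damping' s * (t - s) <= damping t.
Proof.
move=> /andP[s1 s2] /andP[t1 t2]; rewrite /damping /damping'.
have h1 : - s <= 2^-1 by lra.
have h2 : - t <= 2^-1 by lra.
have h3 : s - pi <= 2^-1 by lra.
have h4 : t - pi <= 2^-1 by lra.
have := ramp_tangent h1 h2; have := ramp_tangent h3 h4; lra.
Qed.

Lemma damping_ge1 t : t <= - 2^-1 \/ pi + 2^-1 <= t -> 1 <= damping t.
Proof.
move=> [t1|t1].
  have h : 2^-1 <= - t by lra.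
  by have := ramp_ge1 h; have := ramp_ge0 (t - pi); rewrite /damping; lra.
have h : 2^-1 <= t - pi by lra.
by have := ramp_ge1 h; have := ramp_ge0 (- t); rewrite /damping; lra.
Qed.

End Profile.

(** * Tubes over the slit plane *)

Section Continuity.
Context {R : realType} {T : topologicalType}.
Variables (f g : T -> R) (X : T).
Hypotheses (cf : {for X, continuous f}) (cg : {for X, continuous g}).

Let cS : {for X, continuous (fun Y => f Y ^+ 2 + g Y ^+ 2)}.
Proof.
apply: cvgD; rewrite /=.
  by apply: (@continuous_comp _ _ _ f (fun x : R => x ^+ 2)) => //; exact: exprn_continuous.
by apply: (@continuous_comp _ _ _ g (fun x : R => x ^+ 2)) => //; exact: exprn_continuous.
Qed.

Lemma sqr_modulus_continuous : {for X, continuous (fun Y => f Y ^+ 2 + g Y ^+ 2)}.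
Proof. exact: cS. Qed.

Lemma modulus_continuous : {for X, continuous (fun Y => modulus (f Y) (g Y))}.
Proof.
by apply: (@continuous_comp _ _ _ (fun Y => f Y ^+ 2 + g Y ^+ 2) (@Num.sqrt R)) => //; exact: sqrt_continuous.
Qed.

Lemma log_modulus_continuous : 0 < f X ^+ 2 + g X ^+ 2 ->
  {for X, continuous (fun Y => log_modulus (f Y) (g Y))}.
Proof.
move=> N0; apply: cvgM; last exact: cvg_cst.
by apply: (@continuous_comp _ _ _ (fun Y => f Y ^+ 2 + g Y ^+ 2) (@ln R)) => //; exact: continuous_ln.
Qed.

Lemma argument_continuous : f X < modulus (f X) (g X) ->
  {for X, continuous (fun Y => argument (f Y) (g Y))}.
Proof.
move=> N0; apply: cvgB; first exact: cvg_cst.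
apply: cvgM; first exact: cvg_cst.
apply: (@continuous_comp _ _ _ (fun Y => g Y / (modulus (f Y) (g Y) - f Y)) (@atan R)); last exact: continuous_atan.
apply: cvgM => //; apply: cvgV; first by rewrite lt0r_neq0// subr_gt0.
by apply: cvgB => //; exact: modulus_continuous.
Qed.

End Continuity.

Section PointwiseContinuity.
Context {R : realType} {T : topologicalType}.
Implicit Types (f g : T -> R) (X : T).

Lemma ctsC (c : R) X : {for X, continuous (fun _ : T => c)}.
Proof. exact: cvg_cst. Qed.

Lemma ctsD f g X : {for X, continuous f} -> {for X, continuous g} ->
  {for X, continuous (fun Y => f Y + g Y)}.
Proof. by move=> cf cg; apply: cvgD. Qed.

Lemma ctsB f g X : {for X, continuous f} -> {for X, continuous g} ->
  {for X, continuous (fun Y => f Y - g Y)}.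
Proof. by move=> cf cg; apply: cvgB. Qed.

Lemma ctsN f X : {for X, continuous f} -> {for X, continuous (fun Y => - f Y)}.
Proof. by move=> cf; apply: cvgN. Qed.

Lemma ctsM f g X : {for X, continuous f} -> {for X, continuous g} ->
  {for X, continuous (fun Y => f Y * g Y)}.
Proof. by move=> cf cg; apply: cvgM. Qed.

Lemma cts_max f g X : {for X, continuous f} -> {for X, continuous g} ->
  {for X, continuous (fun Y => Num.max (f Y) (g Y))}.
Proof. by move=> cf cg; apply: continuous_max. Qed.

Lemma cts_comp (h : R -> R) f X : {for X, continuous f} -> {for f X, continuous h} ->
  {for X, continuous (fun Y => h (f Y))}.
Proof. by move=> cf ch; apply: (@continuous_comp _ _ _ f h). Qed.

Lemma cts_gt f X (c : R) : {for X, continuous f} -> c < f X -> \forall Y \near X, c < f Y.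
Proof. by move=> cf; exact: (cvgr_gt _ cf). Qed.

Lemma cts_lt f X (c : R) : {for X, continuous f} -> f X < c -> \forall Y \near X, f Y < c.
Proof. by move=> cf; exact: (cvgr_lt _ cf). Qed.

Lemma closure_ge f (S : set T) X (c : R) : {for X, continuous f} -> closure S X ->
  (forall Y, S Y -> c <= f Y) -> c <= f X.
Proof.
move=> cf clX Sc; rewrite leNgt; apply/negP => /(cts_lt cf) nX.
have [Y [SY fY]] := clX _ nX.
by have := Sc _ SY; rewrite leNgt fY.
Qed.

End PointwiseContinuity.

Section Tubes.
Context {R : realType}.
Implicit Types (X W : Cspace R 2).

Definition zx X : R := complex.Re (X 0 0).
Definition zy X : R := complex.Im (X 0 0).
Definition wx X : R := complex.Re (X 0 1).
Definition wy X : R := complex.Im (X 0 1).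
Definition lz X : R := log_modulus (zx X) (zy X).

Lemma zx_continuous : continuous zx. Proof. exact: Re_coord_continuous. Qed.
Lemma zy_continuous : continuous zy. Proof. exact: Im_coord_continuous. Qed.
Lemma wx_continuous : continuous wx. Proof. exact: Re_coord_continuous. Qed.
Lemma wy_continuous : continuous wy. Proof. exact: Im_coord_continuous. Qed.

Lemma lz_continuous X : 0 < zx X ^+ 2 + zy X ^+ 2 -> {for X, continuous lz}.
Proof.
by apply: log_modulus_continuous; [exact: zx_continuous|exact: zy_continuous].
Qed.

Variables (p C nu d : R).

Definition cutoff (t : R) := Num.max (damping t - nu) 0.

Lemma cutoff_continuous : continuous cutoff.
Proof.
move=> t; apply: (@cts_max _ _ (fun t => damping t - nu) (fun=> 0)); last exact: ctsC.
apply: (@ctsB _ _ damping (fun=> nu)); last exact: ctsC.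
exact: damping_continuous.
Qed.

(** With [zeta = w - d], [theta] its argument and [t = ln |z|], the first term of
    [level] is, up to the factor [exp (p phi)] where [phi] is a local argument of
    [z], the real part of the holomorphic function
    [C (zeta z^(-i) / i)^p]; the same factor turns [|zeta|^2] into the modulus
    of a holomorphic function and the convex function [cutoff] of [t] into a
    subharmonic one.  So [exp (p phi) level] is superharmonic along complex
    lines, and [- ln level] is plurisubharmonic because [phi] is pluriharmonic.
    The branches of [theta] and of the power [p < 1] need the slit. *)
Definition level (a b t : R) : R :=
  C * expR (p * log_modulus a b) * cos (p * (argument a b - t - pi / 2)) -
  expR (2 * log_modulus a b) - cutoff t.

Definition tube : set (Cspace R 2) := [set X |
  [/\ 0 < zx X ^+ 2 + zy X ^+ 2,
      wx X - d < modulus (wx X - d) (wy X),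
      - 2^-1 < lz X < pi + 2^-1,
      `|argument (wx X - d) (wy X) - lz X - pi / 2| < pi / (2 * p)
    & 0 < level (wx X - d) (wy X) (lz X)]].

Let cwx X : {for X, continuous (fun Y => wx Y - d)}.
Proof. by apply: ctsB; [exact: wx_continuous|exact: ctsC]. Qed.

Let ca X : wx X - d < modulus (wx X - d) (wy X) ->
  {for X, continuous (fun Y => argument (wx Y - d) (wy Y))}.
Proof.
move=> sl; apply: (@argument_continuous _ _ (fun Y => wx Y - d) wy X) => //.
  exact: cwx.
exact: wy_continuous.
Qed.

Lemma gap_continuous X : {for X, continuous (fun Y => modulus (wx Y - d) (wy Y) - (wx Y - d))}.
Proof.
apply: ctsB; last exact: cwx.
by apply: modulus_continuous; [exact: cwx|exact: wy_continuous].
Qed.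

Lemma angle_continuous X : 0 < zx X ^+ 2 + zy X ^+ 2 ->
  wx X - d < modulus (wx X - d) (wy X) ->
  {for X, continuous (fun Y => argument (wx Y - d) (wy Y) - lz Y - pi / 2)}.
Proof.
move=> z0 sl; apply: ctsB; last exact: ctsC.
by apply: ctsB; [exact: ca|exact: lz_continuous].
Qed.

Lemma level_continuous X : 0 < zx X ^+ 2 + zy X ^+ 2 ->
  wx X - d < modulus (wx X - d) (wy X) ->
  {for X, continuous (fun Y => level (wx Y - d) (wy Y) (lz Y))}.
Proof.
move=> z0 sl; have cl := lz_continuous z0.
have cs : {for X, continuous (fun Y => log_modulus (wx Y - d) (wy Y))}.
  by apply: log_modulus_continuous; [exact: cwx|exact: wy_continuous|exact: slit_gt0].
have ce (c : R) : {for X, continuous (fun Y => expR (c * log_modulus (wx Y - d) (wy Y)))}.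
  by apply: cts_comp; [apply: ctsM => //; exact: ctsC|exact: continuous_expR].
apply: ctsB; first apply: ctsB; last 2 first.
- exact: ce.
- by apply: cts_comp => //; exact: cutoff_continuous.
apply: ctsM; first by apply: ctsM; [exact: ctsC|exact: ce].
apply: cts_comp; last exact: continuous_cos.
by apply: ctsM; [exact: ctsC|exact: angle_continuous].
Qed.

Lemma tube_open : open tube.
Proof.
rewrite openE => X [z0 sl /andP[t1 t2] ar lv].
have cl := lz_continuous z0.
have cz : {for X, continuous (fun Y => zx Y ^+ 2 + zy Y ^+ 2)}.
  by apply: sqr_modulus_continuous; [exact: zx_continuous|exact: zy_continuous].
have cy : {for X, continuous (fun Y => `|argument (wx Y - d) (wy Y) - lz Y - pi / 2|)}.
  by apply: cts_comp; [exact: angle_continuous|exact: norm_continuous].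
have sl' := sl; rewrite -subr_gt0 in sl'; rewrite /interior /=; near=> Y; split.
- by near: Y; exact: (cts_gt cz).
- rewrite -subr_gt0; near: Y. have h := @gap_continuous X; have h2 := cts_gt h sl'. exact: h2.
- apply/andP; split; near: Y; first exact: (cts_gt cl).
  exact: (cts_lt cl).
- by near: Y; exact: (cts_lt cy).
- by near: Y; exact: (cts_gt (level_continuous z0 sl)).
Unshelve. all: by end_near. Qed.

(** One logarithmic term for each way of leaving the tube: through the zero set
    of [level], towards the slit, or towards either end.  The term
    [|zeta| - Re zeta] is twice the square of the imaginary part of a square
    root of [zeta], which makes its logarithm plurisuperharmonic. *)
Definition tube_exhaustion X : R :=
  Num.max (Num.max (- ln (level (wx X - d) (wy X) (lz X)))
                   (- ln (modulus (wx X - d) (wy X) - (wx X - d))))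
          (Num.max (- ln (lz X + 2^-1)) (- ln (pi + 2^-1 - lz X))).

Lemma tube_exhaustion_continuous X : tube X -> {for X, continuous tube_exhaustion}.
Proof.
move=> [z0 sl /andP[t1 t2] ar lv].
have cl := lz_continuous z0.
have cln (f : Cspace R 2 -> R) : 0 < f X -> {for X, continuous f} ->
    {for X, continuous (fun Y => - ln (f Y))}.
  by move=> f0 cf; apply: ctsN; apply: cts_comp => //; exact: continuous_ln.
apply: cts_max; apply: cts_max; apply: cln.
- exact: lv.
- exact: level_continuous.
- by rewrite subr_gt0.
- exact: gap_continuous.
- lra.
- by apply: ctsD => //; exact: ctsC.
- lra.
- by apply: ctsB => //; exact: ctsC.
Qed.

End Tubes.

(** * Plurisubharmonicity of the exhaustion of a tube *)

Section Supports.
Context {R : realType}.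

Lemma ln_tangent (f0 f : R) : 0 < f0 -> 0 < f -> - ln f0 - (f - f0) / f0 <= - ln f.
Proof.
move=> p0 p; have h : -1 < f / f0 - 1 by rewrite ltrBrDr addNr divr_gt0.
have := le_ln1Dx h; rewrite addrC subrK ln_div// mulrBl divff ?lt0r_neq0//; lra.
Qed.

Section Level.
Variables p C nu : R.
Variables (sg th tt : R -> R) (al be ga de : R).
Hypotheses (hsg : second_order sg al (be ^+ 2 - al ^+ 2))
  (hth : second_order th be (- 2 * al * be))
  (htt : second_order tt ga (de ^+ 2 - ga ^+ 2)).

(* a harmonic conjugate of [tt] up to second order, standing for the local
   argument of z *)
Let ph (r : R) := de * r + - (ga * de) * (r * r).

Let second_order_id : second_order (fun r : R => r) 1 0.
Proof.
exists (fun=> 1); split => //; last exact: is_derive_cst.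
by near=> r; exact: is_derive_id.
Unshelve. all: by end_near. Qed.

Let hph : second_order ph de (- 2 * ga * de).
Proof.
apply: second_order_eq (second_orderD (second_orderZ de second_order_id)
  (second_orderZ (- (ga * de)) (second_orderM second_order_id second_order_id))) _ _; ring.
Qed.

Let ph0 : ph 0 = 0. Proof. by rewrite /ph; ring. Qed.

Let f (r : R) := C * expR (p * sg r) * cos (p * (th r - tt r - pi / 2)) -
  expR (2 * sg r) - cutoff nu (tt r).

Let H0 := cutoff nu (tt 0).
(* the slope of a line supporting the convex function [cutoff] at [tt 0] *)
Let k := if nu < damping (tt 0) then damping' (tt 0) else 0.

(* majorant of [exp (p ph) f] that is smooth to second order: the cutoff is
   replaced by its supporting line *)
Let big (r : R) := C * (expR (p * (ph r + sg r)) * cos (p * (th r + (-1) * tt r + - (pi / 2)))) +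
  ((-1) * expR (p * ph r + 2 * sg r) + (-1) * (expR (p * ph r) * (H0 + k * (tt r + - tt 0)))).

Let psi := p * (th 0 - tt 0 - pi / 2).
Let S := p ^+ 2 * ((de + al) ^+ 2 - (be - ga) ^+ 2) * (expR (p * sg 0) * cos psi)
   + p * (- 2 * ga * de + be ^+ 2 - al ^+ 2) * (expR (p * sg 0) * cos psi)
   - (2 * p ^+ 2 * (de + al) * (be - ga) + p * (- 2 * al * be - de ^+ 2 + ga ^+ 2))
      * (expR (p * sg 0) * sin psi).

Let big_second_order : exists a, second_order big a
  (C * S - expR (2 * sg 0) * ((p * de + 2 * al) ^+ 2 + p * (- 2 * ga * de) + 2 * (be ^+ 2 - al ^+ 2))
   - (H0 * ((p * de) ^+ 2 + p * (- 2 * ga * de)) + 2 * p * k * de * ga + k * (de ^+ 2 - ga ^+ 2))).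
Proof.
eexists; apply: second_order_eq.
  apply: second_orderD.
    apply: second_orderZ; apply: second_orderM.
      by apply: second_order_expR; apply: second_orderZ; apply: second_orderD hph hsg.
    apply: second_order_cos; apply: second_orderZ; apply: second_orderD.
      by apply: second_orderD hth (second_orderZ _ htt).
    exact: second_order_cst.
  apply: second_orderD; apply: second_orderZ.
    apply: second_order_expR; apply: second_orderD.
      exact: second_orderZ hph.
    exact: second_orderZ hsg.
  apply: second_orderM.
    by apply: second_order_expR; exact: second_orderZ hph.
  apply: second_orderD; first exact: second_order_cst.
  by apply: second_orderZ; apply: second_orderD htt (second_order_cst _).
- reflexivity.
rewrite /= ph0 !mulr0 !add0r expR0.
have -> : p * (th 0 + -1 * tt 0 + - (pi / 2)) = psi by rewrite /psi; congr (_ * _); ring.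
rewrite /S; move: (expR _) (expR _) (cos _) (sin _) => e1 e2 c1 s1; ring.
Qed.

(** Concavity of [ln] and convexity of [cutoff] give a function supporting
    [- ln f] from below, with an explicit second derivative. *)
Lemma level_support : 0 < f 0 -> - 2^-1 <= tt 0 <= pi + 2^-1 ->
  exists g a, [/\ second_order g a (- (1 / f 0) *
  (C * S - expR (2 * sg 0) * ((p * de + 2 * al) ^+ 2 + p * (- 2 * ga * de) + 2 * (be ^+ 2 - al ^+ 2))
   - (H0 * ((p * de) ^+ 2 + p * (- 2 * ga * de)) + 2 * p * k * de * ga + k * (de ^+ 2 - ga ^+ 2)))
    + p * (- 2 * ga * de)), g 0 = - ln (f 0)
    & forall r, 0 < f r -> - 2^-1 <= tt r <= pi + 2^-1 -> g r <= - ln (f r)].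
Proof.
move=> f0 t0; have [a ha] := big_second_order.
exists (fun r => (1 - ln (f 0)) + (- (1 / f 0) * big r + p * ph r)); eexists; split.
- apply: second_order_eq (second_orderD (second_order_cst _)
   (second_orderD (second_orderZ _ ha) (second_orderZ _ hph))) _ _; first reflexivity.
  by rewrite add0r.
- rewrite ph0 mulr0 addr0.
  have -> : big 0 = f 0.
    rewrite /big /f ph0 !mulr0 !add0r expR0 subrr mulr0 addr0 mul1r /H0.
    have -> : p * (th 0 + -1 * tt 0 + - (pi / 2)) = p * (th 0 - tt 0 - pi / 2) by congr (_ * _); ring.
    by ring.
  rewrite mulNr div1r mulVf ?lt0r_neq0//; ring.
move=> r fr tr.
have Br : f r * expR (p * ph r) <= big r.
  have -> : f r * expR (p * ph r) = C * (expR (p * (ph r + sg r)) * cos (p * (th r + (-1) * tt r + - (pi / 2)))) +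
  ((-1) * expR (p * ph r + 2 * sg r) + (-1) * (expR (p * ph r) * cutoff nu (tt r))).
    have -> : p * (th r + -1 * tt r + - (pi / 2)) = p * (th r - tt r - pi / 2) by congr (_ * _); ring.
    rewrite /f (mulrDr p (ph r)) !expRD.
    move: (expR _) (expR _) (expR _) (cos _) => e1 e2 e3 c1. ring.
  rewrite /big !lerD2l !mulN1r lerN2 ler_pM2l ?expR_gt0//.
  rewrite /H0 /k /cutoff; case: ltP => h.
    rewrite (max_l (_ : 0 <= damping (tt 0) - nu)) ?subr_ge0 ?(ltW h)//.
    rewrite le_max; apply/orP; left.
    by have := damping_tangent t0 tr; lra.
  by rewrite max_r ?subr_le0// mul0r addr0 le_max lexx orbT.
have p0 : 0 < f r * expR (p * ph r) by rewrite mulr_gt0// expR_gt0.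
have := ln_tangent f0 p0; rewrite lnM ?posrE ?expR_gt0// expRK.
have : - (1 / f 0) * big r <= - (1 / f 0) * (f r * expR (p * ph r)).
  by rewrite !mulNr lerN2 ler_wpM2l// divr_ge0// ltW.
move: (f r * expR (p * ph r)) (big r) => B b h1.
have -> : (B - f 0) / f 0 = (1 / f 0) * B - 1 by field; rewrite lt0r_neq0.
lra.
Qed.

End Level.
End Supports.

Section TubePsh.
Context {R : realType}.
Implicit Types (X W : Cspace R 2).

Lemma real_line X W (r : R) : [/\ zx (X + (r +i* 0)%C *: W) = zx X + r * zx W,
  zy (X + (r +i* 0)%C *: W) = zy X + r * zy W,
  wx (X + (r +i* 0)%C *: W) = wx X + r * wx W
  & wy (X + (r +i* 0)%C *: W) = wy X + r * wy W].
Proof.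
rewrite /zx /zy /wx /wy !mxE.
by case: (W 0 0) (W 0 1) (X 0 0) (X 0 1) => [a b] [c d] [e f] [g h] /=; split; ring.
Qed.

Lemma imaginary_line X W (r : R) : [/\ zx (X + (0 +i* r)%C *: W) = zx X + r * - zy W,
  zy (X + (0 +i* r)%C *: W) = zy X + r * zx W,
  wx (X + (0 +i* r)%C *: W) = wx X + r * - wy W
  & wy (X + (0 +i* r)%C *: W) = wy X + r * wx W].
Proof.
rewrite /zx /zy /wx /wy !mxE.
by case: (W 0 0) (W 0 1) (X 0 0) (X 0 1) => [a b] [c d] [e f] [g h] /=; split; ring.
Qed.

Lemma real_line_near X W (D : set (Cspace R 2)) : open D -> D X ->
  \forall r \near (0 : R), D (X + (r +i* 0)%C *: W).
Proof.
move=> oD DX; have cl : {for 0, continuous (fun r : R => X + ((r +i* 0)%C : (complex R : numFieldType)) *: W)}.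
  apply: line_continuous; apply: C_continuous => /=; last exact: cvg_cst.
  exact: cvg_id.
apply: cl; rewrite (_ : (0 +i* 0)%C = 0)// scale0r addr0.
exact: open_nbhs_nbhs.
Qed.

Lemma imaginary_line_near X W (D : set (Cspace R 2)) : open D -> D X ->
  \forall r \near (0 : R), D (X + (0 +i* r)%C *: W).
Proof.
move=> oD DX; have cl : {for 0, continuous (fun r : R => X + ((0 +i* r)%C : (complex R : numFieldType)) *: W)}.
  apply: line_continuous; apply: C_continuous => /=; first exact: cvg_cst.
  exact: cvg_id.
apply: cl; rewrite (_ : (0 +i* 0)%C = 0)// scale0r addr0.
exact: open_nbhs_nbhs.
Qed.

(** Turning the direction [xi + i eta] by a right angle replaces [al + i be] by
    [- be + i al]. *)
Lemma second_order_log_modulus_rot (x0 y0 xi eta : R) (N := x0 ^+ 2 + y0 ^+ 2) :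
  0 < N -> second_order (fun r => log_modulus (x0 + r * - eta) (y0 + r * xi))
   (- ((x0 * eta - y0 * xi) / N))
   (((x0 * xi + y0 * eta) / N) ^+ 2 - (- ((x0 * eta - y0 * xi) / N)) ^+ 2).
Proof.
move=> N0; apply: second_order_eq (second_order_log_modulus (- eta) xi N0) _ _.
  by rewrite /N; ring.
by rewrite /N; ring.
Qed.

Lemma second_order_argument_rot (x0 y0 xi eta : R) (N := x0 ^+ 2 + y0 ^+ 2) :
  x0 < modulus x0 y0 -> second_order (fun r => argument (x0 + r * - eta) (y0 + r * xi))
   ((x0 * xi + y0 * eta) / N)
   (- 2 * (- ((x0 * eta - y0 * xi) / N)) * ((x0 * xi + y0 * eta) / N)).
Proof.
move=> N0; apply: second_order_eq (second_order_argument (- eta) xi N0) _ _.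
  by rewrite /N; ring.
by rewrite /N; ring.
Qed.

Variables (p C nu d : R).

Lemma tube_level_subharmonic X W : tube p C nu d X ->
  discrete_subharmonic (fun X => - ln (level p C nu (wx X - d) (wy X) (lz X))) X W.
Proof.
move=> tX; have [z0 sl /andP[t1 t2] ar lv] := tX.
have w0 := slit_gt0 sl.
pose N1 := (wx X - d) ^+ 2 + wy X ^+ 2; pose N2 := zx X ^+ 2 + zy X ^+ 2.
pose al := ((wx X - d) * wx W + wy X * wy W) / N1.
pose be := ((wx X - d) * wy W - wy X * wx W) / N1.
pose ga := (zx X * zx W + zy X * zy W) / N2.
pose de := (zx X * zy W - zy X * zx W) / N2.
have hsg := second_order_log_modulus (wx W) (wy W) w0; rewrite -/N1 -/al -/be in hsg.
have hth := second_order_argument (wx W) (wy W) sl; rewrite -/N1 -/al -/be in hth.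
have htt := second_order_log_modulus (zx W) (zy W) z0; rewrite -/N2 -/ga -/de in htt.
have hsg' := second_order_log_modulus_rot (wx W) (wy W) w0; rewrite -/N1 -/al -/be in hsg'.
have hth' := second_order_argument_rot (wx W) (wy W) sl; rewrite -/N1 -/al -/be in hth'.
have htt' := second_order_log_modulus_rot (zx W) (zy W) z0; rewrite -/N2 -/ga -/de in htt'.
move: al be ga de hsg hth htt hsg' hth' htt' => al be ga de hsg hth htt hsg' hth' htt'.
have tt0 : - 2^-1 <= lz X <= pi + 2^-1 by rewrite !ltW.
have := @level_support _ p C nu _ _ _ _ _ _ _ hsg hth htt.
rewrite !mul0r !addr0 => /(_ lv tt0) [g1 [a1 [h1 g10 g1le]]].
have := @level_support _ p C nu _ _ _ _ _ _ _ hsg' hth' htt'.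
rewrite !mul0r !addr0 => /(_ lv tt0) [g2 [a2 [h2 g20 g2le]]].
apply: (discrete_subharmonic_support h1 h2 g10 g20).
- set q := 1 / _; set E2 := expR (2 * _); set E1 := expR (p * _); set H0 := cutoff nu _.
  set c1 := cos _; set s1 := sin _; set k := if _ then _ else _.
  (* the contributions of the pluriharmonic terms cancel, and what remains are
     the Laplacians of two moduli of holomorphic functions *)
  rewrite (_ : _ + _ = q * (E2 * ((p * de + 2 * al) ^+ 2 + (p * ga - 2 * be) ^+ 2) +
     H0 * (p ^+ 2 * (de ^+ 2 + ga ^+ 2)))); last first.
    by move: q E2 E1 H0 c1 s1 k => q E2 E1 H0 c1 s1 k; ring.
  have q0 : 0 <= q by rewrite divr_ge0// ltW.
  have E0 : 0 <= E2 by exact: expR_ge0.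
  have H00 : 0 <= H0 by rewrite /H0 /cutoff le_max lexx orbT.
  by rewrite mulr_ge0// addr_ge0// mulr_ge0 ?addr_ge0 ?sqr_ge0// mulr_ge0 ?addr_ge0 ?sqr_ge0.
- apply: filterS (real_line_near W (@tube_open _ p C nu d) tX) => r [_ _ /andP[k1 k2] _].
  rewrite /lz; have [-> -> -> ->] := real_line X W r; rewrite addrAC => k3.
  apply: g1le => //; move: k1 k2; rewrite /lz; have [-> -> _ _] := real_line X W r.
  by move=> k1 k2; rewrite !ltW.
- apply: filterS (imaginary_line_near W (@tube_open _ p C nu d) tX) => r [_ _ /andP[k1 k2] _].
  rewrite /lz; have [-> -> -> ->] := imaginary_line X W r; rewrite addrAC => k3.
  apply: g2le => //; move: k1 k2; rewrite /lz; have [-> -> _ _] := imaginary_line X W r.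
  by move=> k1 k2; rewrite !ltW.
Qed.

(** If the real and the imaginary parts of the line see [f] as harmonic up to
    second order, then [- ln f] is subharmonic. *)
Lemma neg_ln_subharmonic X W (f : Cspace R 2 -> R) (f1 f2 : R -> R) a1 b1 a2 b2 (c0 c1 : R) :
  second_order f1 a1 b1 -> second_order f2 a2 b2 -> b1 + b2 = 0 -> 0 <= c0 ->
  0 < f1 0 -> f1 0 = f2 0 -> f X = c1 - c0 * ln (f1 0) ->
  (\forall r \near (0 : R), 0 < f1 r /\ f (X + (r +i* 0)%C *: W) = c1 - c0 * ln (f1 r)) ->
  (\forall r \near (0 : R), 0 < f2 r /\ f (X + (0 +i* r)%C *: W) = c1 - c0 * ln (f2 r)) ->
  discrete_subharmonic f X W.
Proof.
move=> h1 h2 b12 c00 p1 e12 fX n1 n2.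
pose g (f1 : R -> R) (r : R) := (c1 + c0 * (1 - ln (f1 0))) + (- (c0 / f1 0)) * f1 r.
have hg (f3 : R -> R) a b : second_order f3 a b -> second_order (g f3) (0 + - (c0 / f3 0) * a) (0 + - (c0 / f3 0) * b).
  by move=> h; exact: second_orderD (second_order_cst _) (second_orderZ _ h).
have g0 (f3 : R -> R) : 0 < f3 0 -> g f3 0 = c1 - c0 * ln (f3 0).
  by move=> h; rewrite /g mulNr divfK ?lt0r_neq0//; ring.
have gle (f3 : R -> R) r : 0 < f3 0 -> 0 < f3 r -> g f3 r <= c1 - c0 * ln (f3 r).
  move=> h hr; have := ler_wpM2l c00 (ln_tangent h hr).
  rewrite [(f3 r - f3 0) / f3 0]mulrBl divff ?lt0r_neq0// /g.
  by move: (f3 0)^-1 => i; lra.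
have p2 : 0 < f2 0 by rewrite -e12.
apply: (discrete_subharmonic_support (hg _ _ _ h1) (hg _ _ _ h2)).
- by rewrite g0.
- by rewrite g0// -e12.
- by rewrite !add0r -e12 -mulrDr b12 mulr0.
- by apply: filterS n1 => r [r0 ->]; exact: gle.
- by apply: filterS n2 => r [r0 ->]; exact: gle.
Qed.

(** The half-angle formula for the imaginary part of the square root. *)
Lemma modulus_half_argument (a b : R) : a < modulus a b ->
  modulus a b - a = 2 * (expR (2^-1 * log_modulus a b) * sin (2^-1 * argument a b)) ^+ 2.
Proof.
move=> sl; have m2 : expR (2^-1 * log_modulus a b) ^+ 2 = modulus a b.
  by rewrite -expRM_natl mulrA divff// mul1r expR_log_modulus ?slit_gt0.
rewrite exprMn m2.
rewrite -[X in _ - X](cos_argument sl).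
have {1}-> : argument a b = 2^-1 * argument a b + 2^-1 * argument a b by lra.
have := cos2Dsin2 (2^-1 * argument a b).
rewrite cosD; move: (cos _) (sin _) (modulus _ _) => c s m.
by move=> /(congr1 ( *%R m)); lra.
Qed.

Lemma tube_slit_subharmonic X W : tube p C nu d X ->
  discrete_subharmonic (fun X => - ln (modulus (wx X - d) (wy X) - (wx X - d))) X W.
Proof.
move=> tX; have [z0 sl /andP[t1 t2] ar lv] := tX.
pose F (a b : R) : R := expR (2^-1 * log_modulus a b) * sin (2^-1 * argument a b).
have F0 (a b : R) : a < modulus a b -> 0 < F a b.
  move=> _; rewrite mulr_gt0 ?expR_gt0//; apply: sin_gt0_pi.
  by have /andP[k1 k2] := argument_bounds a b; apply/andP; split; lra.
have w0 := slit_gt0 sl.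
have hsg := second_order_log_modulus (wx W) (wy W) w0.
have hth := second_order_argument (wx W) (wy W) sl.
have hsg' := second_order_log_modulus_rot (wx W) (wy W) w0.
have hth' := second_order_argument_rot (wx W) (wy W) sl.
have h1 := second_orderM (second_order_expR (second_orderZ 2^-1 hsg)) (second_order_sin (second_orderZ 2^-1 hth)).
have h2 := second_orderM (second_order_expR (second_orderZ 2^-1 hsg')) (second_order_sin (second_orderZ 2^-1 hth')).
have eq (a b : R) : a < modulus a b -> - ln (modulus a b - a) = - ln 2 - 2 * ln (F a b).
  move=> h; rewrite modulus_half_argument// lnM ?posrE ?exprn_gt0 ?F0// lnXn ?F0//.
  by rewrite -/(F a b) -mulr_natl; ring.
apply: (@neg_ln_subharmonic _ _ _ _ _ _ _ _ _ 2 (- ln 2) h1 h2); rewrite ?mul0r ?addr0 //.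
- move: (expR _) (sin _) (cos _) => e s c; ring.
- exact: F0.
- exact: eq.
- apply: filterS (real_line_near W (@tube_open _ p C nu d) tX) => r [_ sl' _ _ _].
  move: sl'; have [_ _ -> ->] := real_line X W r; rewrite addrAC => sl'.
  by split; [exact: F0|exact: eq].
- apply: filterS (imaginary_line_near W (@tube_open _ p C nu d) tX) => r [_ sl' _ _ _].
  move: sl'; have [_ _ -> ->] := imaginary_line X W r; rewrite addrAC => sl'.
  by split; [exact: F0|exact: eq].
Qed.

Lemma tube_height_subharmonic (e c : R) X W : e ^+ 2 = 1 -> tube p C nu d X ->
  (forall Y, tube p C nu d Y -> 0 < c + e * lz Y) ->
  discrete_subharmonic (fun X => - ln (c + e * lz X)) X W.
Proof.
move=> e2 tX c0; have [z0 _ _ _ _] := tX.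
have htt := second_order_log_modulus (zx W) (zy W) z0.
have htt' := second_order_log_modulus_rot (zx W) (zy W) z0.
have h1 := second_orderD (second_order_cst c) (second_orderZ e htt).
have h2 := second_orderD (second_order_cst c) (second_orderZ e htt').
apply: (@neg_ln_subharmonic _ _ _ _ _ _ _ _ _ 1 0 h1 h2); rewrite ?mul0r ?addr0 //.
- by rewrite /=; ring.
- exact: c0.
- by rewrite sub0r mul1r.
- apply: filterS (real_line_near W (@tube_open _ p C nu d) tX) => r /c0.
  by rewrite /lz; have [-> -> _ _] := real_line X W r; rewrite sub0r mul1r.
- apply: filterS (imaginary_line_near W (@tube_open _ p C nu d) tX) => r /c0.
  by rewrite /lz; have [-> -> _ _] := imaginary_line X W r; rewrite sub0r mul1r.
Qed.

Lemma tube_exhaustion_psh :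
  plurisubharmonic (tube p C nu d) (fun X => (tube_exhaustion p C nu d X)%:E).
Proof.
apply: discrete_psh; first exact: tube_open.
  exact: tube_exhaustion_continuous.
move=> X W tX; apply: discrete_subharmonic_max; apply: discrete_subharmonic_max.
- exact: tube_level_subharmonic.
- exact: tube_slit_subharmonic.
- rewrite (_ : (fun X => _) = (fun X => - ln (2^-1 + 1 * lz X))).
    apply: tube_height_subharmonic => //; first by rewrite expr1n.
    by move=> Y [_ _ /andP[k1 k2] _ _]; lra.
  by apply/funext => Y; rewrite mul1r addrC.
- rewrite (_ : (fun X => _) = (fun X => - ln ((pi + 2^-1) + -1 * lz X))).
    apply: tube_height_subharmonic => //; first by rewrite sqrrN expr1n.
    by move=> Y [_ _ /andP[k1 k2] _ _]; lra.
  by apply/funext => Y; rewrite mulN1r.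
Qed.

End TubePsh.

(** * Pseudoconvexity of the tubes *)

Section TubePseudoconvex.
Context {R : realType}.
Variables (p C nu d : R).
Hypotheses (p0 : 0 < p) (p1 : p <= 1) (C1 : 1 <= C).

Lemma norm_coords_le_modulus (a b : R) : `|a| <= modulus a b /\ `|b| <= modulus a b.
Proof.
by rewrite -!sqrtr_sqr; split; apply: ler_wsqrtr; rewrite ?lerDl ?lerDr sqr_ge0.
Qed.

(** Since [p <= 1], [level > 0] forces [m^2 < C m^p], which bounds the modulus
    [m]. *)
Lemma level_gt0_bound (a b t : R) : a < modulus a b -> 0 < level p C nu a b t -> modulus a b <= C.
Proof.
move=> sl; have m0 := slit_gt0 sl; rewrite -expR_log_modulus// /level.
set s := log_modulus a b; set c := cos _ => lv.
have h0 : 0 <= cutoff nu t by rewrite /cutoff le_max lexx orbT.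
have h1 : expR (2 * s) <= C * expR (p * s).
  have : C * expR (p * s) * c <= C * expR (p * s).
    by rewrite ler_piMr ?cos_le1// mulr_ge0 ?expR_ge0// (le_trans _ C1).
  by lra.
have [s0|s0] := leP s 0; first by apply: le_trans C1; rewrite expR_le1.
have h2 : expR (p * s) <= expR s by rewrite ler_expR ler_piMl// ltW.
have h3 : expR (2 * s) <= C * expR s by apply: le_trans h1 _; rewrite ler_pM2l// (lt_le_trans _ C1).
by rewrite expRM_natl expr2 ler_pM2r ?expR_gt0// in h3.
Qed.

Lemma tube_coords X : tube p C nu d X -> forall i,
  `|complex.Re (X 0 i)| <= C + `|d| + expR (pi + 2^-1) /\
  `|complex.Im (X 0 i)| <= C + `|d| + expR (pi + 2^-1).
Proof.
move=> [z0 sl /andP[t1 t2] ar lv]; have c1 := C1.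
have := level_gt0_bound sl lv => mC.
have [k1 k2] := norm_coords_le_modulus (wx X - d) (wy X).
have [k3 k4] := norm_coords_le_modulus (zx X) (zy X).
have k5 : modulus (zx X) (zy X) <= expR (pi + 2^-1).
  by rewrite -expR_log_modulus// ler_expR ltW.
have e0 := @expR_ge0 R (pi + 2^-1); have d0 := normr_ge0 d.
have k6 : `|wx X| <= `|wx X - d| + `|d| by have := ler_normD (wx X - d) d; rewrite subrK.
case; case=> [|[|//]] i.
  rewrite (_ : Ordinal i = 0); last exact: val_inj.
  by rewrite -/(zx X) -/(zy X); split; lra.
rewrite (_ : Ordinal i = 1); last exact: val_inj.
by rewrite -/(wx X) -/(wy X); split; lra.
Qed.

(** The conditions defining the tube survive passage to the limit along a
    sublevel set of the exhaustion: the logarithmic terms keep away from the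
    slit, from the ends and from the zero set of [level], and the angular
    condition is implied by the positivity of [level]. *)
Lemma tube_sublevel_closed c :
  closure [set X | tube p C nu d X /\ tube_exhaustion p C nu d X < c] `<=` tube p C nu d.
Proof.
move=> X clX; set S := [set X | _] in clX.
have neg_ln_lt (x : R) : 0 < x -> - ln x < c -> expR (- c) <= x.
  by move=> x0 xc; rewrite -[leRHS]lnK// ler_expR; lra.
have Sn Y : S Y -> [/\ tube p C nu d Y, expR (- c) <= level p C nu (wx Y - d) (wy Y) (lz Y),
   expR (- c) <= modulus (wx Y - d) (wy Y) - (wx Y - d),
   expR (- c) <= lz Y + 2^-1 & expR (- c) <= pi + 2^-1 - lz Y].
  move=> [tY]; rewrite /tube_exhaustion !gt_max => /andP[/andP[k1 k2] /andP[k3 k4]].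
  have [z0 sl /andP[t1 t2] ar lv] := tY.
  by split => //; apply: neg_ln_lt => //; lra.
have z0 : expR (- 1) <= zx X ^+ 2 + zy X ^+ 2.
  have cz : {for X, continuous (fun Y => zx Y ^+ 2 + zy Y ^+ 2)}.
    by apply: sqr_modulus_continuous; [exact: zx_continuous|exact: zy_continuous].
  apply: (closure_ge cz clX) => Y /Sn[[z0 _ /andP[t1 _] _ _] _ _ _ _].
  by rewrite -[leRHS]lnK// ler_expR; move: t1; rewrite /lz /log_modulus; lra.
have {}z0 : 0 < zx X ^+ 2 + zy X ^+ 2 by apply: lt_le_trans z0; exact: expR_gt0.
have sl : wx X - d < modulus (wx X - d) (wy X).
  rewrite -subr_gt0; apply: (@lt_le_trans _ _ (expR (- c))); first exact: expR_gt0.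
  have cg := @gap_continuous R d X.
  by apply: (closure_ge cg clX) => Y /Sn[].
have cl := lz_continuous z0.
have lv : 0 < level p C nu (wx X - d) (wy X) (lz X).
  apply: (@lt_le_trans _ _ (expR (- c))); first exact: expR_gt0.
  have cg := @level_continuous R p C nu d X z0 sl.
  by apply: (closure_ge cg clX) => Y /Sn[].
have t1 : expR (- c) <= lz X + 2^-1.
  have cg := ctsD cl (@ctsC _ _ (2^-1 : R) X).
  by apply: (closure_ge cg clX) => Y /Sn[].
have t2 : expR (- c) <= pi + 2^-1 - lz X.
  have cg := ctsB (@ctsC _ _ (pi + 2^-1 : R) X) cl.
  by apply: (closure_ge cg clX) => Y /Sn[].
have e0 := @expR_gt0 R (- c).
split => //; first by apply/andP; split; lra.
set y := argument _ _ - _ - _.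
have y1 : `|y| <= pi / (2 * p).
  rewrite -lerN2.
  have cg := ctsN (cts_comp (@angle_continuous R d X z0 sl) (@norm_continuous R R _)).
  apply: (closure_ge cg clX) => Y /Sn[[_ _ _ ar _] _ _ _ _].
  by rewrite lerN2 ltW.
rewrite lt_neqAle y1 andbT; apply/eqP => y2.
move: lv; rewrite /level -/y -cos_norm normrM y2 (gtr0_norm p0).
have -> : p * (pi / (2 * p)) = pi / 2 by move: (pi : R) => P; field; rewrite lt0r_neq0.
rewrite cos_pihalf mulr0 sub0r.
have : 0 <= cutoff nu (lz X) by rewrite /cutoff le_max lexx orbT.
have := @expR_gt0 R (2 * log_modulus (wx X - d) (wy X)); lra.
Qed.

Lemma tube_pseudoconvex : pseudoconvex (tube p C nu d).
Proof.
exists (tube_exhaustion p C nu d); split.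
- apply: continuous_in_subspaceT => X; rewrite inE; exact: tube_exhaustion_continuous.
- exact: tube_exhaustion_psh.
move=> c S; split; last exact: tube_sublevel_closed.
apply: (@closed_box_compact _ _ (C + `|d| + expR (pi + 2^-1))); first exact: closed_closure.
by move=> X /tube_sublevel_closed; exact: tube_coords.
Qed.

End TubePseudoconvex.

(** * The worm *)

Section Worm.
Context {R : realType}.
Implicit Types (a b t : R) (X : Cspace R 2).

(** [b cos t - a sin t] is the imaginary part of [w e^(- i t)]: over a circle
    [|z| = e^t] the worm is a disc centred at [(i / 2) e^(i t)], of squared radius
    [1 / 4 - damping t].  When [t] runs over the core [[0, pi]] the disc rotates
    around [0], which stays on its boundary, by exactly a half-turn. *)
Definition worm_fun a b t : R := a ^+ 2 + b ^+ 2 - (b * cos t - a * sin t) + damping t.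

Definition worm : set (Cspace R 2) :=
  [set X | 0 < zx X ^+ 2 + zy X ^+ 2 /\ worm_fun (wx X) (wy X) (lz X) < 0].

Definition closed_worm : set (Cspace R 2) :=
  [set X | 0 < zx X ^+ 2 + zy X ^+ 2 /\ worm_fun (wx X) (wy X) (lz X) <= 0].

Lemma worm_fun_center a b t : worm_fun a b t =
  (a + sin t / 2) ^+ 2 + (b - cos t / 2) ^+ 2 - 4^-1 + damping t.
Proof. by rewrite /worm_fun; have := cos2Dsin2 t; lra. Qed.

Lemma worm_fun_sym a b t : worm_fun a (- b) (pi - t) = worm_fun a b t.
Proof.
rewrite /worm_fun damping_sym cosB sinB cospi sinpi.
by move: (cos t) (sin t) (damping t) => c s e; ring.
Qed.

Lemma worm_height a b t : worm_fun a b t <= 0 -> - 2^-1 < t < pi + 2^-1.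
Proof.
move=> P0; rewrite !ltNge -negb_or; apply/negP => /orP h.
have := damping_ge1 h; move: P0; rewrite worm_fun_center.
have := sqr_ge0 (a + sin t / 2); have := sqr_ge0 (b - cos t / 2); lra.
Qed.

(** Below the core the discs are tangent to the real axis up to the flat term,
    which keeps them strictly above it. *)
Lemma worm_below a b t : worm_fun a b t <= 0 -> t < 0 -> 0 < b.
Proof.
move=> P0 t0; have /andP[t1 _] := worm_height P0.
have p1 := @pihalf_ge1 R.
have c0 : 0 < cos t by apply: cos_gt0_pihalf; apply/andP; split; lra.
have tN : 0 < - t by rewrite oppr_gt0.
move: P0; rewrite /worm_fun damping_neg ?(ltW t0)// rampP// sinN sqrrN.
have := flat_gt0 (- t); have := sqr_ge0 (a + sin t / 2); have := sqr_ge0 b.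
move: (flat _) => F h1 h2 h3 h4.
have : 0 < b * cos t by lra.
by rewrite pmulr_lgt0.
Qed.

Lemma worm_above a b t : worm_fun a b t <= 0 -> pi < t -> b < 0.
Proof.
rewrite -worm_fun_sym => P0 tp; rewrite -oppr_gt0; apply: worm_below P0 _.
by rewrite subr_lt0.
Qed.

(** Apart from its points with [w = 0], the closed worm avoids the half-line
    [w >= 0]: the half-turn of the core just fails to reach it, and outside the
    core the flat term keeps the discs away from the real axis. *)
Lemma worm_slit a b t : worm_fun a b t <= 0 -> (a != 0) || (b != 0) -> a < modulus a b.
Proof.
move=> P0 ab; have [t0|t0] := ltP t 0.
  by apply: slitP; rewrite gt_eqF// (worm_below P0).
have [tp|tp] := ltP pi t; first by apply: slitP; rewrite lt_eqF// (worm_above P0).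
apply: slitP; have [b0|//] := eqVneq b 0; rewrite /= ltNge; apply/negP => a0.
move: ab P0; rewrite b0 eqxx orbF => an0.
rewrite /worm_fun expr0n mul0r /= addr0 sub0r opprK damping_core ?t0// addr0.
have s0 : 0 <= sin t by apply: sin_ge0_pi; rewrite t0.
have : 0 < a ^+ 2 by rewrite exprn_even_gt0.
have : 0 <= a * sin t by rewrite mulr_ge0.
lra.
Qed.

Lemma modulus_cos a b t : a < modulus a b ->
  modulus a b * cos (argument a b - t - pi / 2) = b * cos t - a * sin t.
Proof.
move=> sl; rewrite cosBpihalf sinB mulrBr !mulrA.
by rewrite sin_argument// cos_argument.
Qed.

Lemma cos_lt0_pihalf (x : R) : pi / 2 < `|x| < 3 * pi / 2 -> cos x < 0.
Proof.
move=> /andP[h1 h2]; rewrite -cos_norm -[`|x|](subrK pi) cosDpi oppr_lt0.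
by apply: cos_gt0_pihalf; apply/andP; split; lra.
Qed.

Lemma argument_upper a b : a < modulus a b -> 0 < b -> argument a b < pi.
Proof.
move=> sl b0; rewrite /argument.
have : 0 < atan (b / (modulus a b - a)).
  by rewrite -atan0; apply: lt_atan; rewrite divr_gt0// subr_gt0.
lra.
Qed.

Lemma argumentN a b : argument a (- b) = 2 * pi - argument a b.
Proof. by rewrite /argument /modulus sqrrN mulNr atanN; ring. Qed.

(** [position a b t] says that [w = a + i b] is on the side of the slit that is
    allowed at height [t]. *)
Definition position a b t := [/\ - 2^-1 < t < pi + 2^-1, t < 0 -> 0 < b & pi < t -> b < 0].

Lemma angle_range a b t : a < modulus a b -> position a b t ->
  `|argument a b - t - pi / 2| < 3 * pi / 2.
Proof.
move=> sl [/andP[t1 t2] tb ta]; have p2 := @pi_ge2 R.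
have /andP[a1 a2] := argument_bounds a b; rewrite ltr_norml.
have [t0|t0] := ltP t 0.
  by have := argument_upper sl (tb t0); move=> a3; apply/andP; split; lra.
have [tp|tp] := ltP pi t.
  have sl' : a < modulus a (- b) by rewrite /modulus sqrrN.
  have bN : 0 < - b by rewrite oppr_gt0; exact: ta.
  have := argument_upper sl' bN; rewrite argumentN => a3.
  by apply/andP; split; lra.
by apply/andP; split; lra.
Qed.

(** The sign of [cos (argument - t - pi / 2)] determines the angle without
    ambiguity because the branch of the argument keeps it in a range shorter
    than [3 pi]. *)
Lemma angle_le a b t : a < modulus a b -> position a b t ->
  0 <= b * cos t - a * sin t -> `|argument a b - t - pi / 2| <= pi / 2.
Proof.
move=> sl ps; rewrite -modulus_cos// => h; rewrite leNgt; apply/negP => k.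
have := angle_range sl ps => k2.
have c0 := @cos_lt0_pihalf _; have := c0 (argument a b - t - pi / 2).
rewrite k k2 => /(_ isT); move: h; rewrite pmulr_rge0 ?modulus_gt0 ?slit_gt0//.
lra.
Qed.

Lemma worm_position a b t : worm_fun a b t <= 0 -> position a b t.
Proof. by move=> P0; split; [exact: worm_height P0|exact: worm_below P0|exact: worm_above P0]. Qed.

Lemma cos_ge1sub (x : R) : 1 - x ^+ 2 / 2 <= cos x.
Proof.
have -> : x = x / 2 + x / 2 by lra.
rewrite cosD -!expr2 cos2sin2.
have : sin (x / 2) ^+ 2 <= (x / 2) ^+ 2.
  have h (y : R) : 0 <= y -> sin y ^+ 2 <= y ^+ 2.
    move=> y0; rewrite -real_normK ?num_real// ler_pXn2r ?nnegrE//.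
    exact: norm_sin_le.
  have [x0|/ltW x0] := leP 0 (x / 2); first exact: h.
  by rewrite -(sqrrN (x / 2)) -(sqrrN (sin _)) -sinN; apply: h; rewrite oppr_ge0.
lra.
Qed.

(** For [p = C = 1] and [nu = d = 0] the function [level] is [- worm_fun], and the
    angular condition of the tube is automatic. *)
Lemma worm_tube : worm = tube 1 1 0 0.
Proof.
have lvl a b t : a < modulus a b -> level 1 1 0 a b t = - worm_fun a b t.
  move=> sl; rewrite /level !mul1r expRM_natl expR_log_modulus ?slit_gt0// modulus_cos//.
  rewrite sqr_modulus /cutoff subr0 max_l ?damping_ge0// /worm_fun; ring.
apply/seteqP; split => X.
  move=> [z0 P0]; have n0 : (wx X != 0) || (wy X != 0).
    rewrite -negb_and; apply/negP => /andP[/eqP a0 /eqP b0]; move: P0.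
    have -> : worm_fun (wx X) (wy X) (lz X) = damping (lz X) by rewrite a0 b0 /worm_fun; ring.
    by rewrite ltNge damping_ge0.
  have sl := worm_slit (ltW P0) n0.
  split => //; rewrite ?subr0//; first exact: worm_height (ltW P0).
    rewrite mulr1 lt_neqAle angle_le ?andbT//; last 2 first.
    - exact: worm_position (ltW P0).
    - move: P0; rewrite /worm_fun; have := damping_ge0 (lz X); have := sqr_ge0 (wx X); have := sqr_ge0 (wy X); lra.
    apply/eqP => y; have := modulus_cos (lz X) sl; rewrite -cos_norm y cos_pihalf mulr0.
    move: P0 (slit_gt0 sl); rewrite /worm_fun; have := damping_ge0 (lz X); lra.
  by rewrite lvl// oppr_gt0.
move=> [z0 sl _ _]; rewrite subr0 in sl *.
by rewrite lvl// oppr_gt0.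
Qed.

Lemma worm_open : open worm.
Proof. by rewrite worm_tube; exact: tube_open. Qed.

Lemma worm_pseudoconvex : pseudoconvex worm.
Proof. by rewrite worm_tube; apply: tube_pseudoconvex. Qed.

End Worm.

(** * The closed worm inside shrinking tubes *)

Section Neighborhoods.
Context {R : realType}.
Implicit Types (a b t : R) (X : Cspace R 2).

Lemma cos_lipschitz (x y : R) : `|cos y - cos x| <= `|y - x|.
Proof.
wlog xy : x y / x <= y => [wl|].
  by have [|/ltW] := leP x y; [exact: wl|move/wl; rewrite distrC (distrC x)].
have Hd : forall z : R, z \in `]x, y[%R -> is_derive z (1 : R) cos (- sin z).
  by move=> z _; exact: is_derive_cos.
have cs : {within `[x, y], continuous (@cos R)} by apply: continuous_subspaceT; exact: continuous_cos.
have [c _ ->] := MVT_segment xy Hd cs.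
by rewrite normrM normrN ler_piMl// sin_max.
Qed.

(** Convexity of the exponential: the power [m^p] is at most [1 - p + p m]. *)
Lemma expR_weighted (p s : R) : 0 <= p <= 1 -> expR (p * s) <= 1 - p + p * expR s.
Proof.
move=> /andP[p0 p1].
have h1 : expR (p * s) * (1 + (s - p * s)) <= expR s.
  by rewrite -[X in _ <= expR X](subrKC (p * s)) expRD ler_pM2l ?expR_gt0// expR_ge1Dx.
have h2 : expR (p * s) * (1 - p * s) <= 1.
  by rewrite -[X in _ <= X](expRxMexpNx_1 (p * s)) ler_pM2l ?expR_gt0// expR_ge1Dx.
have p1' : 0 <= 1 - p by lra.
have := ler_wpM2l p0 h1; have := ler_wpM2l p1' h2; move: (expR _) (expR s) => e1 e2; lra.
Qed.

(** On the tube [worm_fun < worm_fun + level], and the sum of the two is small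
    because [w] is bounded and each parameter is close to its limit value. *)
Lemma tube_close (p C nu d : R) X : 2^-1 <= p < 1 -> 1 <= C <= 4 -> 0 <= nu -> 0 <= d <= 1 ->
  tube p C nu d X ->
  worm_fun (wx X) (wy X) (lz X) < 4 * (C - 1) + 17 * (1 - p) + nu + 10 * d.
Proof.
move=> /andP[p2 p1] /andP[C1 C4] nu0 /andP[d0 d1] [z0 sl _ ar lv].
have p0 : 0 < p by lra.
have mC := level_gt0_bound (ltW p1) C1 sl lv.
have mcos := modulus_cos (lz X) sl.
have m0 := modulus_gt0 (slit_gt0 sl); have m2 := sqr_modulus (wx X - d) (wy X).
have [ma _] := norm_coords_le_modulus (wx X - d) (wy X).
move: (lz X) (wx X) (wy X) z0 ar lv mcos sl mC m0 m2 ma => t a b z0 ar.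
rewrite /level expRM_natl; set s := log_modulus _ _; set y := argument _ _ - _ - _ => lv.
rewrite -/y => mcos sl mC m0 m2 ma.
rewrite -expR_log_modulus ?slit_gt0// -/s in mcos mC m0 m2 ma.
have p01 : 0 <= p <= 1 by rewrite !ltW.
have ew := expR_weighted s p01.
have c1 : 0 <= cos (p * y).
  have : `|p * y| <= pi / 2.
    rewrite normrM (gtr0_norm p0) mulrC -ler_pdivlMr//.
    by apply: le_trans (ltW ar) _; rewrite invfM mulrA.
  by rewrite -cos_norm => h; apply: cos_ge0_pihalf; rewrite h andbT; apply: le_trans (normr_ge0 _); have := @pihalf_ge1 R; lra.
have c2 := cos_le1 (p * y).
have pi4 : pi <= 4 :> R by have := @pihalf_lt2 R; lra.
have c3 : cos (p * y) - cos y <= 4 * (1 - p).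
  apply: le_trans (ler_norm _) _; apply: le_trans (cos_lipschitz _ _) _.
  have -> : p * y - y = (p - 1) * y by ring.
  rewrite normrM ltr0_norm ?subr_lt0// opprB mulrC ler_wpM2r//; first lra.
  apply: le_trans (ltW ar) _; rewrite ler_pdivrMr ?mulr_gt0//.
  by apply: le_trans pi4 _; lra.
have hc : damping t - nu <= cutoff nu t by rewrite /cutoff le_max lexx.
have sn := sin_le1 t; rewrite /worm_fun.
move: (expR (p * s)) (expR_ge0 (p * s)) (expR s) ew lv mcos mC m0 m2 ma => e1 e10 m h lv mcos mC m0 m2 ma.
move: (cos (p * y)) (cos y) (cutoff nu t) (cos t) (sin t) (damping t) c1 c2 c3 hc sn lv mcos.
move=> cp cy cu ct st da c1 c2 c3 hc sn lv mcos.
have sq : a ^+ 2 + b ^+ 2 = m ^+ 2 + 2 * d * (a - d) + d ^+ 2 by rewrite m2; ring.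
have k1 : 2 * d * (a - d) <= 2 * d * m.
  by apply: ler_wpM2l; [lra|apply: le_trans ma; exact: ler_norm].
have k2 : d * st <= d by rewrite ler_piMr.
have k3 : d ^+ 2 <= d by rewrite expr2 ler_piMr.
have k4 : m * (cp - cy) <= 4 * (4 * (1 - p)).
  have : m * (cp - cy) <= m * (4 * (1 - p)) by rewrite ler_pM2l.
  have : m * (4 * (1 - p)) <= 4 * (4 * (1 - p)) by rewrite ler_wpM2r//; lra.
  lra.
have k5 : (e1 - m) * cp <= 1 - p.
  have : e1 - m <= 1 - p.
    have : 0 <= (1 - p) * m by rewrite mulr_ge0//; lra.
    lra.
  have : (e1 - m) * cp <= (1 - p) * cp + 0.
    have := ler_wpM2r c1 (_ : e1 - m <= 1 - p); rewrite addr0; apply.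
    have : 0 <= (1 - p) * m by rewrite mulr_ge0//; lra.
    lra.
  have : (1 - p) * cp <= 1 - p by rewrite ler_piMr//; lra.
  lra.
have e14 : e1 <= 4.
  have : (1 - p) * 1 <= (1 - p) * 4 by rewrite ler_wpM2l//; lra.
  have : p * m <= p * 4 by rewrite ler_pM2l//; lra.
  lra.
have k6 : (C - 1) * (e1 * cp) <= 4 * (C - 1).
  rewrite mulrC ler_wpM2r//; first lra.
  have : e1 * cp <= e1 by rewrite ler_piMr.
  lra.
have k7 : d * m <= d * 4 by apply: ler_wpM2l => //; lra.
lra.
Qed.

End Neighborhoods.

Section Inclusion.
Context {R : realType}.
Implicit Types (a b t : R) (X : Cspace R 2).

Lemma sin_ge_half (x : R) : 0 <= x <= 2^-1 -> x / 2 <= sin x.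
Proof.
move=> /andP[x0 x2]; have Hd : forall y : R, y \in `]0, x[%R -> is_derive y (1 : R) sin (cos y).
  by move=> y _; exact: is_derive_sin.
have cs : {within `[0, x], continuous (@sin R)} by apply: continuous_subspaceT; exact: continuous_sin.
have [c] := MVT_segment x0 Hd cs; rewrite in_itv /= => /andP[c0 cx].
rewrite sin0 !subr0 => ->; have := cos_ge1sub c.
have : c ^+ 2 <= 1 by rewrite expr_le1//; lra.
move=> h1 h2; rewrite mulrC; apply: ler_wpM2r => //; lra.
Qed.

Lemma cos_nincr (x y : R) : 0 <= x -> x <= y -> y <= pi -> cos y <= cos x.
Proof.
move=> x0 xy yp; move: xy; rewrite le_eqVlt => /predU1P[->//|xy].
have xi : x \in `[0, pi] by rewrite in_itv /= x0 (le_trans (ltW xy)).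
have yi : y \in `[0, pi] by rewrite in_itv /= yp (le_trans x0 (ltW xy)).
by apply: ltW; rewrite ltr_cos.
Qed.

Lemma le_scale_npos (x s : R) : x <= 1 -> s <= 0 -> s <= x * s.
Proof. by nra. Qed.

Lemma le1_of_sqr (x : R) : x ^+ 2 <= x -> x <= 1.
Proof. by nra. Qed.

Lemma rotation_le_modulus a b t : b * cos t - a * sin t <= modulus a b.
Proof.
rewrite -[leRHS]ger0_norm ?modulus_ge0//; apply: le_trans (ler_norm _) _.
rewrite -(@ler_pXn2r _ 2)// ?nnegrE// !real_normK ?num_real// sqr_modulus.
have := sqr_ge0 (b * sin t + a * cos t); have := cos2Dsin2 t.
move: (cos t) (sin t) => c s e h.
have -> : a ^+ 2 + b ^+ 2 = (a ^+ 2 + b ^+ 2) * (c ^+ 2 + s ^+ 2) by rewrite e mulr1.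
by rewrite -subr_ge0; move: h; congr (_ <= _); ring.
Qed.

(** Lowering the exponent from [1] to [p] increases [m^p] for [m <= 1], and
    loses at most the factor [1 + d] for [m <= 1 + d]. *)
Lemma expR_contract (p d l : R) : 0 < p <= 1 -> 0 <= d -> expR l <= 1 + d ->
  expR l / (1 + d) <= expR (p * l).
Proof.
move=> /andP[p0 p1] d0 le; have d1 : 0 < 1 + d by lra.
have [l0|l0] := leP l 0.
  apply: (@le_trans _ _ (expR l)); first by rewrite ler_pdivrMr// ler_peMr ?expR_ge0//; lra.
  by rewrite ler_expR; exact: le_scale_npos.
apply: (@le_trans _ _ 1); first by rewrite ler_pdivrMr// mul1r.
by rewrite -expR0 ler_expR mulr_ge0// ltW.
Qed.

Lemma ramp_ge_sqr (tau : R) : 0 <= tau <= 2^-1 -> tau ^+ 2 / 16 <= ramp tau.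
Proof.
move=> /andP[]; rewrite le_eqVlt => /predU1P[<- _|t0 t2].
  by rewrite expr0n /= mul0r ramp_ge0.
have st : tau / 2 <= sin tau by apply: sin_ge_half; rewrite t2 ltW.
have : (tau / 2) ^+ 2 <= sin tau ^+ 2.
  by rewrite ler_pXn2r ?nnegrE ?divr_ge0 ?(ltW t0)//; apply: le_trans st; rewrite divr_ge0// ltW.
by rewrite rampP//; have := flat_gt0 tau; lra.
Qed.

(** The translation by [d] costs terms of order [d m3], where [m3] measures the
    distance to the annulus [w = 0] of the core; as soon as [m3 >= 100 d / mu]
    they are absorbed by the quadratic term inflated by [1 + mu]. *)
Lemma translation_gap (mu d tau rho r m3 m q : R) :
  0 < mu <= 1 -> 0 < d -> 0 <= tau <= m3 -> 0 <= rho <= m3 -> 0 < m3 ->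
  d <= mu * m3 / 100 -> m3 ^+ 2 / 16 <= rho ^+ 2 + r -> rho ^+ 2 + r - d * tau <= q ->
  0 <= m <= rho + d -> 0 < q /\ m ^+ 2 + r < (1 + mu) * q.
Proof.
move=> /andP[m0 m1] d1 /andP[t0 t3] /andP[r0 r3] m30 dm3 L16 L0 /andP[g0 gm].
have dm3' : d * m3 <= mu * m3 ^+ 2 / 100.
  by have := ler_wpM2r (ltW m30) dm3; rewrite expr2; lra.
have mum : mu * m3 ^+ 2 <= m3 ^+ 2 by rewrite ler_piMl// sqr_ge0.
have m32 : 0 < m3 ^+ 2 by rewrite exprn_gt0.
have dtau : d * tau <= d * m3 by rewrite ler_pM2l.
split; first lra.
have k2 : m ^+ 2 <= rho ^+ 2 + 3 * (d * m3).
  have : m ^+ 2 <= (rho + d) ^+ 2 by rewrite ler_pXn2r ?nnegrE ?addr_ge0// ltW.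
  have : d * rho <= d * m3 by rewrite ler_pM2l.
  have : d * d <= d * m3.
    rewrite ler_pM2l//; apply: le_trans dm3 _.
    have : mu * m3 <= m3 by rewrite ler_piMl// ltW.
    lra.
  rewrite sqrrD mulr2n -expr2; lra.
have k3 : (1 + mu) * (rho ^+ 2 + r - d * tau) <= (1 + mu) * q by rewrite ler_pM2l//; lra.
have k4 : mu * (d * tau) <= d * m3.
  by apply: le_trans dtau; rewrite ler_piMl// mulr_ge0// ltW.
have k5 : mu * (m3 ^+ 2 / 16) <= mu * (rho ^+ 2 + r) by rewrite ler_pM2l.
have k6 : 0 < mu * m3 ^+ 2 by rewrite mulr_gt0.
lra.
Qed.

Variables (p mu nu d psi : R).
(* the factor [1 + d] pays for lowering the exponent, [1 + mu] for the
   translation *)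
Let C := (1 + d) * (1 + mu).
Let M := 100 / mu.
(* [M * d] is the size of the neighborhood of the core where the opening of the
   angle is used; there [|p y|] stays below the angle [psi < pi / 2] *)
Hypotheses (p0 : 2^-1 <= p < 1) (mu0 : 0 < mu <= 1) (nu0 : 0 < nu) (d0 : 0 < d <= 1)
  (psi0 : 0 <= psi < pi / 2) (hpsi : p * (pi / 2 + M * d) <= psi)
  (hnu : forall tau, tau <= M * d -> ramp tau <= nu) (hM : M * d + d < cos psi).

(** Away from the core the inflation factor [C] absorbs the translation by [d];
    near the core, it is the opening of the angle that makes room. *)
Lemma closed_worm_level a b t : worm_fun a b t <= 0 -> t <= pi / 2 ->
  [/\ a - d < modulus (a - d) b,
   `|argument (a - d) b - t - pi / 2| < pi / (2 * p)
   & 0 < level p C nu (a - d) b t].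
Proof.
have [p2 p1] := andP p0; have [d1 d2] := andP d0; have [m1 m2] := andP mu0.
have [s1 s2] := andP psi0; have hM' := hM; have hpsi' := hpsi; have nu0' := nu0.
have pp : 0 < p by lra.
have M1 : 100 <= M by rewrite ler_pdivlMr// ler_piMr.
have Md : 0 <= M * d by rewrite mulr_ge0//; lra.
have pi0 := pi_gt0 R; have pih := @pihalf_ge1 R.
move=> P0 tp; have [/andP[t1 t2] tb ta] := worm_position P0.
have ps : position (a - d) b t by split; rewrite ?t1.
have sl : a - d < modulus (a - d) b.
  apply: slitP; have [b0|//] := eqVneq b 0; rewrite /= subr_lt0.
  have t0 : 0 <= t by rewrite leNgt; apply/negP => /tb; rewrite b0 ltxx.
  have [->//|an0] := eqVneq a 0.
  have := worm_slit P0; rewrite an0 => /(_ isT); rewrite b0 /modulus expr0n /= addr0 sqrtr_sqr.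
  by rewrite ltr_normr ltxx /= => h; apply: lt_trans d1; lra.
pose m := modulus (a - d) b; pose rho := modulus a b.
pose y := argument (a - d) b - t - pi / 2.
pose tau := Num.max 0 (- t).
have mg0 : 0 < m by exact: modulus_gt0 (slit_gt0 sl).
have mm2 : m ^+ 2 = (a - d) ^+ 2 + b ^+ 2 by exact: sqr_modulus.
have rr2 : rho ^+ 2 = a ^+ 2 + b ^+ 2 by exact: sqr_modulus.
have rho0 : 0 <= rho by exact: modulus_ge0.
have tau0 : 0 <= tau by rewrite /tau le_max lexx.
have [arho _] : `|a| <= rho /\ `|b| <= rho := norm_coords_le_modulus a b.
have dam : damping t = ramp tau.
  rewrite /tau; have [t0|t0] := leP 0 t.
    by rewrite max_l ?oppr_le0// [ramp 0]rampN// damping_core// t0; lra.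
  by rewrite max_r ?oppr_ge0 ?(ltW t0)// damping_neg// ltW.
have sint : - tau <= sin t.
  rewrite /tau; have [t0|t0] := leP 0 t.
    by rewrite max_l ?oppr_le0// oppr0; apply: sin_ge0_pi; rewrite t0; lra.
  rewrite max_r ?oppr_ge0 ?(ltW t0)// -[t]opprK sinN lerN2 opprK.
  have : `|sin (- t)| <= - t by apply: norm_sin_le; rewrite oppr_ge0 ltW.
  by rewrite ler_norml => /andP[].
have tau2 : tau <= 2^-1 by rewrite /tau ge_max; apply/andP; split; lra.
have mcos : m * cos y = b * cos t - (a - d) * sin t by exact: modulus_cos.
have K0 : rho ^+ 2 + ramp tau <= b * cos t - a * sin t.
  by move: P0; rewrite /worm_fun dam rr2; lra.
have r0 := ramp_ge0 tau.
have L0 : rho ^+ 2 + ramp tau - d * tau <= m * cos y.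
  have : d * - tau <= d * sin t by rewrite ler_pM2l.
  by rewrite mcos; lra.
have cut : cutoff nu t <= ramp tau.
  by rewrite /cutoff dam ge_max r0 andbT; lra.
have mrho : m <= rho + d.
  rewrite -(@ler_pXn2r _ 2)// ?nnegrE ?addr_ge0// ?(ltW mg0)// ?(ltW d1)//.
  rewrite mm2 [(rho + d) ^+ 2]sqrrD rr2; have : - a <= rho by apply: le_trans arho; rewrite -normrN ler_norm.
  move=> h; have : d * - a <= d * rho by rewrite ler_pM2l.
  by rewrite mulr2n; lra.
have lvE : level p C nu (a - d) b t =
  C * expR (p * log_modulus (a - d) b) * cos (p * y) - m ^+ 2 - cutoff nu t.
  by rewrite /level expRM_natl expR_log_modulus ?slit_gt0.
have C1 : 1 <= C.
  by rewrite /C -[leLHS]mulr1 ler_pM//; lra.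
have Em : m = expR (log_modulus (a - d) b) by rewrite expR_log_modulus ?slit_gt0.
have small : rho <= M * d -> tau <= M * d -> [/\ a - d < modulus (a - d) b,
   `|y| < pi / (2 * p) & 0 < level p C nu (a - d) b t].
  move=> hr ht.
  have y1 : `|y| <= pi / 2 + M * d.
    have [t0|t0] := leP 0 t.
      have : 0 <= b * cos t - (a - d) * sin t.
        have : 0 <= d * sin t.
          by rewrite mulr_ge0 ?(ltW d1)//; apply: sin_ge0_pi; rewrite t0; lra.
        by have := sqr_ge0 rho; lra.
      by move/(angle_le sl ps); rewrite -/y; lra.
    have := argument_upper sl (tb t0); have /andP[k1 _] := argument_bounds (a - d) b.
    have : - t <= M * d by apply: le_trans ht; rewrite /tau le_max lexx orbT.
    by rewrite ler_norml /y => k2 k3; apply/andP; split; lra.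
  have py : `|p * y| <= psi.
    rewrite normrM (gtr0_norm pp); apply: le_trans hpsi.
    by rewrite ler_pM2l.
  split => //.
    rewrite invfM mulrA ltr_pdivlMr// mulrC -(gtr0_norm pp) -normrM.
    by apply: le_lt_trans py _.
  have cp : cos psi <= cos (p * y).
    by rewrite -[cos (p * y)]cos_norm; apply: cos_nincr => //; lra.
  have cu0 : cutoff nu t = 0.
    by rewrite /cutoff dam max_r// subr_le0; exact: hnu.
  have mc : m < cos psi by lra.
  have m_le1 : m <= 1 by apply: le_trans (ltW mc) _; exact: cos_le1.
  have E1 : m <= expR (p * log_modulus (a - d) b).
    by rewrite Em ler_expR; apply: le_scale_npos; [exact: ltW|rewrite -expR_le1 -Em].
  rewrite lvE cu0 subr0 subr_gt0.
  apply: (@lt_le_trans _ _ (m * cos psi)); first by rewrite expr2 ltr_pM2l.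
  apply: ler_pM => //; rewrite ?(ltW mg0)//; first by apply: ltW; apply: lt_trans mc.
  by apply: le_trans E1 _; rewrite ler_peMl ?expR_ge0.
have large : M * d <= Num.max rho tau -> [/\ a - d < modulus (a - d) b,
   `|y| < pi / (2 * p) & 0 < level p C nu (a - d) b t].
  set m3 := Num.max rho tau => hm3.
  have rm3 : rho <= m3 by rewrite /m3 le_max lexx.
  have tm3 : tau <= m3 by rewrite /m3 le_max lexx orbT.
  have m30 : 0 < m3 by apply: lt_le_trans hm3; rewrite mulr_gt0//; lra.
  have dm3 : d <= mu * m3 / 100.
    have : 100 * d <= m3 * mu by rewrite -ler_pdivrMr//; apply: le_trans hm3; rewrite /M mulrAC.
    lra.
  have L16 : m3 ^+ 2 / 16 <= rho ^+ 2 + ramp tau.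
    have hr : rho ^+ 2 / 16 <= rho ^+ 2 by rewrite ler_pdivrMr// ler_peMr ?sqr_ge0// ler1n.
    have ht : tau ^+ 2 / 16 <= ramp tau by apply: ramp_ge_sqr; rewrite tau0.
    have [h|h] := leP rho tau; first by rewrite /m3 max_r// -[leLHS]add0r lerD// sqr_ge0.
    by rewrite /m3 max_l ?(ltW h)// -[leLHS]addr0 lerD.
  have [|||q0 gap] := translation_gap mu0 d1 _ _ m30 dm3 L16 L0 (m := m).
  - by rewrite tau0.
  - by rewrite rho0.
  - by rewrite ltW.
  have cy0 : 0 < cos y by rewrite -(pmulr_rgt0 _ mg0).
  have y1 : `|y| <= pi / 2.
    by apply: (angle_le sl ps); rewrite -mcos ltW.
  have ppy : p * `|y| <= `|y| by rewrite ler_piMl// ltW.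
  have y2 : `|y| < pi / (2 * p).
    apply: (le_lt_trans y1); rewrite ltr_pM2l// ltf_pV2 ?posrE ?mulr_gt0//.
    by rewrite -[ltRHS]mulr1 ltr_pM2l.
  have cpy : cos y <= cos (p * y).
    rewrite -(cos_norm y) -(cos_norm (p * y)) normrM (gtr0_norm pp).
    apply: cos_nincr => //; first by rewrite mulr_ge0// ltW.
    by apply: (le_trans y1); rewrite ler_pdivrMr// ler_peMr ?(ltW pi0)// ler1n.
  have rho1 : rho <= 1.
    apply: le1_of_sqr; have h := rotation_le_modulus a b t.
    by apply: le_trans h; apply: le_trans K0; rewrite lerDl.
  have m1d : m <= 1 + d by apply: (le_trans mrho); rewrite lerD2r.
  have E1 : m / (1 + d) <= expR (p * log_modulus (a - d) b).
    by rewrite Em; apply: expR_contract; rewrite -?Em ?pp ?(ltW p1) ?(ltW d1).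
  split => //; rewrite lvE -addrA -opprD subr_gt0.
  apply: (@le_lt_trans _ _ (m ^+ 2 + ramp tau)); first by rewrite lerD2l.
  apply: (lt_le_trans gap); rewrite mulrA; apply: ler_pM => //.
  - by rewrite mulr_ge0 ?(ltW mg0)// addr_ge0// ltW.
  - exact: ltW.
  have mu1 : 0 < 1 + mu by rewrite addr_gt0.
  have dd1 : 0 < 1 + d by rewrite addr_gt0.
  rewrite /C -mulrA mulrCA ler_pM2l//.
  by rewrite -ler_pdivrMl// mulrC.
have [h|h] := leP (M * d) (Num.max rho tau); first exact: large.
by apply: small; apply: le_trans (ltW h); rewrite le_max lexx ?orbT.
Qed.

End Inclusion.

(** * The Stein neighborhood basis *)

Section SteinBasis.
Context {R : realType}.
Implicit Types (a b t : R) (X : Cspace R 2).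

(** The symmetry [(w, t) -> (conjugate of w, pi - t)] reduces the inclusion to the
    lower half [t <= pi / 2]. *)
Lemma closed_worm_sub_tube (p mu nu d psi : R) : 2^-1 <= p < 1 -> 0 < mu <= 1 ->
  0 < nu -> 0 < d <= 1 -> 0 <= psi < pi / 2 ->
  p * (pi / 2 + 100 / mu * d) <= psi ->
  (forall tau, tau <= 100 / mu * d -> ramp tau <= nu) -> 100 / mu * d + d < cos psi ->
  closed_worm `<=` tube p ((1 + d) * (1 + mu)) nu d.
Proof.
move=> h1 h2 h3 h4 h5 h6 h7 h8 X [z0 P0].
have lvl := @closed_worm_level R p mu nu d psi h1 h2 h3 h4 h5 h6 h7 h8.
have [sl ar lv] : [/\ wx X - d < modulus (wx X - d) (wy X),
   `|argument (wx X - d) (wy X) - lz X - pi / 2| < pi / (2 * p)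
   & 0 < level p ((1 + d) * (1 + mu)) nu (wx X - d) (wy X) (lz X)].
  have [tp|tp] := leP (lz X) (pi / 2); first exact: lvl.
  have P0' := P0; rewrite -worm_fun_sym in P0'.
  have tp' : pi - lz X <= pi / 2 by lra.
  have [sl ar lv] := lvl _ _ _ P0' tp'.
  have angN : argument (wx X - d) (- wy X) - (pi - lz X) - pi / 2 =
     - (argument (wx X - d) (wy X) - lz X - pi / 2) by rewrite argumentN; lra.
  split.
  - by move: sl; rewrite /modulus sqrrN.
  - by move: ar; rewrite angN normrN.
  - by move: lv; rewrite /level angN mulrN cosN /log_modulus sqrrN /cutoff damping_sym.
by split => //; exact: worm_height P0.
Qed.

(** The parameters are chosen in order: [mu], [nu] and [1 - p] from [e], which
    fixes an angle [psi] strictly between [p pi / 2] and [pi / 2], and finally the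
    translation [d], small with respect to all of them. *)
Lemma shrinking_tubes (e : R) : 0 < e -> exists p C nu d : R,
  [/\ 0 < p <= 1, 1 <= C, closed_worm `<=` tube p C nu d &
      forall X, tube p C nu d X -> worm_fun (wx X) (wy X) (lz X) < e].
Proof.
move=> e0.
pose mu := Num.min 1 (e / 40); pose q := Num.min 2^-1 (e / 170); pose p := 1 - q.
have mu0 : 0 < mu <= 1.
  by rewrite /mu lt_min ltr01 divr_gt0//= ge_min lexx.
have mue : mu <= e / 40 by rewrite /mu ge_min lexx orbT.
have q0 : 0 < q by rewrite /q lt_min; apply/andP; split; [lra|rewrite divr_gt0].
have q2 : q <= 2^-1 by rewrite /q ge_min lexx.
have qe : q <= e / 170 by rewrite /q ge_min lexx orbT.
have p0 : 2^-1 <= p < 1 by rewrite /p; apply/andP; split; lra.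
have pi2 := @pi_ge2 R.
pose nu := e / 10; have nu0 : 0 < nu by rewrite divr_gt0.
pose psi := pi / 4 * (1 + p).
have psi0 : 0 <= psi < pi / 2.
  have [p1 p2] := andP p0; rewrite /psi; apply/andP; split.
    by rewrite mulr_ge0//; lra.
  have : pi / 4 * (1 + p) < pi / 4 * 2 by rewrite ltr_pM2l//; lra.
  lra.
have [mu1 mu2] := andP mu0.
have M0 : 0 < 100 / mu by rewrite divr_gt0.
pose M := 100 / mu.
have cp : 0 < cos psi.
  by have [k1 k2] := andP psi0; apply: cos_gt0_pihalf; apply/andP; split; lra.
have : \forall tau \near (0 : R), ramp tau < nu.
  by apply: (cts_lt (@ramp_continuous R 0)); rewrite rampN.
move=> /nbhs_ballP[r /= r0 rr].
have rampM (tau : R) : tau < r -> ramp tau <= nu.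
  move=> tr; have [t0|t0] := leP tau 0; first by rewrite rampN// ltW.
  by apply/ltW/rr; rewrite /ball /= sub0r normrN gtr0_norm.
pose d := Num.min (Num.min 1 (e / 200)) (Num.min (q / (2 * M)) (Num.min (r / (2 * M)) (cos psi / (2 * (M + 1))))).
have M0' : 0 < M by [].
have d0 : 0 < d.
  have M1 : 0 < M + 1 by lra.
  by rewrite /d !lt_min ltr01 /= !divr_gt0// mulr_gt0.
have [d1 de dq dr dc] : [/\ d <= 1, d <= e / 200, d <= q / (2 * M), d <= r / (2 * M) & d <= cos psi / (2 * (M + 1))].
  by rewrite /d !ge_min !lexx !orbT.
exists p, ((1 + d) * (1 + mu)), nu, d; split.
- by have [k1 k2] := andP p0; apply/andP; split; lra.
- rewrite -[leLHS]mulr1 ler_pM//; lra.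
- apply: (@closed_worm_sub_tube p mu nu d psi) => //; rewrite -/M.
  + by rewrite d0.
  + have : M * d <= q / 2.
      by move: dq; rewrite ler_pdivlMr ?mulr_gt0//; lra.
    move=> h; have : p * (M * d) <= q / 2.
      have [_ k1] := andP p0; apply: (le_trans _ h); rewrite ler_piMl //; last exact: ltW.
      by rewrite mulr_ge0 // ltW.
    rewrite /psi /p; have : 2 * q <= pi * q by rewrite ler_pM2r.
    lra.
  + move=> tau ht; apply: rampM; apply: le_lt_trans ht _.
    by move: dr; rewrite ler_pdivlMr ?mulr_gt0//; lra.
  + move: dc; rewrite ler_pdivlMr ?mulr_gt0//; last by lra.
    lra.
move=> X tX; have C1 : 1 <= (1 + d) * (1 + mu) <= 4.
  have : d * mu <= 1 by rewrite -[leRHS]mulr1 ler_pM// ltW.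
  have : 0 < d * mu by rewrite mulr_gt0.
  by move=> k1 k2; apply/andP; split; lra.
have d01 : 0 <= d <= 1 by rewrite ltW.
apply: lt_le_trans (tube_close p0 C1 (ltW nu0) d01 tX) _.
have : d * mu <= d by rewrite ler_piMr// ltW.
rewrite /p /nu; lra.
Qed.

Lemma worm_fun_continuous X : 0 < zx X ^+ 2 + zy X ^+ 2 ->
  {for X, continuous (fun Y => worm_fun (wx Y) (wy Y) (lz Y))}.
Proof.
move=> z0; have cl := lz_continuous z0.
apply: ctsD; last by apply: cts_comp => //; exact: damping_continuous.
apply: ctsB; first by apply: sqr_modulus_continuous; [exact: wx_continuous|exact: wy_continuous].
apply: ctsB; apply: ctsM; [exact: wy_continuous| |exact: wx_continuous|].
  by apply: cts_comp => //; exact: continuous_cos.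
by apply: cts_comp => //; exact: continuous_sin.
Qed.

Lemma lz_expR X : 0 < zx X ^+ 2 + zy X ^+ 2 -> zx X ^+ 2 + zy X ^+ 2 = expR (2 * lz X).
Proof. by move=> z0; rewrite expRM_natl expR_log_modulus// sqr_modulus. Qed.

Lemma zsq_continuous : continuous (fun Y : Cspace R 2 => zx Y ^+ 2 + zy Y ^+ 2).
Proof. by move=> X; apply: sqr_modulus_continuous; [exact: zx_continuous|exact: zy_continuous]. Qed.

Lemma lz_ge_closure (S : set (Cspace R 2)) (X : Cspace R 2) (l : R) : closure S X ->
  (forall Y, S Y -> 0 < zx Y ^+ 2 + zy Y ^+ 2 /\ l <= lz Y) -> 0 < zx X ^+ 2 + zy X ^+ 2.
Proof.
move=> clX h; apply: (@lt_le_trans _ _ (expR (2 * l))); first exact: expR_gt0.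
apply: (closure_ge (@zsq_continuous X) clX) => Y /h[z0 t1].
by rewrite lz_expR// ler_expR; lra.
Qed.

Lemma sublevel_coords X : 0 < zx X ^+ 2 + zy X ^+ 2 -> lz X <= pi + 2^-1 ->
  worm_fun (wx X) (wy X) (lz X) <= 1 -> forall i,
  `|complex.Re (X 0 i)| <= 2 + expR (pi + 2^-1) /\
  `|complex.Im (X 0 i)| <= 2 + expR (pi + 2^-1).
Proof.
move=> z0 t2; rewrite worm_fun_center => P1.
have [k3 k4] := norm_coords_le_modulus (zx X) (zy X).
have k5 : modulus (zx X) (zy X) <= expR (pi + 2^-1).
  by rewrite -expR_log_modulus// ler_expR.
have e0 := @expR_ge0 R (pi + 2^-1).
have bnd (u v s : R) : (u + s / 2) ^+ 2 + v ^+ 2 <= 5 / 4 -> -1 <= s <= 1 -> `|u| <= 2.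
  move=> h /andP[s1 s2]; have h2 : (u + s / 2) ^+ 2 <= (3 / 2) ^+ 2.
    by have := sqr_ge0 v; lra.
  move: h2; rewrite -[X in X <= _]real_normK ?num_real// ler_pXn2r ?nnegrE ?divr_ge0//.
  by rewrite !ler_norml => /andP[k1 k2]; apply/andP; split; lra.
have da := damping_ge0 (lz X).
have wa : `|wx X| <= 2.
  by apply: (bnd _ (wy X - cos (lz X) / 2) (sin (lz X))); [lra|rewrite sin_geN1 sin_le1].
have wb : `|wy X| <= 2.
  apply: (bnd _ (wx X + sin (lz X) / 2) (- cos (lz X))); last first.
    by rewrite lerN2 cos_le1 lerNl cos_geN1.
  by rewrite mulNr; lra.
case; case=> [|[|//]] i.
  rewrite (_ : Ordinal i = 0); last exact: val_inj.
  by rewrite -/(zx X) -/(zy X); split; lra.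
rewrite (_ : Ordinal i = 1); last exact: val_inj.
by rewrite -/(wx X) -/(wy X); split; lra.
Qed.

(** Compactness: [worm_fun] has a positive minimum on the compact set of points of
    the sublevel [worm_fun <= 1] that lie outside [U]. *)
Lemma sublevel_in_open (U : set (Cspace R 2)) : open U -> closed_worm `<=` U ->
  exists2 e : R, 0 < e & forall X, 0 < zx X ^+ 2 + zy X ^+ 2 ->
    - 2^-1 <= lz X <= pi + 2^-1 -> worm_fun (wx X) (wy X) (lz X) < e -> U X.
Proof.
move=> oU KU.
pose F := [set X | [/\ 0 < zx X ^+ 2 + zy X ^+ 2, - 2^-1 <= lz X <= pi + 2^-1,
   worm_fun (wx X) (wy X) (lz X) <= 1 & ~ U X]].
have clF : closed F.
  move=> X clX; have z0 : 0 < zx X ^+ 2 + zy X ^+ 2.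
    by apply: (@lz_ge_closure F X (- 2^-1)) => // Y [? /andP[? _] _ _].
  have cl := lz_continuous z0; split => //.
  - apply/andP; split; first by apply: (closure_ge cl clX) => Y [_ /andP[]].
    by rewrite -lerN2; apply: (closure_ge (ctsN cl) clX) => Y [_ /andP[_ h] _ _]; rewrite lerN2.
  - rewrite -lerN2; apply: (closure_ge (ctsN (worm_fun_continuous z0)) clX) => Y [_ _ h _].
    by rewrite lerN2.
  - move=> UX; have [Y [[_ _ _ nU] UY]] := clX U (open_nbhs_nbhs (conj oU UX)).
    exact: nU.
have cF : compact F.
  apply: (closed_box_compact clF (M := 2 + expR (pi + 2^-1))) => X [z0 /andP[_ t2] P1 _].
  exact: sublevel_coords.
have [F0|/set0P F0] := eqVneq F set0.
  exists 1 => // X z0 tX P1; apply: contrapT => nU.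
  have : F X by split => //; exact: ltW.
  by rewrite F0.
have cw : {within F, continuous (fun Y => worm_fun (wx Y) (wy Y) (lz Y))}.
  by apply: continuous_in_subspaceT => X; rewrite inE => -[z0 _ _ _]; exact: worm_fun_continuous.
have [Z ZF Zmin] := compact_EVT_min F0 cF cw.
rewrite inE in ZF; have [z0 tZ PZ nUZ] := ZF.
have Zpos : 0 < worm_fun (wx Z) (wy Z) (lz Z).
  by rewrite ltNge; apply/negP => h; apply: nUZ; apply: KU.
exists (Num.min 1 (worm_fun (wx Z) (wy Z) (lz Z))); first by rewrite lt_min ltr01.
move=> X zX tX; rewrite lt_min => /andP[P1 PX]; apply: contrapT => nU.
have FX : F X by split => //; exact: ltW.
have := Zmin X; rewrite inE => /(_ FX); rewrite leNgt PX //.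
Qed.

Lemma closed_worm_Stein : Stein_neighborhood_basis (@closed_worm R).
Proof.
move=> U oU KU; have [e e0 eU] := sublevel_in_open oU KU.
have [p [C [nu [d [/andP[p0 p1] C1 Kt te]]]]] := shrinking_tubes e0.
exists (tube p C nu d); split => //.
- exact: tube_open.
- exact: tube_pseudoconvex.
move=> X tX; have [z0 _ /andP[t1 t2] _ _] := tX.
by apply: eU => //; [rewrite !ltW|exact: te].
Qed.

Lemma closure_worm_sub : closure (@worm R) `<=` closed_worm.
Proof.
move=> X clX; have z0 : 0 < zx X ^+ 2 + zy X ^+ 2.
  apply: (@lz_ge_closure worm X (- 2^-1)) => // Y [zY /ltW PY]; split => //.
  by have /andP[/ltW] := worm_height PY.
split => //; rewrite -oppr_ge0.
apply: (closure_ge (ctsN (worm_fun_continuous z0)) clX) => Y [_ h].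
by rewrite oppr_ge0 ltW.
Qed.

End SteinBasis.

(** * Closure, connectedness and boundedness *)

Section Shape.
Context {R : realType}.
Implicit Types (a b t : R) (X : Cspace R 2).

Definition mkpoint (a b x y : R) : Cspace R 2 :=
  \row_(i < 2) if i == 0 then (x +i* y)%C else (a +i* b)%C.

Lemma mkpointE (a b x y : R) : [/\ zx (mkpoint a b x y) = x, zy (mkpoint a b x y) = y,
  wx (mkpoint a b x y) = a & wy (mkpoint a b x y) = b].
Proof. by rewrite /zx /zy /wx /wy !mxE. Qed.

Lemma mkpoint_eta X : X = mkpoint (wx X) (wy X) (zx X) (zy X).
Proof.
apply/rowP => i; rewrite mxE; case: ifP => [/eqP ->|i0].
  by rewrite /zx /zy; case: (X 0 0).
have -> : i = 1 by move: i i0; case=> -[|[|//]] j //= _; exact: val_inj.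
by rewrite /wx /wy; case: (X 0 1).
Qed.

Lemma mkpoint_continuous (T : topologicalType) (a b x y : T -> R) (s : T) :
  {for s, continuous a} -> {for s, continuous b} -> {for s, continuous x} ->
  {for s, continuous y} -> {for s, continuous (fun s => mkpoint (a s) (b s) (x s) (y s))}.
Proof.
move=> ca cb cx cy; apply: Cspace_continuous => i.
  case: (eqVneq i 0) => [->|i0].
    by rewrite (_ : (fun _ => _) = x)//; apply/funext => u; rewrite mxE.
  rewrite (_ : (fun _ => _) = a)//; apply/funext => u; rewrite mxE; move: i0.
  by case: eqP.
case: (eqVneq i 0) => [->|i0].
  by rewrite (_ : (fun _ => _) = y)//; apply/funext => u; rewrite mxE.
rewrite (_ : (fun _ => _) = b)//; apply/funext => u; rewrite mxE; move: i0.
by case: eqP.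
Qed.

Lemma log_modulusM (k x y : R) : 0 < x ^+ 2 + y ^+ 2 ->
  log_modulus (x * expR k) (y * expR k) = log_modulus x y + k.
Proof.
move=> z0; rewrite /log_modulus !exprMn -mulrDl lnM ?posrE ?exprn_gt0 ?expR_gt0//.
by rewrite -expRM_natl expRK; lra.
Qed.

(** The damping is convex in the range of heights of the worm and vanishes at the
    middle height [pi / 2]. *)
Lemma damping_scale t s : - 2^-1 < t < pi + 2^-1 -> 0 <= s <= 1 ->
  damping (t + s * (pi / 2 - t)) <= (1 - s) * damping t.
Proof.
move=> /andP[t1 t2] /andP[s0 s1]; have p0 := pi_gt0 R.
wlog tp : t t1 t2 / t <= pi / 2 => [wl|].
  have [|tp] := leP t (pi / 2); first exact: wl.
  have := wl (pi - t); rewrite !damping_sym => h.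
  have -> : t + s * (pi / 2 - t) = pi - (pi - t + s * (pi / 2 - (pi - t))) by lra.
  by rewrite damping_sym; apply: h; lra.
have ge0 := mulr_ge0 (_ : 0 <= 1 - s) (damping_ge0 t).
rewrite subr_ge0 in ge0; have {}ge0 := ge0 s1.
pose t' := t + s * (pi / 2 - t).
have t'p : t' <= pi.
  have : s * (pi / 2 - t) <= 1 * (pi / 2 - t) by rewrite ler_wpM2r//; lra.
  by rewrite /t'; lra.
rewrite -/t'; have [t'0|t'0] := leP 0 t'; first by rewrite damping_core ?t'0.
have t0 : t < 0.
  apply: le_lt_trans t'0; rewrite /t' lerDl mulr_ge0//; lra.
rewrite !damping_neg ?(ltW t0) ?(ltW t'0)//.
pose l := t' / t.
have lt : - t' = l * - t by rewrite /l mulrN divfK// lt_eqF.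
have l0 : 0 <= l by rewrite /l -[_ / _]opprK -mulrN -invrN -mulNr divr_ge0// oppr_ge0 ltW.
have l1 : l <= 1 - s.
  rewrite /l ler_ndivrMr//; rewrite /t'.
  have : 0 <= s * pi by rewrite mulr_ge0// ltW.
  lra.
rewrite lt; apply: le_trans (ramp_scale (_ : 0 <= l <= 1) _) _; first by rewrite l0; lra.
  lra.
by apply: ler_wpM2r => //; exact: ramp_ge0.
Qed.

(** The path joining a point of the closed worm to the circle
    [|z| = exp (pi / 2), w = - 1 / 2]: the modulus of [z] moves towards
    [exp (pi / 2)], and [w] moves towards the centre of its disc. *)
Definition path_to_core X (s : R) : Cspace R 2 :=
  let t := lz X + s * (pi / 2 - lz X) in
  mkpoint (- (sin t / 2) + (1 - s) * (wx X + sin (lz X) / 2))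
        (cos t / 2 + (1 - s) * (wy X - cos (lz X) / 2))
        (zx X * expR (s * (pi / 2 - lz X))) (zy X * expR (s * (pi / 2 - lz X))).

Lemma path_to_core0 X : path_to_core X 0 = X.
Proof.
rewrite [RHS]mkpoint_eta /path_to_core !mul0r expR0 !mulr1 addr0 subr0 !mul1r.
by congr (mkpoint _ _ _ _); ring.
Qed.

Lemma path_to_core_continuous X : continuous (path_to_core X).
Proof.
move=> s; have cl : {for s, continuous (fun s : R => s * (pi / 2 - lz X))}.
  by apply: ctsM; [exact: cvg_id|exact: ctsC].
have ct : {for s, continuous (fun s : R => lz X + s * (pi / 2 - lz X))}.
  by apply: ctsD => //; exact: ctsC.
have c1 : {for s, continuous (fun s : R => 1 - s)}.
  by apply: ctsB; [exact: ctsC|exact: cvg_id].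
have ce (x : R) : {for s, continuous (fun s : R => x * expR (s * (pi / 2 - lz X)))}.
  by apply: ctsM; [exact: ctsC|apply: cts_comp => //; exact: continuous_expR].
apply: (@mkpoint_continuous R
  (fun s => - (sin (lz X + s * (pi / 2 - lz X)) / 2) + (1 - s) * (wx X + sin (lz X) / 2))
  (fun s => cos (lz X + s * (pi / 2 - lz X)) / 2 + (1 - s) * (wy X - cos (lz X) / 2))) => //.
- apply: ctsD; last by apply: ctsM => //; exact: ctsC.
  apply: ctsN; apply: ctsM; last exact: ctsC.
  by apply: cts_comp => //; exact: continuous_sin.
- apply: ctsD; last by apply: ctsM => //; exact: ctsC.
  apply: ctsM; last exact: ctsC.
  by apply: cts_comp => //; exact: continuous_cos.
Qed.

Lemma path_to_core_worm X (s : R) : closed_worm X -> 0 < s <= 1 -> worm (path_to_core X s).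
Proof.
move=> [z0 P0] /andP[s0 s1]; have tX := worm_height P0.
rewrite /worm /path_to_core /=; set t := lz X + _; set k := s * _ in t *.
have [E1 E2 E3 E4] := mkpointE (- (sin t / 2) + (1 - s) * (wx X + sin (lz X) / 2))
   (cos t / 2 + (1 - s) * (wy X - cos (lz X) / 2)) (zx X * expR k) (zy X * expR k).
rewrite /lz E1 E2 E3 E4 log_modulusM// -/(lz X) -/t; split.
  by rewrite !exprMn -mulrDl mulr_gt0// exprn_gt0// expR_gt0.
move: P0; rewrite !worm_fun_center.
have := damping_scale tX (_ : 0 <= s <= 1); rewrite s1 ltW// => /(_ isT).
rewrite -/k -/t; have := damping_ge0 (lz X).
set u := wx X + _; set v := wy X - _; move: (damping t) (damping (lz X)) => d' d.
have -> : - (sin t / 2) + (1 - s) * u + sin t / 2 = (1 - s) * u by ring.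
have -> : cos t / 2 + (1 - s) * v - cos t / 2 = (1 - s) * v by ring.
rewrite !exprMn => d0 dd P0.
have uv : u ^+ 2 + v ^+ 2 <= 4^-1 - d by lra.
have d4 : d <= 4^-1 by have := sqr_ge0 u; have := sqr_ge0 v; lra.
have := ler_wpM2l (sqr_ge0 (1 - s)) uv.
have h : 0 <= (1 - s) * s * (4^-1 - d) by rewrite mulr_ge0 ?mulr_ge0//; lra.
have : 0 < s * 4^-1 by rewrite mulr_gt0.
lra.
Qed.

Lemma closed_worm_sub : closed_worm `<=` closure (@worm R).
Proof.
move=> X KX B; rewrite -{1}(path_to_core0 X) => nB.
have : \forall s \near (0 : R)^'+, B (path_to_core X s).
  by apply: cvg_within; apply: path_to_core_continuous.
move=> hB; have [s [Bs s0 s1]] : exists s : R, [/\ B (path_to_core X s), 0 < s & s <= 1].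
  apply: (@filter_ex _ (0 : R)^'+); near=> s; split.
  - by near: s.
  - by near: s; exact: nbhs_right_gt.
  - by near: s; exact: nbhs_right_le.
by exists (path_to_core X s); split => //; apply: path_to_core_worm; rewrite ?s0.
Unshelve. all: by end_near. Qed.

Lemma closure_worm : closure (@worm R) = closed_worm.
Proof. by apply/seteqP; split; [exact: closure_worm_sub|exact: closed_worm_sub]. Qed.

Definition core_circle (s : R) : Cspace R 2 :=
  mkpoint (- 2^-1) 0 (expR (pi / 2) * cos s) (expR (pi / 2) * sin s).

Lemma core_circle_worm s : worm (core_circle s).
Proof.
rewrite /worm /core_circle /=; set e := expR (pi / 2).
have [E1 E2 E3 E4] := mkpointE (- 2^-1 : R) 0 (e * cos s) (e * sin s).
have e0 : 0 < e by exact: expR_gt0.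
have N : (e * cos s) ^+ 2 + (e * sin s) ^+ 2 = e ^+ 2.
  by rewrite !exprMn -mulrDr cos2Dsin2 mulr1.
rewrite /lz E1 E2 E3 E4 N; split; first exact: exprn_gt0.
have -> : log_modulus (e * cos s) (e * sin s) = pi / 2.
  by rewrite /log_modulus N /e -expRM_natl expRK; lra.
rewrite worm_fun_center damping_core ?sin_pihalf ?cos_pihalf; last first.
  by have := pi_gt0 R; move=> p; apply/andP; split; lra.
lra.
Qed.

Lemma path_to_core_end X : 0 < zx X ^+ 2 + zy X ^+ 2 ->
  exists s, path_to_core X 1 = core_circle s.
Proof.
move=> z0; rewrite /path_to_core mul1r subrKC subrr !mul0r !addr0 sin_pihalf cos_pihalf mul0r.
have m0 := modulus_gt0 z0; pose m := modulus (zx X) (zy X).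
have [|s _ [cs ss]] := @unit_circle R (zx X / m) (zy X / m).
  by rewrite !exprMn -mulrDl exprVn sqr_modulus divff// lt0r_neq0.
exists s; rewrite /core_circle cs ss mul1r expRB expR_log_modulus//.
by congr (mkpoint _ _ _ _); rewrite mulrCA.
Qed.

(** Every point of the worm is joined by its path to the circle [core_circle],
    which lies in the worm. *)
Lemma worm_connected : connected (@worm R).
Proof.
have cC : connected (range core_circle).
  apply: connected_continuous_connected.
    by apply/connected_intervalP => x y _ _ z _.
  apply: continuous_subspaceT => s.
  apply: (@mkpoint_continuous R (fun=> - 2^-1) (fun=> 0) (fun s => expR (pi / 2) * cos s) (fun s => expR (pi / 2) * sin s)).
  - exact: ctsC.
  - exact: ctsC.
  - by apply: ctsM; [exact: ctsC|exact: continuous_cos].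
  - by apply: ctsM; [exact: ctsC|exact: continuous_sin].
have -> : @worm R = \bigcup_(X in @worm R) (range core_circle `|` path_to_core X @` `[0, 1]).
  apply/seteqP; split.
    move=> X wX; exists X => //; right; exists 0; last exact: path_to_core0.
    by rewrite /= in_itv /= lexx ler01.
  move=> Y [X wX [[s _ <-]|[s]]]; first exact: core_circle_worm.
  rewrite /= in_itv /= => /andP[s0 s1] <-.
  move: s0; rewrite le_eqVlt => /predU1P[<-|s0]; first by rewrite path_to_core0.
  by apply: path_to_core_worm; [case: wX => ? /ltW|rewrite s0].
apply: bigcup_connected.
  by exists (core_circle 0) => X _; left; exists 0.
move=> X [z0 _]; apply: connectedU => //.
  have [s hs] := path_to_core_end z0.
  exists (core_circle s); split; first by exists s.
  by exists 1 => //; rewrite /= in_itv /= lexx ler01.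
apply: connected_continuous_connected; last first.
  apply: continuous_subspaceT; exact: path_to_core_continuous.
exact: segment_connected.
Qed.

Lemma worm_nonempty : @worm R !=set0.
Proof. by exists (core_circle 0); exact: core_circle_worm. Qed.

Lemma worm_bounded : bounded_set (@worm R).
Proof.
pose M := 2 + expR (pi + 2^-1) : R.
have M0 : 0 < M + 1 by have := @expR_gt0 R (pi + 2^-1); rewrite /M; lra.
have N0 : 0 < ((2 * (M + 1))%:C)%C :> R[i] by rewrite ltcE /= eqxx mulr_gt0.
exists ((2 * (M + 1))%:C)%C; split; first exact: gtr0_real.
move=> N' NN' X [z0 P0].
have /andP[_ /ltW t2] := worm_height (ltW P0).
have P1 : worm_fun (wx X) (wy X) (lz X) <= 1 by lra.
have := sublevel_coords z0 t2 P1 => bX.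
suff : ball (0 : Cspace R 2) ((2 * (M + 1))%:C)%C X.
  rewrite mx_norm_ball /ball_ /= sub0r normrN => h.
  by apply/ltW/(lt_trans h).
split => // i j; rewrite /ball /= !mxE sub0r normrN (ord1 i).
have [k1 k2] := bX j.
by apply: norm_lt_ReIm; apply: le_lt_trans; [exact: k1| |exact: k2|]; rewrite /M ltrDl.
Qed.

End Shape.

(** * Regularity of the boundary *)

Section LocallyLipschitz.
Context {R : realType}.

Definition locally_lipschitz (V : normedModType R) (g : V -> R) (x : V) :=
  exists L d : R, [/\ 0 <= L, 0 < d & forall y z, ball x d y -> ball x d z ->
    `|g y - g z| <= L * `|y - z| ].

Lemma locally_lipschitz_continuous (V : normedModType R) (g : V -> R) x :
  locally_lipschitz g x -> {for x, continuous g}.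
Proof.
move=> [L [d [L0 d0 h]]]; apply/cvgrPdist_lt => e e0.
have L1 : 0 < L + 1 by lra.
have := @nbhsx_ballx _ _ x (Num.min d (e / (L + 1))).
rewrite lt_min d0 divr_gt0// => /(_ isT); apply: filterS => y.
rewrite -ball_normE /= lt_min => /andP[yd ye].
apply: le_lt_trans (h _ _ (ballxx _ d0) _) _; first by rewrite -ball_normE.
move: ye; rewrite ltr_pdivlMr//; have := normr_ge0 (x - y); nra.
Qed.

Lemma locally_lipschitz_cst (V : normedModType R) (c : R) (x : V) :
  locally_lipschitz (fun=> c) x.
Proof.
by exists 0, 1; split => // y z _ _; rewrite subrr normr0 mul0r.
Qed.

Lemma locally_lipschitz_bounded (V : normedModType R) (g : V -> R) x :
  locally_lipschitz g x -> exists B d : R, [/\ 0 <= B, 0 < d & forall y, ball x d y -> `|g y| <= B].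
Proof.
move=> [L [d [L0 d0 h]]]; exists (`|g x| + L * d), d; split => //.
  by rewrite addr_ge0// mulr_ge0// ltW.
move=> y xy; have := h _ _ xy (ballxx x d0).
move: xy; rewrite -ball_normE /= distrC => xy hy.
have : L * `|y - x| <= L * d by rewrite ler_wpM2l// ltW.
have := ler_normD (g y - g x) (g x); rewrite subrK; lra.
Qed.

Lemma min_ball (V : normedModType R) (x y : V) (d d' : R) :
  ball x (Num.min d d') y -> ball x d y /\ ball x d' y.
Proof. by move=> h; split; apply: le_ball h; rewrite ge_min lexx ?orbT. Qed.

Lemma locally_lipschitzD (V : normedModType R) (f g : V -> R) x :
  locally_lipschitz f x -> locally_lipschitz g x ->
  locally_lipschitz (fun y => f y + g y) x.
Proof.
move=> [L [d [L0 d0 h]]] [L' [d' [L0' d0' h']]].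
exists (L + L'), (Num.min d d'); split; rewrite ?addr_ge0 ?lt_min ?d0//.
move=> y z /min_ball[y1 y2] /min_ball[z1 z2].
have k1 := h y z y1 z1; have k2 := h' y z y2 z2.
have -> : f y + g y - (f z + g z) = (f y - f z) + (g y - g z) by ring.
by apply: le_trans (ler_normD _ _) _; lra.
Qed.

Lemma locally_lipschitzM (V : normedModType R) (f g : V -> R) x :
  locally_lipschitz f x -> locally_lipschitz g x ->
  locally_lipschitz (fun y => f y * g y) x.
Proof.
move=> lf lg; have [B [e [B0 e0 hB]]] := locally_lipschitz_bounded lf.
have [B' [e' [B0' e0' hB']]] := locally_lipschitz_bounded lg.
move: lf lg => [L [d [L0 d0 h]]] [L' [d' [L0' d0' h']]].
exists (B * L' + B' * L), (Num.min (Num.min d d') (Num.min e e')).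
split; rewrite ?addr_ge0 ?mulr_ge0 ?lt_min ?d0 ?d0' ?e0//.
move=> y z /min_ball[/min_ball[y1 y2] /min_ball[y3 y4]] /min_ball[/min_ball[z1 z2] /min_ball[z3 z4]].
have -> : f y * g y - f z * g z = f y * (g y - g z) + g z * (f y - f z) by ring.
apply: le_trans (ler_normD _ _) _; rewrite mulrDl !normrM -!mulrA.
by apply: lerD; apply: ler_pM => //; [exact: hB|exact: h'|exact: hB'|exact: h].
Qed.

Lemma locally_lipschitz_comp (V : normedModType R) (phi : R -> R) (f : V -> R) x :
  locally_lipschitz f x -> locally_lipschitz phi (f x) ->
  locally_lipschitz (fun y => phi (f y)) x.
Proof.
move=> lf [L' [d' [L0' d0' h']]]; have cf := locally_lipschitz_continuous lf.
have /nbhs_ballP[e /= e0 he] : \forall y \near x, ball (f x) d' (f y).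
  by apply: cf; apply: nbhsx_ballx.
move: lf => [L [d [L0 d0 h]]].
exists (L' * L), (Num.min d e); split; rewrite ?mulr_ge0 ?lt_min ?d0//.
move=> y z /min_ball[y1 y2] /min_ball[z1 z2].
apply: le_trans (h' _ _ (he _ y2) (he _ z2)) _.
by rewrite -mulrA ler_wpM2l//; exact: h.
Qed.

Lemma locally_lipschitz_uniform (I : finType) (V : normedModType R) (G : I -> V -> R) x :
  (forall i, locally_lipschitz (G i) x) -> exists L d : R, [/\ 0 <= L, 0 < d &
    forall i y z, ball x d y -> ball x d z -> `|G i y - G i z| <= L * `|y - z| ].
Proof.
move=> lG; have /choice[F hF] : forall i, exists p : R * R, [/\ 0 <= p.1, 0 < p.2 &
    forall y z, ball x p.2 y -> ball x p.2 z -> `|G i y - G i z| <= p.1 * `|y - z| ].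
  by move=> i; have [L [d h]] := lG i; exists (L, d).
exists (\sum_i (F i).1), (\big[Num.min/1]_i (F i).2); split.
- by apply: sumr_ge0 => i _; have [] := hF i.
- by apply/bigmin_gtP; split => // i _; have [] := hF i.
move=> i y z yd zd; have [Li0 _ h] := hF i.
have sub y' : ball x (\big[Num.min/1]_i (F i).2) y' -> ball x (F i).2 y'.
  by apply: le_ball; apply: bigmin_le.
apply: le_trans (h _ _ (sub _ yd) (sub _ zd)) _; apply: ler_wpM2r => //.
by rewrite (bigD1 i)//= lerDl; apply: sumr_ge0 => j _; have [] := hF j.
Qed.

(** By the mean value theorem. *)
Lemma locally_lipschitz_C1 (phi phi' : R -> R) (s : R) :
  (\forall x \near s, is_derive (x : R) (1 : R) phi (phi' x)) ->
  {for s, continuous phi'} -> locally_lipschitz phi s.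
Proof.
move=> dphi cphi.
have nB : \forall x \near s, `|phi' x| < `|phi' s| + 1.
  by apply: (cts_lt (cts_comp cphi (@norm_continuous R R _))); rewrite ltrDl.
have /nbhs_ballP[d /= d0 hd] : \forall x \near s, is_derive (x : R) (1 : R) phi (phi' x) /\ `|phi' x| < `|phi' s| + 1.
  exact: filterI.
exists (`|phi' s| + 1), d; split => //.
move=> y z yd zd; wlog yz : y z yd zd / y <= z => [wl|].
  by have [|/ltW] := leP y z; [exact: wl|rewrite distrC (distrC y); exact: wl].
have inb (x : R) : y <= x <= z -> ball s d x.
  move=> /andP[yx xz]; move: yd zd; rewrite -!ball_normE /= !ltr_norml => /andP[k1 k2] /andP[k3 k4].
  by apply/andP; split; lra.
have Hd : forall x : R, x \in `]y, z[%R -> is_derive x (1 : R) phi (phi' x).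
  by move=> x; rewrite in_itv /= => /andP[h1 h2]; apply: (hd x _).1; apply: inb; rewrite !ltW.
have cs : {within `[y, z], continuous phi}.
  apply: continuous_in_subspaceT => x; rewrite inE /= in_itv /= => h1.
  apply: differentiable_continuous; apply/derivable1_diffP.
  by have [[]] := hd x (inb _ h1).
have [c] := MVT_segment yz Hd cs; rewrite in_itv /= => h1.
rewrite distrC [`|y - z|]distrC => ->; rewrite normrM ler_wpM2r//.
by have [_ /ltW] := hd c (inb _ h1).
Qed.

End LocallyLipschitz.

Section C11Calculus.
Context {R : realType} {n : nat}.
Local Notation V := 'rV[R]_n.
Implicit Types (f g : V -> R) (x : V).

Lemma norm_coord_le (v : V) j : `|v 0 j| <= `|v|.
Proof.
rewrite [leRHS]/Num.norm /= mx_normrE; apply/bigmax_geP; right => /=.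
by exists (0, j).
Qed.

Lemma norm_le_coords (v : V) (M : R) : 0 <= M -> (forall j, `|v 0 j| <= M) -> `|v| <= M.
Proof.
move=> M0 h; rewrite [leLHS]/Num.norm /= mx_normrE; apply/bigmax_leP; split => // -[i j] _ /=.
by rewrite (ord1 i).
Qed.

Definition c11_at f (G : 'I_n -> V -> R) x :=
  [/\ \forall y \near x, differentiable f y /\ forall i, 'D_(delta_mx 0 i) f y = G i y,
      locally_lipschitz f x & forall i, locally_lipschitz (G i) x].

Lemma c11_cst (c : R) x : c11_at (fun=> c) (fun _ _ => 0) x.
Proof.
split; last 2 first.
- exact: locally_lipschitz_cst.
- by move=> i; exact: locally_lipschitz_cst.
near=> y; split; first exact: differentiable_cst.
by move=> i; rewrite derive_cst.
Unshelve. all: by end_near. Qed.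

Lemma c11_coord (j : 'I_n) x :
  c11_at (fun y => y 0 j) (fun i _ => (i == j)%:R) x.
Proof.
split.
- near=> y; split; first exact: differentiable_coord.
  move=> i; rewrite deriveE; last exact: differentiable_coord.
  have @f : {linear V -> R}.
    by exists (fun N : V => N 0 j); do 2![eexists]; do ?[constructor];
       rewrite ?mxE// => ? *; rewrite ?mxE//; move=> ?; rewrite !mxE.
  rewrite (_ : (fun _ => _) = f) // diff_lin //.
    by rewrite /= mxE eqxx /= eq_sym.
  exact: coord_continuous.
- exists 1, 1; split => // y z _ _; rewrite mul1r.
  by have := norm_coord_le (y - z) j; rewrite !mxE.
- by move=> i; exact: locally_lipschitz_cst.
Unshelve. all: by end_near. Qed.

Lemma c11D f g F G x : c11_at f F x -> c11_at g G x ->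
  c11_at (fun y => f y + g y) (fun i y => F i y + G i y) x.
Proof.
move=> [df lf lF] [dg lg lG]; split; last 2 first.
- exact: locally_lipschitzD.
- by move=> i; exact: locally_lipschitzD.
apply: filterS2 df dg => y [df hf] [dg hg]; split; first exact: differentiableD.
by move=> i; rewrite deriveD ?hf ?hg//; exact: diff_derivable.
Qed.

Lemma c11M f g F G x : c11_at f F x -> c11_at g G x ->
  c11_at (fun y => f y * g y) (fun i y => f y * G i y + g y * F i y) x.
Proof.
move=> [df lf lF] [dg lg lG]; split; last 2 first.
- exact: locally_lipschitzM.
- by move=> i; apply: locally_lipschitzD; exact: locally_lipschitzM.
apply: filterS2 df dg => y [df hf] [dg hg]; split; first exact: differentiableM.
by move=> i; rewrite deriveM ?hf ?hg//; exact: diff_derivable.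
Qed.

Lemma c11_comp (phi phi' : R -> R) f F x : c11_at f F x ->
  (\forall s \near f x, is_derive (s : R) (1 : R) phi (phi' s)) ->
  locally_lipschitz phi' (f x) ->
  c11_at (fun y => phi (f y)) (fun i y => phi' (f y) * F i y) x.
Proof.
move=> [df lf lF] dphi lphi'; have lphi : locally_lipschitz phi (f x).
  by apply: locally_lipschitz_C1 dphi _; exact: locally_lipschitz_continuous.
split; last 2 first.
- exact: locally_lipschitz_comp.
- by move=> i; apply: locally_lipschitzM => //; exact: locally_lipschitz_comp.
have cf := locally_lipschitz_continuous lf.
have dphi2 : \forall y \near x, is_derive (f y) (1 : R) phi (phi' (f y)) := cf _ dphi.
apply: filterS2 df dphi2 => y [df hf] dp.
have dphi1 : differentiable phi (f y) by apply/derivable1_diffP; case: dp.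
split; first exact: differentiable_comp.
move=> i; rewrite deriveE; last exact: differentiable_comp.
rewrite diff_comp//= -(hf i) deriveE//.
have dphi0 : derivable phi (f y) 1 by case: dp.
rewrite (deriv1E dphi0) /= derive1E (derive_val (is_derive := dp)).
by rewrite /GRing.scale /= mulrC.
Qed.

End C11Calculus.

Section WormBoundary.
Context {R : realType}.
Local Notation V := 'rV[R]_(2 + 2).

(** In R^4 the real parts of both coordinates come before the imaginary parts. *)
Definition i_zx : 'I_(2 + 2) := lshift 2 0.
Definition i_wx : 'I_(2 + 2) := lshift 2 1.
Definition i_zy : 'I_(2 + 2) := rshift 2 0.
Definition i_wy : 'I_(2 + 2) := rshift 2 1.

Lemma index_cases (i : 'I_(2 + 2)) : ((i = i_zx \/ i = i_wx) \/ i = i_zy) \/ i = i_wy.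
Proof.
case: i => -[|[|[|[|//]]]] il.
- by left; left; left; exact: val_inj.
- by left; left; right; exact: val_inj.
- by left; right; exact: val_inj.
- by right; exact: val_inj.
Qed.

Definition height (v : V) : R := log_modulus (v 0 i_zx) (v 0 i_zy).
Definition nondegenerate (v : V) : Prop := 0 < v 0 i_zx ^+ 2 + v 0 i_zy ^+ 2.
Definition defining (v : V) : R := worm_fun (v 0 i_wx) (v 0 i_wy) (height v).

Lemma realify_coords (X : Cspace R 2) : [/\ realify X 0 i_zx = zx X,
  realify X 0 i_wx = wx X, realify X 0 i_zy = zy X & realify X 0 i_wy = wy X].
Proof.
by rewrite /realify /i_zx /i_wx /i_zy /i_wy !row_mxEl !row_mxEr !mxE.
Qed.

Lemma realify_worm : realify @` (@worm R) = [set v | nondegenerate v /\ defining v < 0].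
Proof.
apply/seteqP; split => [_ [X wX <-]|v [z0 P0]].
  by rewrite /= /nondegenerate /defining /height; have [-> -> -> ->] := realify_coords X.
exists (mkpoint (v 0 i_wx) (v 0 i_wy) (v 0 i_zx) (v 0 i_zy)).
  by rewrite /worm /= /lz; have [-> -> -> ->] := mkpointE (v 0 i_wx) (v 0 i_wy) (v 0 i_zx) (v 0 i_zy).
apply/rowP => i; have [c1 c2 c3 c4] := realify_coords (mkpoint (v 0 i_wx) (v 0 i_wy) (v 0 i_zx) (v 0 i_zy)).
have [e1 e2 e3 e4] := mkpointE (v 0 i_wx) (v 0 i_wy) (v 0 i_zx) (v 0 i_zy).
rewrite e1 e2 e3 e4 in c1 c2 c3 c4.
by case: (index_cases i) => [[[->|->]|->]|->].
Qed.

(** The derivative in [t] is multiplied by the gradient [(x / N, y / N)] of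
    [ln |z|]. *)
Definition gradient_entry (i : 'I_(2 + 2)) (v : V) : R :=
  let t := height v in
  let N := v 0 i_zx ^+ 2 + v 0 i_zy ^+ 2 in
  let Pt := v 0 i_wy * sin t + v 0 i_wx * cos t + damping' t in
  (2 * v 0 i_wx + sin t) * (i == i_wx)%:R + (2 * v 0 i_wy - cos t) * (i == i_wy)%:R
  + Pt * ((v 0 i_zx * (i == i_zx)%:R + v 0 i_zy * (i == i_zy)%:R) / N).

Lemma c11_eq n (f g : 'rV[R]_n -> R) F G x : c11_at f F x -> f = g ->
  (forall i y, F i y = G i y) -> c11_at g G x.
Proof.
move=> h <- FG; rewrite (_ : G = F)//; apply/funext => i; apply/funext => y.
by rewrite FG.
Qed.

Lemma cos_locally_lipschitz (s : R) : locally_lipschitz (@cos R) s.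
Proof.
by exists 1, 1; split => // y z _ _; rewrite mul1r; exact: cos_lipschitz.
Qed.

Lemma inv_locally_lipschitz (s : R) : 0 < s -> locally_lipschitz (@GRing.inv R) s.
Proof.
move=> s0; apply: (@locally_lipschitz_C1 _ _ (fun x => - (x ^- 2))).
  have : \forall x \near s, 0 < x by exact: lt_nbhsr.
  apply: filterS => x x0; have xn : id x != 0 by rewrite lt0r_neq0.
  apply: is_derive_eq (is_deriveV xn (is_derive_id x (1 : R))) _.
  by rewrite /GRing.scale /= mulr1.
apply: ctsN; apply: cvgV; first by rewrite expf_neq0// lt0r_neq0.
exact: exprn_continuous.
Qed.

Lemma damping'_locally_lipschitz (s : R) : locally_lipschitz (@damping' R) s.
Proof.
exists (2 * (1 + 36 * expR 2)), 1; split => //.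
by move=> y z _ _; exact: damping'_lipschitz.
Qed.

Lemma defining_c11 v : nondegenerate v -> c11_at defining gradient_entry v.
Proof.
move=> z0.
have ca := c11_coord i_wx v; have cb := c11_coord i_wy v.
have cx := c11_coord i_zx v; have cy := c11_coord i_zy v.
have cN := c11D (c11M cx cx) (c11M cy cy).
have N0 : 0 < v 0 i_zx * v 0 i_zx + v 0 i_zy * v 0 i_zy by rewrite -!expr2.
have dln : \forall s \near (v 0 i_zx * v 0 i_zx + v 0 i_zy * v 0 i_zy), is_derive (s : R) (1 : R) (@ln R) (s^-1).
  have : \forall s \near (v 0 i_zx * v 0 i_zx + v 0 i_zy * v 0 i_zy), 0 < s by exact: lt_nbhsr.
  by apply: filterS => s s0; exact: is_derive1_ln.
have cl := c11_comp cN dln (inv_locally_lipschitz N0).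
have ch := c11M cl (c11_cst (2^-1 : R) v).
have dsin (x : R) : \forall s \near x, is_derive (s : R) (1 : R) (@sin R) (cos s).
  by near=> s; exact: is_derive_sin.
have dcos (x : R) : \forall s \near x, is_derive (s : R) (1 : R) (@cos R) (- sin s).
  by near=> s; exact: is_derive_cos.
have ddam (x : R) : \forall s \near x, is_derive (s : R) (1 : R) (@damping R) (damping' s).
  by near=> s; exact: is_derive_damping.
have lsinN (x : R) : locally_lipschitz (fun s : R => - sin s) x.
  apply: (@locally_lipschitz_C1 _ _ (fun s => - cos s)).
    by near=> s; apply: is_deriveN; exact: is_derive_sin.
  by apply: ctsN; exact: continuous_cos.
have csin := c11_comp ch (dsin _) (cos_locally_lipschitz _).
have ccos := c11_comp ch (dcos _) (lsinN _).
have cdam := c11_comp ch (ddam _) (damping'_locally_lipschitz _).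
have cbc := c11M cb ccos; have cas := c11M ca csin.
have cneg := c11M (c11_cst (-1 : R) v) (c11D cbc (c11M (c11_cst (-1 : R) v) cas)).
have := c11D (c11D (c11D (c11M ca ca) (c11M cb cb)) cneg) cdam.
move=> /c11_eq; apply.
  apply/funext => y; rewrite /defining /worm_fun /height /log_modulus -!expr2.
  by move: (cos _) (sin _) (damping _) => c s e; ring.
move=> i y; rewrite /gradient_entry /= /height /log_modulus !expr2.
set N := y 0 i_zx * y 0 i_zx + y 0 i_zy * y 0 i_zy; move: (ln N) (N^-1) => l M.
move: (cos _) (sin _) (damping' _) => c s e.
move: (i == i_wx)%:R (i == i_wy)%:R (i == i_zx)%:R (i == i_zy)%:R => d1 d2 d3 d4.
by field.
Unshelve. all: by end_near. Qed.

Lemma gradient_defining v : nondegenerate v ->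
  \forall y \near v, gradient defining y = \row_i gradient_entry i y.
Proof.
move=> /defining_c11[d _ _]; apply: filterS d => y [_ h].
by apply/rowP => i; rewrite !mxE h.
Qed.

Lemma nondegenerate_open : open nondegenerate.
Proof.
rewrite openE => v z0; rewrite /interior /nondegenerate.
by apply: (@cts_gt _ _ (fun v : V => v 0 i_zx ^+ 2 + v 0 i_zy ^+ 2)) => //;
  apply: sqr_modulus_continuous; exact: coord_continuous.
Qed.

(** If the derivative in [w] vanishes, [w] is the centre of its disc, so the disc
    is reduced to a point and [damping t = 1 / 4]; then [t] is outside the core, where
    the damping is strictly monotone. *)
Lemma gradient_nonzero v : nondegenerate v -> defining v = 0 ->
  exists i, gradient_entry i v != 0.
Proof.
move=> z0 P0; apply: contrapT => h.
have {}h i : gradient_entry i v = 0.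
  by apply/eqP/negPn/negP => hi; apply: h; exists i.
have tv : - 2^-1 < height v < pi + 2^-1 by apply: (@worm_height _ (v 0 i_wx) (v 0 i_wy)); move: P0; rewrite /defining => ->.
have := h i_wx; have := h i_wy; have := h i_zx; have := h i_zy.
rewrite /gradient_entry !eqxx.
have [-> -> -> ->] : [/\ (i_wx == i_wy) = false, (i_wx == i_zx) = false, (i_wx == i_zy) = false & (i_wy == i_zx) = false] by [].
have [-> -> -> ->] : [/\ (i_wy == i_wx) = false, (i_wy == i_zy) = false, (i_zx == i_wx) = false & (i_zx == i_wy) = false] by [].
have [-> -> -> ->] : [/\ (i_zx == i_zy) = false, (i_zy == i_wx) = false, (i_zy == i_wy) = false & (i_zy == i_zx) = false] by [].
rewrite !mulr0 !mulr1 !addr0 !add0r !mul0r !mulr0 !addr0.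
set N := v 0 i_zx ^+ 2 + _.
set Pt := v 0 i_wy * _ + _ + _ => hy hx hb ha.
have N0 : N != 0 by rewrite lt0r_neq0.
have Pt0 : Pt = 0.
  apply/eqP; apply: contraT => Ptn.
  have x0 : v 0 i_zx = 0.
    by apply/eqP; move/eqP: hx; rewrite !mulf_eq0 (negbTE Ptn) invr_eq0 (negbTE N0) orbF.
  have y0 : v 0 i_zy = 0.
    by apply/eqP; move/eqP: hy; rewrite !mulf_eq0 (negbTE Ptn) invr_eq0 (negbTE N0) orbF.
  by move: N0; rewrite /N x0 y0 expr0n /= addr0 eqxx.
have ea : v 0 i_wx = - (sin (height v) / 2) by lra.
have eb : v 0 i_wy = cos (height v) / 2 by lra.
have d4 : damping (height v) = 4^-1.
  move: P0; rewrite /defining worm_fun_center ea eb addNr subrr expr0n /=; lra.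
have d0 : damping' (height v) = 0.
  by move: Pt0; rewrite /Pt ea eb; lra.
have p0 := pi_gt0 R; have [t1 t2] := andP tv.
have [t0|t0] := ltP (height v) 0.
  have r0 : ramp' (height v - pi) = 0 by apply: ramp'N; lra.
  have r1 : 0 < ramp' (- height v) by apply: ramp'_gt0; lra.
  by move: d0; rewrite /damping' r0; lra.
have [tp|tp] := ltP pi (height v).
  have r0 : ramp' (- height v) = 0 by apply: ramp'N; lra.
  have r1 : 0 < ramp' (height v - pi) by apply: ramp'_gt0; lra.
  by move: d0; rewrite /damping' r0; lra.
by move: d4; rewrite damping_core ?t0//; lra.
Qed.

(** Near a boundary point [z] stays away from [0], since [t > - 1 / 2] on the worm,
    and [defining] is a defining function. *)
Lemma worm_C11 : C11_boundary (realify @` (@worm R)).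
Proof.
rewrite realify_worm; set U := [set v | _].
have cdef v : nondegenerate v -> {for v, continuous defining}.
  by move=> /defining_c11[_ l _]; exact: locally_lipschitz_continuous.
have oU : open U.
  rewrite openE => v [z0 P0]; rewrite /interior /U /=.
  apply: filterI; first exact: (open_nbhs_nbhs (conj nondegenerate_open z0)).
  exact: (cts_lt (cdef _ z0)).
split => //.
- have [X wX] := @worm_nonempty R; exists (realify X).
  by rewrite /U -realify_worm; exists X.
- apply/eqP => UT; have : U 0 by rewrite UT.
  by move=> [] /=; rewrite /nondegenerate !mxE expr0n /= addr0 ltxx.
move=> p [clp nip].
have z0 : nondegenerate p.
  apply: (@lt_le_trans _ _ (expR (- 1))); first exact: expR_gt0.
  have cN : {for p, continuous (fun v : V => v 0 i_zx ^+ 2 + v 0 i_zy ^+ 2)}.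
    by apply: sqr_modulus_continuous; exact: coord_continuous.
  apply: (closure_ge cN clp) => v [zv Pv].
  have /andP[t1 _] := worm_height (ltW Pv).
  have := expR_log_modulus zv; rewrite -sqr_modulus => <-.
  by rewrite -expRM_natl ler_expR; move: t1; rewrite /height; lra.
have P0 : defining p = 0.
  apply/eqP; rewrite eq_le; apply/andP; split.
    rewrite -oppr_ge0; apply: (closure_ge (ctsN (cdef _ z0)) clp) => v [_ Pv].
    by rewrite oppr_ge0 ltW.
  rewrite leNgt; apply/negP => Pn; apply: nip.
  by move: oU; rewrite openE; apply.
exists [set v | nondegenerate v /\ gradient defining v != 0], defining.
have oV : open [set v | nondegenerate v /\ gradient defining v != 0].
  rewrite openE => v [zv gv]; rewrite /interior.
  have gE := gradient_defining zv.
  have [i gi] : exists i, gradient_entry i v != 0.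
    apply: contrapT => h; move/eqP: gv; apply.
    rewrite (nbhs_singleton gE); apply/rowP => i; rewrite !mxE.
    by apply/eqP/negPn/negP => hi; apply: h; exists i.
  have [_ _ lG] := defining_c11 zv.
  have cg := locally_lipschitz_continuous (lG i).
  have ng : \forall y \near v, gradient_entry i y != 0.
    exact: (cg _ (open_nbhs_nbhs (conj (@open_neq _ (0 : R)) gi))).
  have zn : \forall y \near v, nondegenerate y := open_nbhs_nbhs (conj nondegenerate_open zv).
  have near3 : \forall y \near v, nondegenerate y /\
      gradient defining y = \row_j gradient_entry j y /\ gradient_entry i y != 0.
    exact: filterI zn (filterI gE ng).
  apply: (@filterS _ _ (nbhs_filter v) _ _ _ near3) => y [zy [gy ny]]; split; first exact: zy.
  by rewrite gy; apply: contraNneq ny => /rowP/(_ i); rewrite !mxE => ->.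
split => //.
- split => //; have [i gi] := gradient_nonzero z0 P0.
  rewrite (nbhs_singleton (gradient_defining z0)).
  by apply: contraNneq gi => /rowP/(_ i); rewrite !mxE => ->.
- split => v [zv gv].
    by have [d _ _] := defining_c11 zv; have [] := nbhs_singleton d.
  have [_ _ lG] := defining_c11 zv.
  have [L [d [L0 d0 h]]] := locally_lipschitz_uniform lG.
  have /nbhs_ballP[d' /= d0' hE] := gradient_defining zv.
  exists (ball v (Num.min d d')).
    by apply: nbhsx_ballx; rewrite lt_min d0.
  exists L; split; first exact: num_real.
  move=> M /ltW LM [y z] [[/min_ball[y1 y2] _] [/min_ball[z1 z2] _]] /=.
  apply: norm_le_coords => [|j]; first by rewrite mulr_ge0// (le_trans L0).
  rewrite (hE _ y2) (hE _ z2) !mxE; apply: le_trans (h j y z y1 z1) _.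
  by rewrite ler_wpM2r.
- by move=> v [].
by apply/seteqP; split => [v [[zv Pv] [_ gv]]|v [[zv gv] Pv]].
Qed.

End WormBoundary.

(** * Maximum and continuity principles on annuli *)

Section MaximumPrinciple.
Context {R : realType}.
Local Notation C := (complex R : numFieldType).

(** A continuous function that is below [m] at one point is below [m] by a fixed
    amount on an interval. *)
Lemma integral_lt (g : R -> R) (m s : R) : continuous g -> (forall x, g x <= m) ->
  0 < s < 2 * pi -> g s < m ->
  \int[lebesgue_measure]_(t in `[0, 2 * pi]) g t < 2 * pi * m.
Proof.
move=> cg gm /andP[s0 s2] gs; have p0 := pi_gt0 R.
pose h x := m - g x; pose delta := h s / 2.
have d0 : 0 < delta by rewrite /delta /h divr_gt0// subr_gt0.
have ch : continuous h by move=> x; apply: ctsB; [exact: ctsC|exact: cg].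
have ig (f : R -> R) a b : continuous f -> lebesgue_measure.-integrable `[a, b] (EFin \o f).
  move=> cf; apply: continuous_compact_integrable; first exact: segment_compact.
  exact: continuous_subspaceT.
have len (x y : R) : x <= y -> fine (lebesgue_measure (`[x, y] : set R)) = y - x.
  move=> xy; rewrite (lebesgue_measure_itv `[x, y]) /= lte_fin.
  by case: ltP => //= yx; apply/eqP; rewrite eq_sym subr_eq0 eq_le xy yx.
have /nbhs_ballP[d /= d00 hd] : \forall x \near s, delta < h x.
  by apply: cts_gt; [exact: ch|move: d0; rewrite /delta; lra].
pose a := Num.max (s - d / 2) 0; pose b := Num.min (s + d / 2) (2 * pi).
have ab : a < b by by rewrite /a /b gt_max !lt_min; apply/andP; split; apply/andP; split; lra.
have Ih : \int[lebesgue_measure]_(t in `[0, 2 * pi]) h t =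
    2 * pi * m - \int[lebesgue_measure]_(t in `[0, 2 * pi]) g t.
  rewrite RintegralB//; [|by apply: (ig (fun=> m)) => x; exact: cvg_cst|exact: ig].
    by rewrite Rintegral_cst// len ?mulr_ge0 ?(ltW p0)// subr0 mulrC.
rewrite -subr_gt0 -Ih.
apply: (@lt_le_trans _ _ (\int[lebesgue_measure]_(t in `[a, b]) delta)).
  by rewrite Rintegral_cst// len ?(ltW ab)// mulr_gt0// subr_gt0.
apply: (@le_trans _ _ (\int[lebesgue_measure]_(t in `[a, b]) h t)).
  apply: le_Rintegral => //; [by apply: (ig (fun=> delta)) => x; exact: cvg_cst|exact: ig|].
  move=> x; rewrite /= in_itv /= => /andP[ax xb]; apply/ltW/hd.
  move: ax xb; rewrite /a /b ge_max le_min => /andP[? _] /andP[? _].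
  by rewrite /ball /= ltr_norml; apply/andP; split; lra.
rewrite /Rintegral fine_le//; try by apply: integrable_fin_num => //; exact: ig.
apply: ge0_subset_integral => //.
- have := ig h 0 (2 * pi) ch; exact: measurable_int.
- by move=> x _; rewrite lee_fin /h subr_ge0.
move=> x; rewrite /= !in_itv /= => /andP[ax xb].
by move: ax xb; rewrite /a /b ge_max le_min => /andP[_ ->] /andP[_ ->].
Qed.

(** The strong maximum principle on a single disc. *)
Lemma psh_interior_max n (D : set (Cspace R n)) (u : Cspace R n -> R) (z w : Cspace R n) (s : R) :
  (forall X, D X -> {for X, continuous u}) -> plurisubharmonic D (fun z => (u z)%:E) ->
  (forall t : R[i], `|t| <= 1 -> D (z + t *: w)) ->
  (forall t : R[i], `|t| <= 1 -> u (z + t *: w) <= u z) ->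
  0 < s < 2 * pi -> u (z + expi s *: w) = u z.
Proof.
move=> cu [_ _ sub] zwD zwu s02; apply/eqP; rewrite eq_le zwu ?norm_expi//= leNgt.
apply/negP => us; pose g s := u (z + expi s *: w).
have cg : continuous g.
  move=> x; apply: (@continuous_comp _ _ _ (fun s => z + expi s *: w) u).
    by apply: line_continuous; exact: expi_continuous.
  by apply: cu; apply: zwD; rewrite norm_expi.
have gm x : g x <= u z by apply: zwu; rewrite norm_expi.
have := integral_lt cg gm s02 us; rewrite ltNge => /negP; apply.
have := sub z w zwD; have p0 := pi_gt0 R.
have ig : lebesgue_measure.-integrable `[0, 2 * pi] (EFin \o g).
  apply: continuous_compact_integrable; first exact: segment_compact.
  exact: continuous_subspaceT.
rewrite -[X in (_ * X)%E](@fineK _ _); last exact: integrable_fin_num.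
by rewrite -EFinM lee_fin ler_pdivlMl ?mulr_gt0.
Qed.

End MaximumPrinciple.

Section Annuli.
Context {R : realType}.
Implicit Types (X : Cspace R 2) (D : set (Cspace R 2)).

Definition sqz X : R := zx X ^+ 2 + zy X ^+ 2.

Definition annulus (a p q : R) : set (Cspace R 2) :=
  [set X | [/\ wx X = a, wy X = 0 & p <= sqz X <= q]].

Lemma sqz_continuous : continuous sqz.
Proof. exact: zsq_continuous. Qed.

Lemma z_disc X (r : R) (t : R[i]) : let Y := X + t *: mkpoint 0 0 r 0 in
  [/\ zx Y = zx X + r * complex.Re t, zy Y = zy X + r * complex.Im t, wx Y = wx X & wy Y = wy X].
Proof.
rewrite /zx /zy /wx /wy !mxE /=; case: (X 0 0) (X 0 1) t => a b [c d] [p q] /=.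
by split; ring.
Qed.

Lemma norm_le1_ReIm (t : R[i]) : `|t| <= 1 -> `|complex.Re t| <= 1 /\ `|complex.Im t| <= 1.
Proof.
rewrite normc_def lecR -{1}sqrtr1 ler_sqrt// => h.
have k (x : R) : x ^+ 2 <= 1 -> `|x| <= 1 by rewrite -real_normK ?num_real// expr_le1.
by split; apply: k; have := sqr_ge0 (complex.Re t); have := sqr_ge0 (complex.Im t); lra.
Qed.

(** Among the maximum points pick one where [|z|] is largest.  If it were not on
    the boundary of the annulus, a small disc around it would lie in the annulus
    and contain a maximum point with a larger [|z|]. *)
Lemma annulus_max D (u : Cspace R 2 -> R) (a p q M : R) (A := annulus a p q) :
  (forall X, D X -> {for X, continuous u}) -> plurisubharmonic D (fun z => (u z)%:E) ->
  compact A -> A `<=` D ->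
  (forall X, A X -> sqz X = p \/ sqz X = q -> u X <= M) ->
  forall X, A X -> u X <= M.
Proof.
move=> cu pu cA AD uM X0 AX0.
have cuA : {within A, continuous u}.
  by apply: continuous_in_subspaceT => X; rewrite inE => /AD; exact: cu.
have [X1] := compact_EVT_max (ex_intro _ X0 AX0) cA cuA.
rewrite inE => AX1 max1.
have {max1}max1 Y : A Y -> u Y <= u X1 by move=> AY; apply: max1; rewrite inE.
apply: le_trans (max1 _ AX0) _.
pose K := A `&` [set X | u X1 <= u X].
have cK : compact K.
  apply: (subclosed_compact _ cA); last by move=> X [].
  have clA := compact_closed (@norm_hausdorff _ _) cA.
  move=> X clX; have AX : A X.
    by apply: clA => B /clX[Y [[AY _] BY]]; exists Y.
  by split => //; apply: (closure_ge (cu _ (AD _ AX)) clX) => Y [].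
have KX1 : K X1 by split; [exact: AX1|exact: lexx].
have [X] := compact_EVT_max (ex_intro _ X1 KX1) cK (continuous_subspaceT sqz_continuous).
rewrite inE => -[AX uX] max2.
apply: (le_trans uX).
have [wa wb /andP[pX qX]] := AX.
have [pe|pX'] := eqVneq (sqz X) p; first by apply: uM AX _; left.
have [qe|qX'] := eqVneq (sqz X) q; first by apply: uM AX _; right.
have {pX'}pX' : p < sqz X by rewrite lt_neqAle eq_sym pX' pX.
have {qX'}qX' : sqz X < q by rewrite lt_neqAle qX' qX.
exfalso.
have /nbhs_CspaceP[e e0 eX] : \forall Y \near X, p < sqz Y /\ sqz Y < q.
  by apply: filterI; [exact: (cts_gt (@sqz_continuous X))|exact: (cts_lt (@sqz_continuous X))].
pose r := e / 2.
have r0 : 0 < r by rewrite /r divr_gt0.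
have XA (t : R[i]) : `|t| <= 1 -> A (X + t *: mkpoint 0 0 r 0).
  move=> /norm_le1_ReIm[t1 t2]; have [Y1 Y2 Y3 Y4] := z_disc X r t.
  rewrite /A /annulus /= Y3 Y4; split => //.
  have rs (x : R) : `|x| <= 1 -> `|r * x| < e.
    move=> x1; rewrite normrM gtr0_norm//; apply: (@le_lt_trans _ _ (r * 1)); first by rewrite ler_pM2l.
    by rewrite mulr1 /r; lra.
  suff [k1 k2] : p < sqz (X + t *: mkpoint 0 0 r 0) /\ sqz (X + t *: mkpoint 0 0 r 0) < q.
    by rewrite !ltW.
  apply: eX => i; have [->|->] : i = 0 \/ i = 1.
  - by move: i; case=> -[|[|//]] j; [left|right]; exact: val_inj.
  - rewrite -/(zx _) -/(zy _) -/(zx X) -/(zy X) Y1 Y2.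
    by rewrite [_ - zx X]addrAC [_ - zy X]addrAC !subrr !add0r; split; exact: rs.
  - by rewrite -/(wx _) -/(wy _) -/(wx X) -/(wy X) Y3 Y4 !subrr normr0.
(* moving vertically away from the real axis increases [|z|] *)
pose s : R := if 0 <= zy X then pi / 2 else 3 * pi / 2.
have [p0 pi0] : 0 < pi :> R /\ 0 < s < 2 * pi.
  have := pi_gt0 R => p0; split => //; rewrite /s; case: ifP => _; apply/andP; split; lra.
have us := psh_interior_max cu pu (fun t t1 => AD _ (XA t t1))
  (fun t t1 => le_trans (max1 _ (XA t t1)) uX) pi0.
have KY : K (X + expi s *: mkpoint 0 0 r 0).
  by split; [apply: XA; rewrite norm_expi|rewrite /= us].
have := max2 (X + expi s *: mkpoint 0 0 r 0); rewrite inE => /(_ KY).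
have [Y1 Y2 Y3 Y4] := z_disc X r (expi s).
rewrite /sqz Y1 Y2 /expi /= /s.
have r2 : 0 < r ^+ 2 by rewrite exprn_gt0.
case: ifP => [y0|/negbT]; last rewrite -ltNge => y0.
  rewrite cos_pihalf sin_pihalf.
  have : 0 <= r * zy X by rewrite mulr_ge0// ltW.
  lra.
have -> : 3 * pi / 2 = pi / 2 + pi :> R by lra.
rewrite cosDpi sinDpi cos_pihalf sin_pihalf.
have : 0 <= r * - zy X by rewrite mulr_ge0// ?oppr_ge0 ltW.
lra.
Qed.

End Annuli.

Section ContinuityPrinciple.
Context {R : realType}.
Implicit Types (X : Cspace R 2).
Local Notation T2 := (R * Cspace R 2)%type.

Lemma closure_eq0 (T : topologicalType) (f : T -> R) (S : set T) (X : T) :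
  {for X, continuous f} -> closure S X -> (forall Y, S Y -> f Y = 0) -> f X = 0.
Proof.
move=> cf clX f0; apply/eqP; rewrite eq_le; apply/andP; split.
  rewrite -oppr_ge0; apply: (closure_ge (ctsN cf) clX) => Y SY.
  by rewrite f0// oppr0.
by apply: (closure_ge cf clX) => Y SY; rewrite f0.
Qed.

(** The continuity principle for a family of annuli whose boundary circles remain
    in a pseudoconvex open set [W].  At the first parameter for which an annulus
    leaves [W], some point outside [W] is a limit of points of the previous
    annuli; on these the exhaustion is bounded, uniformly by the maximum
    principle, so the limit is in [W]. *)
Lemma annuli_principle (W : set (Cspace R 2)) (a p q : R -> R) (T M : R) :
  open W -> pseudoconvex W -> continuous a -> continuous p -> continuous q ->
  (forall s : R, 0 <= s <= T -> `|a s| <= M /\ q s <= M ^+ 2) -> 0 <= M ->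
  annulus (a 0) (p 0) (q 0) `<=` W ->
  (forall (s : R) X, 0 <= s <= T -> annulus (a s) (p s) (q s) X ->
     sqz X = p s \/ sqz X = q s -> W X) ->
  forall s : R, 0 <= s <= T -> annulus (a s) (p s) (q s) `<=` W.
Proof.
move=> oW [u [cuW pu exhaust]] ca cp cq bM M0 A0 bW.
have cu X : W X -> {for X, continuous u}.
  by move=> WX; move: cuW; rewrite continuous_open_subspace//; apply; rewrite inE.
pose F : set T2 := [set x | 0 <= x.1 <= T /\ annulus (a x.1) (p x.1) (q x.1) x.2].
have c1 (x : T2) : {for x, continuous (fun y : T2 => y.1)} by exact: cvg_fst.
have c2 (x : T2) : {for x, continuous (fun y : T2 => y.2)} by exact: cvg_snd.
have cc (f : R -> R) (x : T2) : continuous f -> {for x, continuous (fun y : T2 => f y.1)}.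
  by move=> cf; exact: (cts_comp (c1 x) (cf x.1)).
have cX (f : Cspace R 2 -> R) (x : T2) : {for x.2, continuous f} -> {for x, continuous (fun y : T2 => f y.2)}.
  by move=> cf; apply: (@continuous_comp _ _ _ (fun y : T2 => y.2) f).
have csq (x : T2) := cX _ x (@sqz_continuous R x.2).
have clF : closed F.
  move=> x clx.
  have h (f : T2 -> R) : {for x, continuous f} -> (forall y, F y -> 0 <= f y) -> 0 <= f x.
    by move=> cf; exact: (closure_ge cf clx).
  have t0 : 0 <= x.1 by apply: (h (fun y => y.1)) => // y [/andP[]].
  have t1 : 0 <= T - x.1.
    apply: (h (fun y => T - y.1)) => [|y [/andP[_ y1] _]]; last by rewrite subr_ge0.
    by apply: ctsB => //; exact: ctsC.
  have x0 : wx x.2 - a x.1 = 0.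
    apply: (closure_eq0 (ctsB (cX _ x (@wx_continuous R x.2)) (cc _ x ca)) clx).
    by move=> y [_ [-> _ _]]; rewrite subrr.
  have y0 : wy x.2 = 0.
    by apply: (closure_eq0 (cX _ x (@wy_continuous R x.2)) clx) => y [_ []].
  have p0 : 0 <= sqz x.2 - p x.1.
    apply: (h (fun y => sqz y.2 - p y.1)) => [|y [_ [_ _ /andP[? _]]]]; last by rewrite subr_ge0.
    exact: ctsB (csq x) (cc _ x cp).
  have q0 : 0 <= q x.1 - sqz x.2.
    apply: (h (fun y => q y.1 - sqz y.2)) => [|y [_ [_ _ /andP[_ ?]]]]; last by rewrite subr_ge0.
    exact: ctsB (cc _ x cq) (csq x).
  split; first by rewrite t0 -subr_ge0.
  by split; [apply/eqP; rewrite -subr_eq0 x0|exact: y0|rewrite -subr_ge0 p0 -subr_ge0].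
have cF : compact F.
  apply: (@subclosed_compact _ F (`[0, T] `*` [set X : Cspace R 2 | forall i,
    `|complex.Re (X 0 i)| <= M /\ `|complex.Im (X 0 i)| <= M])).
  - exact: clF.
  - by apply: compact_setX; [exact: segment_compact|exact: box_compact].
  move=> [s X] [/= sT [wa wb /andP[_ Xq]]]; split => /=; first by rewrite in_itv.
  have [aM qM] := bM s sT.
  have small (x : R) : x ^+ 2 <= sqz X -> `|x| <= M.
    move=> xX; rewrite -(@ler_pXn2r _ 2) ?nnegrE// real_normK ?num_real//.
    exact: le_trans xX (le_trans Xq qM).
  move=> i; have [->|->] : i = 0 \/ i = 1.
  + by move: i; case=> -[|[|//]] j; [left|right]; exact: val_inj.
  + by split; apply: small; rewrite /sqz ?lerDl ?lerDr ?sqr_ge0.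
  + by rewrite -/(wx X) -/(wy X) wa wb normr0.
have bW' (x : T2) : F x -> sqz x.2 = p x.1 \/ sqz x.2 = q x.1 -> W x.2 by move=> [h1 h2]; exact: bW h2.
have [K uK] : exists K, forall x : T2, F x -> sqz x.2 = p x.1 \/ sqz x.2 = q x.1 -> u x.2 <= K.
  pose B := F `&` [set x | (sqz x.2 - p x.1) * (sqz x.2 - q x.1) = 0].
  have cB : compact B.
    apply: (subclosed_compact _ cF) => [x clx|x []//]; split.
      by apply: clF => N /clx[y [[Fy _] Ny]]; exists y.
    apply: (@closure_eq0 _ (fun x => (sqz x.2 - p x.1) * (sqz x.2 - q x.1)) B x _ clx) => [|y []//].
    exact: (ctsM (ctsB (csq x) (cc _ x cp)) (ctsB (csq x) (cc _ x cq))).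
  have BP x : F x -> sqz x.2 = p x.1 \/ sqz x.2 = q x.1 -> B x.
    by move=> Fx h; split => //=; case: h => ->; rewrite subrr ?mulr0 ?mul0r.
  have BW x : B x -> W x.2.
    move=> [Fx /eqP]; rewrite mulf_eq0 !subr_eq0 => /orP h; apply: bW' => //.
    by case: h => /eqP; [left|right].
  have [[x0 Bx0]|Bn] := pselect (B !=set0); last first.
    by exists 0 => x Fx h; exfalso; apply: Bn; exists x; exact: BP.
  have cuB : {within B, continuous (fun x : T2 => u x.2)}.
    apply: continuous_in_subspaceT => x; rewrite inE => /BW Wx.
    exact: cX (cu _ Wx).
  have [x1 _ mx] := compact_EVT_max (ex_intro _ x0 Bx0) cB cuB.
  by exists (u x1.2) => x Fx h; apply: mx; rewrite inE; exact: BP.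
move=> s sT X AX; apply: contrapT => nWX.
pose E := F `&` [set x | ~ W x.2].
have cE : compact E.
  apply: (subclosed_compact _ cF) => [x clx|x []//]; split.
    by apply: clF => N /clx[y [[Fy _] Ny]]; exists y.
  move=> Wx; have nW : \forall y \near x, W y.2.
    by apply: (c2 x); exact: open_nbhs_nbhs.
  by have [y [[_ ny] Wy]] := clx _ nW.
have Ex0 : E (s, X) by [].
have [[t Y]] := compact_EVT_min (ex_intro _ (s, X) Ex0) cE (continuous_subspaceT c1).
rewrite inE => -[[tT AY] nWY] /= tmin.
have {}tmin t' : 0 <= t' < t -> annulus (a t') (p t') (q t') `<=` W.
  move=> /andP[t0 tt] Z AZ; apply: contrapT => nWZ.
  have : (t', Z) \in E.
    by rewrite inE; split => //; split => //=; rewrite t0 ltW// (lt_le_trans tt)//; case/andP: tT.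
  by move=> /tmin /=; rewrite leNgt tt.
have t0 : 0 < t.
  have /andP[] := tT; rewrite le_eqVlt => /predU1P[t0|//] _.
  by exfalso; apply: nWY; apply: A0; rewrite t0.
have [wY wbY /andP[pY qY]] := AY.
have {}pY : p t < sqz Y.
  rewrite lt_neqAle pY andbT; apply/eqP => h; apply: nWY; apply: (bW t) => //=.
  by left.
have {}qY : sqz Y < q t.
  rewrite lt_neqAle qY andbT; apply/eqP => h; apply: nWY; apply: (bW t) => //=.
  by right.
apply: nWY; have [_] := exhaust (K + 1); apply.
pose Z (t' : R) := mkpoint (a t') 0 (zx Y) (zy Y).
have ZY : Z t = Y by rewrite /Z -wY -{1}wbY -mkpoint_eta.
have cZ : {for t, continuous Z}.
  by apply: (@mkpoint_continuous _ _ a (fun=> 0) (fun=> zx Y) (fun=> zy Y)); [exact: ca|exact: ctsC|exact: ctsC|exact: ctsC].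
move=> N; rewrite -ZY => nN.
have h : \forall t' \near t, N (Z t') /\ p t' < sqz Y /\ sqz Y < q t'.
  apply: filterI; first exact: cZ.
  by apply: filterI; [exact: (cts_lt (cp t))|exact: (cts_gt (cq t))].
have [t' [[NZ [p' q']] t'0 t't]] : exists t' : R, [/\ N (Z t') /\ p t' < sqz Y /\ sqz Y < q t', 0 < t' & t' < t].
  apply: (@filter_ex _ (t : R)^'-); near=> t'; split.
  - by near: t'; apply: cvg_within; exact: h.
  - by near: t'; exact: nbhs_left_gt.
  - by near: t'; exact: nbhs_left_lt.
have t't' : 0 <= t' < t by rewrite ltW.
have t'T : 0 <= t' <= T.
  by case/andP: tT => _ tT; rewrite ltW//= (le_trans (ltW t't)).
exists (Z t'); split => //.
have [Z1 Z2 Z3 Z4] := mkpointE (a t') 0 (zx Y) (zy Y).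
have AZ : annulus (a t') (p t') (q t') (Z t').
  by split => //; rewrite /sqz Z1 Z2 -/(sqz Y) !ltW.
split; first exact: tmin AZ.
have cA : compact (annulus (a t') (p t') (q t')).
  have -> : annulus (a t') (p t') (q t') = (fun x : T2 => x.2) @` (F `&` [set x | x.1 - t' = 0]).
    apply/seteqP; split => [V AV|_ [[r V] [[/= _ AV] rt]] <-].
      by exists (t', V) => //; split => //=; rewrite subrr.
    by have /eqP := rt; rewrite /= subr_eq0 => /eqP <-.
  apply: continuous_compact; first exact: continuous_subspaceT.
  apply: (subclosed_compact _ cF) => [x clx|x []//]; split.
    by apply: clF => O /clx[y [[Fy _] Oy]]; exists y.
  have cd : {for x, continuous (fun y : T2 => y.1 - t')} := ctsB (c1 x) (@ctsC _ _ t' x).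
  by apply: (closure_eq0 cd clx) => y [].
apply: (@le_lt_trans _ _ K); last by rewrite ltrDl.
apply: (annulus_max cu pu cA (tmin _ t't')) AZ => V AV.
exact: (uK (t', V)).
Unshelve. all: by end_near. Qed.

End ContinuityPrinciple.

(** * Failure of s-H-convexity *)

Section NotHConvex.
Context {R : realType}.
Implicit Types (X Y : Cspace R 2).

Lemma euclidean_normE X : euclidean_norm X =
  Num.sqrt (zx X ^+ 2 + zy X ^+ 2 + wx X ^+ 2 + wy X ^+ 2).
Proof.
rewrite /euclidean_norm big_ord_recl big_ord1 /zx /zy /wx /wy.
by have -> : lift ord0 ord0 = 1 :> 'I_2 by [exact: val_inj]; rewrite !addrA.
Qed.

Lemma coordsB X Y : [/\ zx (X - Y) = zx X - zx Y, zy (X - Y) = zy X - zy Y,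
  wx (X - Y) = wx X - wx Y & wy (X - Y) = wy X - wy Y].
Proof.
rewrite /zx /zy /wx /wy !mxE; by case: (X 0 0) (X 0 1) (Y 0 0) (Y 0 1) => [? ?] [? ?] [? ?] [? ?].
Qed.

Lemma coords_le_euclidean_norm X :
  [/\ `|zx X| <= euclidean_norm X, `|zy X| <= euclidean_norm X,
      `|wx X| <= euclidean_norm X & `|wy X| <= euclidean_norm X].
Proof.
rewrite euclidean_normE.
have := sqr_ge0 (zx X); have := sqr_ge0 (zy X); have := sqr_ge0 (wx X); have := sqr_ge0 (wy X).
move=> h1 h2 h3 h4.
by split; rewrite -sqrtr_sqr ler_wsqrtr//; lra.
Qed.

Lemma euclidean_dist_le n (K : set (Cspace R n)) (X Y : Cspace R n) : K Y ->
  euclidean_dist X K <= euclidean_norm (X - Y).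
Proof.
move=> KY; apply: ge_inf; last by exists Y.
by exists 0 => _ [Z _ <-]; exact: sqrtr_ge0.
Qed.

Lemma euclidean_dist_lt n (K : set (Cspace R n)) (X : Cspace R n) (e : R) : K !=set0 ->
  euclidean_dist X K < e -> exists2 Y, K Y & euclidean_norm (X - Y) < e.
Proof.
move=> [Y0 KY0] /inf_lt[|_ [Y KY <-] h]; last by exists Y.
by exists (euclidean_norm (X - Y0)); exists Y0.
Qed.

(** The disc over the end circle has centre [sin tau / 2 + (i / 2) cos tau] up to
    symmetry and squared radius [cos tau ^ 2 / 4 - flat tau]: it misses the real
    point [sin tau / 2] by less than [4 flat tau]. *)
Lemma end_circle_close (tau : R) X : 0 < tau <= 2^-1 -> flat tau <= 16^-1 ->
  wx X = sin tau / 2 -> wy X = 0 ->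
  sqz X = expR (- (2 * tau)) \/ sqz X = expR (2 * (pi + tau)) ->
  euclidean_dist X closed_worm <= 4 * flat tau.
Proof.
move=> /andP[t0 t2] f1 wa wb zt.
have f0 := flat_gt0 tau.
have z0 : 0 < zx X ^+ 2 + zy X ^+ 2 by rewrite -/(sqz X); case: zt => ->; exact: expR_gt0.
have c2 : 2^-1 <= cos tau.
  have := cos_ge1sub tau; have : tau ^+ 2 <= 2^-1 by nra.
  lra.
have P0 : worm_fun (sin tau / 2) (4 * flat tau) (- tau) <= 0.
  rewrite /worm_fun damping_neg ?oppr_le0 ?(ltW t0)// opprK rampP// cosN sinN.
  have : flat tau * (16 * flat tau - 4 * cos tau + 1) <= 0 by rewrite pmulr_rle0//; lra.
  lra.
have [b [bf Pb]] : exists b, `|b| = 4 * flat tau /\ worm_fun (sin tau / 2) b (lz X) <= 0.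
  case: zt => zt.
    exists (4 * flat tau); split; first by rewrite gtr0_norm ?mulr_gt0.
    rewrite /lz /log_modulus -/(sqz X) zt expRK.
    by have -> : - (2 * tau) / 2 = - tau by lra.
  exists (- (4 * flat tau)); split; first by rewrite normrN gtr0_norm ?mulr_gt0.
  rewrite /lz /log_modulus -/(sqz X) zt expRK.
  have -> : 2 * (pi + tau) / 2 = pi - - tau by lra.
  by rewrite worm_fun_sym.
have [Y1 Y2 Y3 Y4] := mkpointE (wx X) b (zx X) (zy X).
have KY : closed_worm (mkpoint (wx X) b (zx X) (zy X)).
  by rewrite /closed_worm /= /lz Y1 Y2 Y3 Y4 wa.
apply: le_trans (euclidean_dist_le X KY) _.
rewrite euclidean_normE; have [-> -> -> ->] := coordsB X (mkpoint (wx X) b (zx X) (zy X)).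
rewrite Y1 Y2 Y3 Y4 wb !subrr expr0n /= !add0r sqrrN sqrtr_sqr bf.
exact: lexx.
Qed.

Lemma core_annulus X : annulus 0 1 (expR (2 * pi)) X -> closed_worm X.
Proof.
move=> [wa wb /andP[z1 z2]].
have z0 : 0 < sqz X by lra.
split => //; rewrite wa wb /worm_fun damping_core; first by rewrite !mul0r expr0n /=; lra.
rewrite /lz /log_modulus -/(sqz X); apply/andP; split.
  by rewrite divr_ge0// ln_ge0.
have : ln (sqz X) <= 2 * pi by rewrite -[leRHS]expRK ler_ln ?posrE ?expR_gt0.
lra.
Qed.

(** Near the middle height the disc lies on the side [a < 0] up to its boundary
    point [0], so a point with [a > 2 e] and [|b| < e] is outside. *)
Lemma middle_circle_far (e : R) Y : 0 < e <= 6^-1 -> closed_worm Y ->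
  e <= euclidean_norm (mkpoint (3 * e) 0 (expR (pi / 2)) 0 - Y).
Proof.
move=> /andP[e0 e6] [z0 P0]; rewrite leNgt; apply/negP => h.
set X := mkpoint _ _ _ _ in h.
have [h1 h2 h3 h4] := coords_le_euclidean_norm (X - Y).
have [k1 k2 k3 k4] := coordsB X Y.
have [X1 X2 X3 X4] := mkpointE (3 * e) 0 (expR (pi / 2)) 0.
move: h1 h2 h3 h4; rewrite k1 k2 k3 k4 X1 X2 X3 X4 !sub0r normrN (normrN (wy Y)).
move=> /le_lt_trans/(_ h); rewrite ltr_norml => /andP[x1 x2].
move=> /le_lt_trans/(_ h); rewrite ltr_norml => /andP[y1 y2].
move=> /le_lt_trans/(_ h); rewrite ltr_norml => /andP[a1 a2].
move=> /le_lt_trans/(_ h) b1.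
have E2 : 2 <= expR (pi / 2) :> R.
  have := @expR_ge1Dx R (pi / 2); have := @pihalf_ge1 R; lra.
set E := expR (pi / 2) in E2 x1 x2.
have e2 : 4 <= expR 2 :> R.
  have -> : 2 = 1 + 1 :> R by lra.
  by rewrite expRD; have := @expR_ge1Dx R 1; nra.
have zl : E ^+ 2 / 4 <= sqz Y.
  have : E / 2 <= zx Y by lra.
  move=> hx; have := sqr_ge0 (zy Y); rewrite /sqz; nra.
have zu : sqz Y <= 4 * E ^+ 2.
  rewrite /sqz; have : zy Y ^+ 2 <= e ^+ 2 by nra.
  have : zx Y ^+ 2 <= (E + e) ^+ 2 by nra.
  nra.
have EE : E ^+ 2 = expR pi by rewrite /E -expRM_natl; congr expR; lra.
have {}zl : pi <= 2 + 2 * lz Y.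
  rewrite -ler_expR [expR (2 + _)]expRD -(lz_expR z0) -EE -/(sqz Y).
  have : 0 < sqz Y := z0; nra.
have {}zu : 2 * lz Y <= 2 + pi.
  rewrite -ler_expR [expR (2 + _)]expRD -(lz_expR z0) -EE -/(sqz Y).
  have : 0 < sqz Y := z0; nra.
have s2 : 2^-1 <= sin (lz Y).
  rewrite -cosBpihalf; have := cos_ge1sub (lz Y - pi / 2).
  have : (lz Y - pi / 2) ^+ 2 <= 1.
    have : -1 <= lz Y - pi / 2 <= 1 by lra.
    move: (lz Y - pi / 2) => y /andP[]; nra.
  lra.
have bc : wy Y * cos (lz Y) <= e.
  apply: le_trans (ler_norm _) _; rewrite normrM.
  have c1 : `|cos (lz Y)| <= 1 by rewrite ler_norml cos_geN1 cos_le1.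
  by apply: le_trans (ltW b1); apply: ler_piMr.
have as1 : e < wx Y * sin (lz Y) by nra.
have := damping_ge0 (lz Y); have := sqr_ge0 (wx Y); have := sqr_ge0 (wy Y).
by move: P0; rewrite /worm_fun; lra.
Qed.

Lemma flat_small (C : R) N : 0 < C -> exists2 T : R, 0 < T <= 2^-1 & 4 * flat T < C * (sin T / 6) ^+ N.
Proof.
move=> C0; pose B : R := 8 * expR 2 * N.+1`!%:R * 12 ^+ N.
have f0 : 0 < N.+1`!%:R :> R by rewrite ltr0n fact_gt0.
have B0 : 0 < B by rewrite /B !mulr_gt0 ?expR_gt0 ?exprn_gt0.
pose T := Num.min 2^-1 (C / B).
have T0 : 0 < T by rewrite /T lt_min invr_gt0 ltr0n /= divr_gt0.
have T2 : T <= 2^-1 by rewrite /T ge_min lexx.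
exists T; first by rewrite T0.
have TB : B * T <= C by rewrite mulrC -ler_pdivlMr// /T ge_min lexx orbT.
have sT : T / 12 <= sin T / 6.
  have := @sin_ge_half R T; rewrite (ltW T0) T2 => /(_ isT); lra.
have T12 : (T / 12) ^+ N <= (sin T / 6) ^+ N.
  by rewrite lerXn2r ?nnegrE//; lra.
apply: (@lt_le_trans _ _ (C * (T / 12) ^+ N)); last by rewrite ler_pM2l.
have TN : 0 < (T / 12) ^+ N by rewrite exprn_gt0// divr_gt0.
have fl := flat_le N T0.
apply: (@le_lt_trans _ _ (4 * (expR 2 * N.+1`!%:R * T ^+ N.+1))); first by rewrite ler_pM2l.
apply: (@lt_le_trans _ _ (B * T * (T / 12) ^+ N)); last by rewrite ler_pM2r.
have -> : B * T * (T / 12) ^+ N = 8 * (expR 2 * N.+1`!%:R * T ^+ N.+1).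
  rewrite /B expr_div_n exprS; move: (expR 2) (T ^+ N) => x y.
  have : (12 : R) ^+ N != 0 by rewrite expf_neq0.
  by move: ((12 : R) ^+ N) => z z0; field.
rewrite ltr_pM2r; first lra.
by rewrite !mulr_gt0 ?expR_gt0 ?exprn_gt0.
Qed.

(** The scale is chosen as [e = sin T / 6], so that the last annulus is [w = 3 e]:
    it is at distance at least [e] from the closed worm, although the end circles of
    all annuli up to it are within [4 flat T < C e^s]. *)
Lemma worm_not_s_H_convex (s : R) : 1 <= s -> ~ s_H_convex s (@closed_worm R).
Proof.
move=> s1 [C /andP[C0 C1] hC].
pose N := (Num.truncn s).+1.
have sN : s <= N%:R by apply/ltW/truncnS_gt.
have [T /andP[T0 T2] fT] := @flat_small C N C0.
pose e := sin T / 6.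
have p1 := @pihalf_ge1 R.
have sT0 : 0 < sin T by apply: sin_gt0_pihalf; lra.
have sT1 : sin T <= 1 by exact: sin_le1.
have e01 : 0 < e <= 1 by rewrite /e; apply/andP; split; lra.
have [e0 e1] := andP e01; have e6 : e <= 6^-1 by rewrite /e; lra.
have [W [oW pW sub1 sub2]] := hC e e01.
have eN : e ^+ N <= e `^ s by rewrite -powR_mulrn ?(ltW e0)// ger_powR.
have {}fT : 4 * flat T < C * e `^ s.
  by apply: (lt_le_trans fT); rewrite ler_pM2l.
have Ce : 4 * flat T <= e.
  apply: (le_trans (ltW fT)); rewrite -[leRHS]mul1r; apply: ler_pM => //; first exact: ltW.
    exact: powR_ge0.
  by rewrite -[leRHS]powRr1 ?(ltW e0)// ger_powR.
have fle (tau : R) : 0 < tau <= T -> flat tau <= flat T.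
  move=> /andP[t0 tT]; rewrite /flat ler_expR lerD2l lerN2 lef_pV2 ?posrE//.
have near_worm X (r : R) : r <= 4 * flat T -> euclidean_dist X closed_worm <= r -> W X.
  by move=> h1 h2; apply: sub1; apply: (le_lt_trans h2); apply: (le_lt_trans h1).
have coreW X : annulus 0 1 (expR (2 * pi)) X -> W X.
  move=> /core_annulus KX; apply: (near_worm X 0).
    by rewrite mulr_ge0// ltW// flat_gt0.
  apply: (le_trans (euclidean_dist_le X KX)).
  by rewrite subrr euclidean_normE /zx /zy /wx /wy !mxE /= expr0n /= !addr0 sqrtr0.
pose a (t : R) := sin t / 2; pose p (t : R) := expR (- (2 * t)); pose q (t : R) := expR (2 * (pi + t)).
have ca : continuous a by move=> t; exact: (ctsM (@continuous_sin R t) (@ctsC _ _ (2^-1 : R) t)).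
have cp : continuous p.
  move=> t; have c2 : {for t, continuous (fun t : R => 2 * t)} by apply: ctsM; [exact: ctsC|exact: cvg_id].
  exact: (cts_comp (ctsN c2) (@continuous_expR R _)).
have cq : continuous q.
  move=> t; have c1 : {for t, continuous (fun t : R => pi + t)} by apply: ctsD; [exact: ctsC|exact: cvg_id].
  have c2 : {for t, continuous (fun t : R => 2 * (pi + t))} by apply: ctsM => //; exact: ctsC.
  exact: (cts_comp c2 (@continuous_expR R _)).
have XT : annulus (a T) (p T) (q T) (mkpoint (3 * e) 0 (expR (pi / 2)) 0).
  have [X1 X2 X3 X4] := mkpointE (3 * e) 0 (expR (pi / 2)) 0.
  split => //; first by rewrite X3 /a /e; lra.
  by rewrite /sqz X1 X2 expr0n addr0 -expRM_natl !ler_expR; apply/andP; split; lra.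
have : W (mkpoint (3 * e) 0 (expR (pi / 2)) 0).
  apply: (@annuli_principle R W a p q T (expR (pi + 1)) oW pW ca cp cq _ _ _ _ T _ _ XT).
  - move=> t /andP[t0 tT]; split.
      rewrite /a normrM; have := @sin_le1 R t; have := @sin_geN1 R t => h1 h2.
      have : `|sin t| <= 1 by rewrite ler_norml h1 h2.
      have : 1 <= expR (pi + 1) :> R by rewrite -[leLHS]expR0 ler_expR; lra.
      rewrite [`|2^-1|]gtr0_norm//; lra.
    by rewrite /q -expRM_natl ler_expR; lra.
  - exact: expR_ge0.
  - move=> X; rewrite /a /p /q sin0 mul0r mulr0 oppr0 expR0 addr0; exact: coreW.
  - move=> t X /andP[t0 tT] AX zX.
    move: t0; rewrite le_eqVlt => /predU1P[t0|t0].
      by apply: coreW; move: AX; rewrite -t0 /a /p /q sin0 mul0r mulr0 oppr0 expR0 addr0.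
    have [wa wb _] := AX; have ft : flat t <= flat T by apply: fle; rewrite t0.
    apply: (near_worm X (4 * flat t)); first by rewrite ler_pM2l.
    apply: end_circle_close => //; last lra.
    by rewrite t0 (le_trans tT).
  - by rewrite (ltW T0) lexx.
move=> /sub2 /euclidean_dist_lt[|Y KY]; first by have [X wX] := @worm_nonempty R; exists X; case: wX => ? /ltW.
apply/negP; rewrite -leNgt; apply: middle_circle_far => //.
by rewrite e0.
Qed.

End NotHConvex.

(** * The domain *)

Theorem theorem1p1 (R : realType) :
  exists Omega : set (Cspace R 2),
    [/\ Omega !=set0, bounded_set Omega, open Omega, connected Omega
      & pseudoconvex Omega] /\
    C11_boundary (realify @` Omega) /\
    Stein_neighborhood_basis (closure Omega) /\
    (forall s : R, 1 <= s -> ~ s_H_convex s (closure Omega)).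
Proof.
exists worm; split; last split; last split.
- split; [exact: worm_nonempty|exact: worm_bounded|exact: worm_open
    |exact: worm_connected|exact: worm_pseudoconvex].
- exact: worm_C11.
- by rewrite closure_worm; exact: closed_worm_Stein.
- by rewrite closure_worm; exact: worm_not_s_H_convex.
Qed.
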